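(* Let $r\ge 1$. Let $\Gamma$ be an $r$-generic loop of loops of genus $g$ and $\pi \colon \widetilde{\Gamma} \to \Gamma$ the quotient by the antipodal involution. Then \[ V^r (\Gamma,\pi) = \bigcup_Q T(Q), \] where the union is over all lingering words $Q$ of length $g-1$ in the Coxeter group $A_r$ that contain a reduced subword for $w_0$.
   Context: Divisors on metric graphs. $\mathrm{PL}(\Gamma)$ is the set of continuous piecewise linear functions with integer slopes on $\Gamma$; $\mathrm{ord}_p(\varphi)$ is the sum of the incoming slopes of $\varphi$ at $p$, $\mathrm{div}(\varphi)=\sum_p \mathrm{ord}_p(\varphi)\,p$; divisors are linearly equivalent if they differ by some $\mathrm{div}(\varphi)$; $\mathrm{Pic}(\Gamma)$ is the group of classes. $\mathrm{rk}$ is the Baker-Norine rank: $\mathrm{rk}(D)$ is the largest $r$ such that $D-E$ is equivalent to an effective divisor for every effective $E$ of degree $r$ ($-1$ if $D$ is not equivalent to an effective divisor). $K_\Gamma=\sum_p(\mathrm{val}(p)-2)p$. Loop of loops. For $g\ge 2$, a loop of loops of genus $g$ is a metric graph $\Gamma$ with vertices $v_j,w_j$ ($j\in\mathbb Z/(g-1)\mathbb Z$), with two edges joining $v_j$ to $w_j$ (forming the loop $\gamma_j$) and one edge $\beta_j$ joining $w_{j-1}$ to $v_j$; edge lengths are arbitrary positive reals. $\ell(\gamma_j)$ is the total length of $\gamma_j$; $\ell(v_j,w_j)$ is the length of a fixed one of its two edges, and $\gamma_j$ is oriented so that this edge is traversed from $v_j$ to $w_j$. The torsion order $m_j$ is $0$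 if $\ell(v_j,w_j)/\ell(\gamma_j)$ is irrational, and otherwise the least positive integer with $m_j\ell(v_j,w_j)\in\ell(\gamma_j)\mathbb Z$. $\Gamma$ is $r$-generic if for every $j$ either $m_j=0$ or $m_j\ge r$. The cover. $\widetilde\Gamma$ is the loop of loops of genus $2g-1$ (indices $j\in\mathbb Z/(2g-2)\mathbb Z$) with $\ell(\beta_j)=\ell(\beta_{g-1+j})$, $\ell(\gamma_j)=\ell(\gamma_{g-1+j})$, $\ell(v_j,w_j)=\ell(v_{g-1+j},w_{g-1+j})$ whose quotient by the antipodal involution $p\mapsto\overline p$ (shifting indices by $g-1$) is $\Gamma$. $\mathrm{Nm}_\pi(\sum a_pp)=\sum a_p\pi(p)$, $P(\Gamma,\pi)=\{[D]\in\mathrm{Pic}(\widetilde\Gamma)\mid\mathrm{Nm}_\pi[D]=[K_\Gamma]\}$, and $V^r(\Gamma,\pi)=\{[D]\in P(\Gamma,\pi)\mid \mathrm{rk}(D)\ge r,\ \mathrm{rk}(D)\equiv r\ (\mathrm{mod}\ 2)\}$. Coordinates. For $\xi\in\mathbb R$, $\langle\xi\rangle_j\in\gamma_j\subset\widetilde\Gamma$ is the point reached from $w_j$ by travelling signed distance $\xi\,\ell(v_j,w_j)$ in the direction of the orientation; so $w_j=\langle0\rangle_j$, $v_j=\langle-1\rangle_j$, and for integers $a,b$, $\langle a\rangle_j=\langle b\rangle_j$ iff $a\equiv b$ mod $m_j$. Fix $p_0$ in the interior of the edge $\beta_1$ of $\widetilde\Gamma$. Let $\widehat{\mathbb T}^0$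 be the set of divisors $\sum_{j=1}^{2g-2}\langle\xi_j\rangle_j$ and $\widehat{\mathbb T}^1=\{D-p_0+\overline p_0\mid D\in\widehat{\mathbb T}^0\}$. Superscripts are read mod 2. Distinct divisors in $\widehat{\mathbb T}^0\sqcup\widehat{\mathbb T}^1$ are inequivalent, so $\xi_j(D)\in\mathbb R/(\ell(\gamma_j)/\ell(v_j,w_j))\mathbb Z$ is well defined on their classes. $P^r$ is the set of classes of divisors in $\widehat{\mathbb T}^r$ with $\xi_{g-1+j}(D)=-1-\xi_j(D)$ for all $j$. Slopes. For $0\le i\le r$: $s^r_j[i]=i-\frac r2$ if $r$ is even; if $r$ is odd, $s^r_j[i]=i-\frac{r+1}2$ for $j\in\{1,\dots,g-1\}$ and $s^r_j[i]=i-\frac{r-1}2$ for $j\in\{g,\dots,2g-2\}$. Words. $A_r$ is the symmetric group $S_{r+1}$ on $\{0,\dots,r\}$ with generating set $S=\{\tau_0,\dots,\tau_{r-1}\}$, $\tau_i$ the transposition of $i$ and $i+1$; $w_0(j)=r-j$; $\epsilon$ is the identity. A lingering word of length $n$ is a sequence $s_1\cdots s_n$ with $s_j\in S\cup\{\epsilon\}$. It contains a reduced subword for $w_0$ if some subsequence of its non-identity terms is a reduced word (i.e. of minimal length $\binom{r+1}2$) with product $w_0$. For a lingering word $Q=s_1\cdots s_{g-1}$, \[ T(Q)=\{[D]\in P^r\mid \xi_j(D)=s^r_j[i]\text{ (i.e. }\langle\xi_j(D)\rangle_j=\langle s^r_j[i]\rangle_j)\text{ whenever } s_j=\tau_i\}.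 \] *)

(* Defs.v *)
From HB Require Import structures.
From mathcomp Require Import all_boot all_order all_algebra all_fingroup.
From mathcomp Require Import boolp classical_sets reals.
From mathcomp Require Import freeg.

Set Implicit Arguments.
Unset Strict Implicit.
Unset Printing Implicit Defensive.

Import Order.TTheory GRing.Theory Num.Theory.
Local Open Scope classical_set_scope.
Local Open Scope ring_scope.

Record metric_graph (R : realType) := MetricGraph {
  vert : finType;
  edge : finType;
  src : edge -> vert;
  tgt : edge -> vert;
  len : edge -> R;
  len_gt0 : forall e, 0 < len e }.

Section MetricGraph.
Context {R : realType} (G : metric_graph R).

(* A point is a vertex or a pair (e, t) with t strictly inside the edge e. *)
Definition is_point (x : vert G + edge G * R) : bool :=
  if x is inr (e, t) then 0 < t < len e else true.

Definition gpoint := {x : vert G + edge G * R | is_point x}.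

Definition vtx (v : vert G) : gpoint := exist is_point (inl v) isT.

(* The point of e at distance t from src e; t is clamped to [0, len e]. *)
Definition at_edge (e : edge G) (t : R) : gpoint :=
  insubd (vtx (if t <= 0 then src e else tgt e)) (inr (e, t)).

Definition divisor := {freeg gpoint / int}.

(* The breakpoints of phi on e are 0 = t_0 < t_1 < ... < t_n = len e, with
   s = [:: t_1; ...; t_n].  Continuity at the vertices is built in, because
   both closed ends of each edge are covered. *)
Definition is_PL (phi : gpoint -> R) : Prop :=
  forall e : edge G, exists s : seq R,
    [/\ path <%R 0 s, last 0 s = len e &
      forall i, (i < size s)%N -> exists k : int,
        let a := nth 0 (0 :: s) i in let b := nth 0 (0 :: s) i.+1 in
        forall t, a <= t <= b ->
          phi (at_edge e t) = phi (at_edge e a) + k%:~R * (t - a)].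

(* The unit-speed germs of paths leaving p, one for each tangent direction. *)
Definition rays (p : gpoint) : seq (R -> gpoint) :=
  match val p with
  | inl v => [seq at_edge e | e <- enum (edge G) & src e == v]
          ++ [seq (fun h => at_edge e (len e - h))
               | e <- enum (edge G) & tgt e == v]
  | inr (e, t) => [:: fun h => at_edge e (t + h); fun h => at_edge e (t - h)]
  end.

Definition valence (p : gpoint) : nat := size (rays p).

(* The right slope of f at 0; the default 0 is irrelevant for germs of
   functions satisfying is_PL. *)
Definition out_slope (f : R -> R) : int :=
  xget 0 [set k : int | exists2 eps : R, 0 < eps &
    forall h, 0 <= h < eps -> f h = f 0 + k%:~R * h].

(* The incoming slope along a ray is the opposite of the outgoing one. *)
Definition ord_at (phi : gpoint -> R) (p : gpoint) : int :=
  \sum_(ray <- rays p) - out_slope (phi \o ray).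

Definition is_div (phi : gpoint -> R) (D : divisor) : Prop :=
  forall p, coeff p D = ord_at phi p.

Definition lin_equiv (D D' : divisor) : Prop :=
  exists2 phi, is_PL phi & is_div phi (D - D').

(* The element [D] of Pic, as the coset of D modulo principal divisors. *)
Definition pic (D : divisor) : set divisor := [set D' | lin_equiv D D'].

Definition effective (D : divisor) : Prop := forall p, 0 <= coeff p D.

Definition eq_effective (D : divisor) : Prop :=
  exists2 D', effective D' & lin_equiv D D'.

Definition rank_ge (D : divisor) (n : nat) : Prop :=
  forall E, effective E -> deg E = n%:Z -> eq_effective (D - E).

Definition rk (D : divisor) : int :=
  if `[< eq_effective D >] then
    Posz (xget 0%N [set n | rank_ge D n /\
                            forall m, rank_ge D m -> (m <= n)%N])
  else -1.

(* Points in the interior of an edge have valence 2 and do not contribute. *)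
Definition canonical_div : divisor :=
  \sum_(v : vert G) << (valence (vtx v))%:Z - 2 *g vtx v >>.

End MetricGraph.

(* A loop of loops with n loops has genus n + 1.  The ordinal k stands for the
   index k + 1 of Z/n, so that the indices 1, ..., n are 0, ..., n - 1 here. *)
Record loop_of_loops (R : realType) (n : nat) := LoopOfLoops {
  vw_len : 'I_n -> R;      (* the fixed edge from v_j to w_j *)
  wv_len : 'I_n -> R;      (* the other edge of the loop gamma_j *)
  bridge_len : 'I_n -> R;  (* the edge beta_j from w_(j-1) to v_j *)
  vw_len_gt0 : forall j, 0 < vw_len j;
  wv_len_gt0 : forall j, 0 < wv_len j;
  bridge_len_gt0 : forall j, 0 < bridge_len j }.

Section LoopOfLoops.
Context {R : realType} {n : nat} (L : loop_of_loops R n).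

Definition lol_vert : finType := ('I_n + 'I_n)%type.
Definition lol_v (j : 'I_n) : lol_vert := inl j.
Definition lol_w (j : 'I_n) : lol_vert := inr j.

Definition lol_edge : finType := ('I_n + 'I_n + 'I_n)%type.
Definition lol_vw (j : 'I_n) : lol_edge := inl (inl j).
Definition lol_wv (j : 'I_n) : lol_edge := inl (inr j).
Definition lol_bridge (j : 'I_n) : lol_edge := inr j.

Definition lol_src (e : lol_edge) : lol_vert :=
  match e with
  | inl (inl j) => lol_v j
  | inl (inr j) => lol_w j
  | inr j => lol_w (ord_pred j)
  end.

Definition lol_tgt (e : lol_edge) : lol_vert :=
  match e with
  | inl (inl j) => lol_w j
  | inl (inr j) => lol_v j
  | inr j => lol_v j
  end.

Definition lol_len (e : lol_edge) : R :=
  match e with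
  | inl (inl j) => vw_len L j
  | inl (inr j) => wv_len L j
  | inr j => bridge_len L j
  end.

Lemma lol_len_gt0 e : 0 < lol_len e.
Proof.
case: e => [[j|j]|j]; [exact: vw_len_gt0|exact: wv_len_gt0|].
exact: bridge_len_gt0.
Qed.

Definition lol_graph : metric_graph R :=
  @MetricGraph R lol_vert lol_edge lol_src lol_tgt lol_len lol_len_gt0.

Definition loop_len (j : 'I_n) : R := vw_len L j + wv_len L j.

Definition torsion_order (j : 'I_n) : nat :=
  if `[< irrational (vw_len L j / loop_len j) >] then 0%N else
  xget 0%N [set m : nat |
    let torsion k :=
      (0 < k)%N /\ exists z : int, k%:R * vw_len L j = z%:~R * loop_len j in
    torsion m /\ forall k, torsion k -> (m <= k)%N].

Definition generic (r : nat) : Prop :=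
  forall j, torsion_order j = 0%N \/ (r <= torsion_order j)%N.

(* The point <x>_j: the loop is oriented so that it runs from w_j along the
   edge lol_wv j to v_j, then along lol_vw j back to w_j. *)
Definition loop_point (j : 'I_n) (x : R) : gpoint lol_graph :=
  let d := x * vw_len L j in
  let d0 := d - (Num.floor (d / loop_len j))%:~R * loop_len j in
  if d0 <= wv_len L j then @at_edge R lol_graph (lol_wv j) d0
  else @at_edge R lol_graph (lol_vw j) (d0 - wv_len L j).

End LoopOfLoops.

Definition lol_map (R : realType) (m n : nat) (L : loop_of_loops R m)
    (L' : loop_of_loops R n) (s : 'I_m -> 'I_n)
    (p : gpoint (lol_graph L)) : gpoint (lol_graph L') :=
  match val p with
  | inl (inl j) => @vtx R (lol_graph L') (lol_v (s j))
  | inl (inr j) => @vtx R (lol_graph L') (lol_w (s j))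
  | inr (inl (inl j), t) => @at_edge R (lol_graph L') (lol_vw (s j)) t
  | inr (inl (inr j), t) => @at_edge R (lol_graph L') (lol_wv (s j)) t
  | inr (inr j, t) => @at_edge R (lol_graph L') (lol_bridge (s j)) t
  end.

(* Reduction from Z/2n to Z/n, and the shift of Z/2n by n. *)
Definition idx_proj {n : nat} (k : 'I_(n + n)) : 'I_n :=
  match split k with inl j => j | inr j => j end.

Definition idx_antipode {n : nat} (k : 'I_(n + n)) : 'I_(n + n) :=
  match split k with inl j => rshift n j | inr j => lshift n j end.

Section Cover.
Context {R : realType} {n : nat} (Gamma : loop_of_loops R n).

Definition dcover : loop_of_loops R (n + n) := {|
  vw_len k := vw_len Gamma (idx_proj k);
  wv_len k := wv_len Gamma (idx_proj k);
  bridge_len k := bridge_len Gamma (idx_proj k);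
  vw_len_gt0 k := vw_len_gt0 Gamma (idx_proj k);
  wv_len_gt0 k := wv_len_gt0 Gamma (idx_proj k);
  bridge_len_gt0 k := bridge_len_gt0 Gamma (idx_proj k) |}.

Definition cover_proj : gpoint (lol_graph dcover) -> gpoint (lol_graph Gamma) :=
  lol_map Gamma idx_proj.

Definition antipode : gpoint (lol_graph dcover) -> gpoint (lol_graph dcover) :=
  lol_map dcover idx_antipode.

Definition norm_div (D : divisor (lol_graph dcover)) : divisor (lol_graph Gamma) :=
  fglift (fun p => << cover_proj p >>) D.

Definition prym : set (set (divisor (lol_graph dcover))) :=
  [set pic D | D in
    [set D | pic (norm_div D) = pic (canonical_div (lol_graph Gamma))]].

Definition prym_BN (r : nat) : set (set (divisor (lol_graph dcover))) :=
  [set c | prym c /\ exists D,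
    [/\ c = pic D, r%:Z <= rk D & (rk D = r%:Z %[mod 2])%Z]].

Definition in_first_bridge (p : gpoint (lol_graph dcover)) : Prop :=
  exists k : 'I_(n + n), exists t : R,
    [/\ k = 0%N :> nat, 0 < t < bridge_len dcover k &
        p = @at_edge R (lol_graph dcover) (lol_bridge k) t].

(* The element of \hat T^r with coordinates xi. *)
Definition hatT_div (p0 : gpoint (lol_graph dcover)) (r : nat)
    (xi : 'I_(n + n) -> R) : divisor (lol_graph dcover) :=
  \sum_(k < n + n) << loop_point dcover k (xi k) >>
  + (if odd r then << antipode p0 >> - << p0 >> else 0).

(* The coordinates of the elements of P^r.  Equality of coordinates, which is
   modulo loop_len / vw_len, is equality of the corresponding points. *)
Definition prym_coords : set ('I_(n + n) -> R) :=
  [set xi | forall k, loop_point dcover (idx_antipode k) (xi (idx_antipode k)) =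
                      loop_point dcover (idx_antipode k) (-1 - xi k)].

Definition slope (r : nat) (k : 'I_(n + n)) (i : nat) : int :=
  if odd r then
    if (k < n)%N then i%:Z - (r.+1)./2%:Z else i%:Z - (r.-1)./2%:Z
  else i%:Z - r./2%:Z.

End Cover.

Arguments prym {R n} Gamma.
Arguments prym_BN {R n} Gamma r.

(* None stands for the identity and Some i for the generator tau i. *)
Definition lingering_word (r n : nat) := n.-tuple (option 'I_r).

Definition tau (r : nat) (i : 'I_r) : 'S_r.+1 :=
  tperm (widen_ord (leqnSn r) i) (fintype.lift ord0 i).

Definition w0 (r : nat) : 'S_r.+1 := perm (@rev_ord_inj r.+1).

Definition word_prod (r : nat) (u : seq 'I_r) : 'S_r.+1 :=
  (\prod_(i <- u) tau i)%g.

Definition reduced_word (r : nat) (u : seq 'I_r) : Prop :=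
  forall u' : seq 'I_r, word_prod u' = word_prod u -> (size u <= size u')%N.

(* Permutations compose from left to right in the library; the order does not
   matter here since w0 is an involution and reversal preserves reducedness,
   and the subsequence u itself is kept in the order of the word. *)
Definition contains_w0 (r n : nat) (Q : lingering_word r n) : Prop :=
  exists u : seq 'I_r,
    [/\ subseq u (pmap id Q), reduced_word u & word_prod u = w0 r].

(* T(Q): the classes in P^r whose coordinates match the slopes prescribed by
   Q. The coordinates of a class are unique up to equality of points, so it
   does not matter which xi represents it. *)
Definition word_torus (R : realType) (n r : nat) (Gamma : loop_of_loops R n)
    (p0 : gpoint (lol_graph (dcover Gamma))) (Q : lingering_word r n) :
    set (set (divisor (lol_graph (dcover Gamma)))) :=
  [set pic (hatT_div p0 r xi) | xi in
    prym_coords Gamma `&` [set xi |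
      forall (j : 'I_n) (i : 'I_r), tnth Q j = Some i ->
        loop_point (dcover Gamma) (lshift n j) (xi (lshift n j)) =
        loop_point (dcover Gamma) (lshift n j)
          (slope r (lshift n j) i)%:~R]].

(* Main.v *)
(* On a loop of loops, a divisor is principal iff there are integers, the slopes
   along the bridges, which satisfy a degree equation on each loop and bridge, a
   moment congruence on each loop, and one equation closing up the cycle of
   bridges.  Applied to the norm of D, this shows that each Prym class is that of
   a divisor of \hat T^0 or \hat T^1 with antisymmetric coordinates xi.

   For 0 <= i < r, call i a wall of the loop j if <xi_j> = <s_j[i]>.  The bridge
   slope of a function in R(D) can move between s_j[i] and s_j[i+1] at the loop j
   only if i is a wall.  Let r + 1 strands start at the positions 0, ..., r, and
   let two adjacent strands swap, unless they have swapped before, at each wall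
   between them.
   - If the strands end in the reversed order, their positions are the bridge
     slopes, extended antisymmetrically to the second half of the cover, of r + 1
     functions in R(D) which have distinct slopes at each vertex.  Hence a
     tropical combination of them (Cramer's rule) vanishes at any r vertices, with
     multiplicities, and moving chips along edges extends this to all points, so
     that rk(D) >= r.
   - Otherwise, by a min-cut argument, some path of gaps between the positions
     runs from a to r + 1 - a, avoids the walls, and has total variation less than
     r.  The effective divisor E that pays for this variation at the vertices w_k
     makes the path a barrier for the slopes of functions in R(D - E): they stay
     on one side of it, which contradicts the closing up condition.  Hence
     rk(D) < r - 1.
   As the coordinates in \hat T^r depend only on r mod 2, applying the dichotomy
   to rk(D) + 1 yields the parity of rk(D).  For an r-generic Gamma each loop has
   at most one wall, so that the walls form a lingering word Q, and the swaps of
   the strands a subword which is reduced since each swap adds an inversion. *)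
Require Import Defs.
From mathcomp Require Import all_boot all_order all_algebra all_fingroup.
From mathcomp Require Import boolp classical_sets reals.
From mathcomp Require Import freeg.
From mathcomp Require Import ring lra zify.

Set Implicit Arguments.
Unset Strict Implicit.
Unset Printing Implicit Defensive.

Import Order.TTheory GRing.Theory Num.Theory.
Local Open Scope classical_set_scope.
Local Open Scope ring_scope.

(** The closing up equation is the obstacle: it alone couples all the loops, and it is an equation
    between reals, out of reach of counting chips. The cover helps because its terms can be grouped
    by antipodal pairs of loops and of bridges. For a strand each pair contributes 0: the chips left
    on two antipodal loops are matched by the reflection that exchanges [<x>] and [<-1-x>], and the
    Green function has a constant sum on matched points. On one side of a barrier all the pairs
    contribute with the same strict sign.

    The two endpoint conditions have one origin. Slopes change sign on passing to the second half of
    the cover; given the chips at [p0] and its antipode, the position x is continued by r - x and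
    the gap c by r + 1 - c.

    In the min-cut argument the flow consists of the strands that start below a gap a and end above
    a gap c. Only the descents of a path of gaps cost anything. Its ascents exceed them by c - a, so
    a bound on the flow bounds the total variation. *)

(** * One-sided slopes and piecewise linear functions on an interval *)

Section Germs.
Context {R : realType}.
Implicit Types (f g : R -> R) (k l : int) (t a b : R).

Definition has_slope f k :=
  exists2 eps, 0 < eps & forall h, 0 <= h < eps -> f h = f 0 + k%:~R * h.

(** Uniqueness makes the value chosen in [out_slope] the actual slope of the germ. *)
Lemma has_slope_uniq f k l : has_slope f k -> has_slope f l -> k = l.
Proof.
case=> e e0 fk [d d0 fl]; pose h := Num.min e d / 2.
have m0 : 0 < Num.min e d by rewrite lt_min e0.
have h0 : 0 < h by rewrite /h; lra.
have [he hd] : h < e /\ h < d.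
  have : Num.min e d <= e /\ Num.min e d <= d by rewrite !ge_min !lexx orbT.
  by rewrite /h; lra.
have := fk h; rewrite (ltW h0) he fl; last by rewrite (ltW h0) hd.
move=> /(_ isT) /addrI.
by move=> /(mulIf (lt0r_neq0 h0)) /intr_inj.
Qed.

Lemma out_slopeE f k : has_slope f k -> out_slope f = k.
Proof.
by move=> fk; apply: (has_slope_uniq _ fk); apply: (xgetI (P := has_slope f) 0 fk).
Qed.

Lemma has_slope_near f g k :
  (exists2 eps, 0 < eps & forall h, 0 <= h < eps -> f h = g h) ->
  has_slope f k -> has_slope g k.
Proof.
case=> e e0 fg [d d0 fk]; exists (Num.min e d); first by rewrite lt_min e0.
move=> h; rewrite lt_min => /and3P[h0 he hd].
by rewrite -(fg h) ?h0 // -(fg 0) ?lexx // fk ?h0.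
Qed.

Lemma has_slopeD f g k l :
  has_slope f k -> has_slope g l -> has_slope (fun h => f h + g h) (k + l).
Proof.
case=> e e0 fk [d d0 gl]; exists (Num.min e d); first by rewrite lt_min e0.
move=> h; rewrite lt_min => /and3P[h0 he hd].
rewrite fk; last by rewrite h0.
rewrite gl; last by rewrite h0.
by rewrite intrD; ring.
Qed.

Lemma has_slope_mulz f k l :
  has_slope f k -> has_slope (fun h => l%:~R * f h) (l * k).
Proof.
case=> e e0 fk; exists e => // h hh.
by rewrite fk // intrM; ring.
Qed.

Lemma has_slope_cst (c : R) : has_slope (fun=> c) 0.
Proof. by exists 1 => // h _; rewrite mul0r addr0. Qed.

Lemma has_slopeDc f k (c : R) : has_slope f k -> has_slope (fun h => f h + c) k.
Proof.
move=> fk; rewrite -[k]addr0.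
exact: (has_slopeD fk (has_slope_cst c)).
Qed.

Lemma has_slopeN f k : has_slope f k -> has_slope (fun h => - f h) (- k).
Proof. by case=> e e0 fk; exists e => // h hh; rewrite fk // mulrNz; ring. Qed.

Lemma has_slope_sum (I : Type) (r : seq I) (F : I -> R -> R) (K : I -> int) :
  (forall i, has_slope (F i) (K i)) ->
  has_slope (fun h => \sum_(i <- r) F i h) (\sum_(i <- r) K i).
Proof.
move=> FK; elim: r => [|i r IH].
  rewrite big_nil; apply: has_slope_near (has_slope_cst 0).
  by exists 1 => // h _; rewrite big_nil.
rewrite big_cons; apply: has_slope_near (has_slopeD (FK i) IH).
by exists 1 => // h _; rewrite big_cons.
Qed.

Lemma has_slope_lt f g k l : has_slope f k -> has_slope g l -> f 0 < g 0 ->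
  exists2 eps, 0 < eps & forall h, 0 <= h < eps -> f h < g h.
Proof.
case=> e e0 fk [d d0 gl] lt0.
(* The difference g - f decreases by at most |k - l| per unit of length; the added 1 keeps the
   denominator positive when k = l. *)
pose c := (g 0 - f 0) / (1 + `|k%:~R - l%:~R|).
have den : 0 < 1 + `|k%:~R - l%:~R : R| by apply: ltr_wpDr.
have c0 : 0 < c by rewrite divr_gt0 // subr_gt0.
exists (Num.min c (Num.min e d)); first by rewrite !lt_min c0 e0.
move=> h; rewrite !lt_min => /and4P[h0 hc he hd].
rewrite fk; last by rewrite h0.
rewrite gl; last by rewrite h0.
have : (k%:~R - l%:~R) * h <= `|k%:~R - l%:~R| * h.
  by rewrite ler_wpM2r // ler_norm.
have : h * (1 + `|k%:~R - l%:~R|) < g 0 - f 0 by rewrite -ltr_pdivlMr.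
by set n := `|_|; nra.
Qed.

(** The exact slope, in particular the smaller one at a tie, is needed to see when truncating a
    function creates a kink. *)
Lemma has_slope_min f g k l : has_slope f k -> has_slope g l ->
  has_slope (fun h => Num.min (f h) (g h))
    (if f 0 < g 0 then k else if g 0 < f 0 then l else Num.min k l).
Proof.
move=> fk gl; case: ltgtP => [lt|gt|eq].
- have [e e0 H] := has_slope_lt fk gl lt.
  apply: has_slope_near fk; exists e => // h /H hlt.
  by rewrite (min_idPl (ltW hlt)).
- have [e e0 H] := has_slope_lt gl fk gt.
  apply: has_slope_near gl; exists e => // h /H hlt.
  by rewrite (min_idPr (ltW hlt)).
- case: fk gl => e e0 fk [d d0 gl].
  exists (Num.min e d); first by rewrite lt_min e0.
  move=> h; rewrite lt_min => /and3P[h0 he hd].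
  rewrite fk ?h0 // gl ?h0 // eq !minxx.
  have [kl|lk] := leP k l.
    by rewrite (min_idPl _) // lerD2l ler_wpM2r // ler_int.
  by rewrite (min_idPr _) // lerD2l ler_wpM2r // ler_int ltW.
Qed.

Lemma has_slope_minl (I : Type) (f0 : R -> R) (k0 : int) (r : seq I)
    (F : I -> R -> R) (K : I -> int) :
  has_slope f0 k0 -> (forall i, has_slope (F i) (K i)) ->
  exists k, has_slope (fun h => \big[Num.min/f0 h]_(i <- r) F i h) k.
Proof.
move=> f0k FK; elim: r => [|i r [k IH]].
  exists k0; apply: has_slope_near f0k.
  by exists 1 => // h _; rewrite big_nil.
eexists; apply: has_slope_near (has_slope_min (FK i) IH).
by exists 1 => // h _; rewrite big_cons.
Qed.

Lemma has_slope_le f g k l : has_slope f k -> has_slope g l -> f 0 = g 0 ->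
  (forall h, f h <= g h) -> k <= l.
Proof.
move=> [e e0 fk] [d d0 gl] eq le; rewrite leNgt; apply/negP => lk.
pose h := Num.min e d / 2.
have m0 : 0 < Num.min e d by rewrite lt_min e0.
have h0 : 0 < h by rewrite /h; lra.
have [he hd] : h < e /\ h < d.
  have : Num.min e d <= e /\ Num.min e d <= d by rewrite !ge_min !lexx orbT.
  by rewrite /h; lra.
have := le h; rewrite fk ?(ltW h0) // gl ?(ltW h0) // eq lerD2l ler_pM2r //.
by rewrite ler_int leNgt lk.
Qed.

(** The breakpoint list of [is_PL] in recursive form, so that integrating along the interval is an
    induction on the list. *)
Fixpoint pieces f a (s : seq R) : Prop :=
  if s is b :: s' then
    [/\ a < b, exists k : int, forall t, a <= t <= b -> f t = f a + k%:~R * (t - a)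
      & pieces f b s']
  else True.

Lemma piecesP f a s : pieces f a s <-> path <%R a s /\
  forall i, (i < size s)%N -> exists k : int,
    let u := nth 0 (a :: s) i in let v := nth 0 (a :: s) i.+1 in
    forall t, u <= t <= v -> f t = f u + k%:~R * (t - u).
Proof.
elim: s a => [|b s IH] a /=; first by split.
split=> [[ab fk /IH[ps fs]]|[/andP[ab ps] fs]].
  by split=> [|[|i] si //]; [rewrite ab|apply: fs].
split=> //; first exact: (fs 0%N).
by apply/IH; split=> // i si; apply: (fs i.+1).
Qed.

Lemma pieces_rcons f a s b : pieces f a s -> last a s < b ->
  (exists k : int, forall t, last a s <= t <= b ->
     f t = f (last a s) + k%:~R * (t - last a s)) ->
  pieces f a (rcons s b).
Proof.
elim: s a => [|c s IH] a /=; first by [].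
by move=> [ac fk ps] lb H; split=> //; apply: IH.
Qed.

Lemma pieces_le f a s : pieces f a s -> a <= last a s.
Proof.
elim: s a => [|c s IH] a //= [ac _ /IH]; exact/le_trans/ltW.
Qed.

Definition rslope f t := out_slope (fun h => f (t + h)).
Definition lslope f t := out_slope (fun h => f (t - h)).

Definition right_lin f t := has_slope (fun h => f (t + h)) (rslope f t).
Definition left_lin f t := has_slope (fun h => f (t - h)) (lslope f t).

Lemma right_linP f t : (exists k, has_slope (fun h => f (t + h)) k) -> right_lin f t.
Proof. by case=> k fk; rewrite /right_lin /rslope (out_slopeE fk). Qed.

Lemma left_linP f t : (exists k, has_slope (fun h => f (t - h)) k) -> left_lin f t.
Proof. by case=> k fk; rewrite /left_lin /lslope (out_slopeE fk). Qed.

Lemma lin_right f a b k : a < b ->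
  (forall t, a <= t <= b -> f t = f a + k%:~R * (t - a)) ->
  forall t, a <= t < b -> has_slope (fun h => f (t + h)) k.
Proof.
move=> ab fk t /andP[ta tb]; exists (b - t); first by rewrite subr_gt0.
move=> h /andP[h0 hb]; rewrite addr0 (fk (t + h)) ?(fk t); try lra.
Qed.

Lemma lin_left f a b k : a < b ->
  (forall t, a <= t <= b -> f t = f a + k%:~R * (t - a)) ->
  forall t, a < t <= b -> has_slope (fun h => f (t - h)) (- k).
Proof.
move=> ab fk t /andP[ta tb]; exists (t - a); first by rewrite subr_gt0.
move=> h /andP[h0 hb]; rewrite subr0 (fk (t - h)) ?(fk t) ?mulrNz; try lra.
Qed.

Lemma pieces_right f a s t : pieces f a s -> a <= t < last a s -> right_lin f t.
Proof.
elim: s a => [|b s IH] a /=; first by move=> _ /andP[at_ /(le_lt_trans at_)]; rewrite ltxx.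
move=> [ab [k fk] ps] /andP[at_ tl]; have [tb|bt] := ltP t b.
  by apply: right_linP; exists k; apply: (lin_right ab fk); rewrite at_ tb.
by apply: (IH b) => //; rewrite bt.
Qed.

Lemma pieces_left f a s t : pieces f a s -> a < t <= last a s -> left_lin f t.
Proof.
elim: s a => [|b s IH] a /=; first by move=> _ /andP[at_ /(lt_le_trans at_)]; rewrite ltxx.
move=> [ab [k fk] ps] /andP[at_ tl]; have [tb|bt] := leP t b.
  by apply: left_linP; exists (- k); apply: (lin_left ab fk); rewrite at_ tb.
by apply: (IH b) => //; rewrite bt.
Qed.

(** The order of f at an interior point of an edge; it is positive where f is strictly concave. *)
Definition kink f t : int := - rslope f t - lslope f t.

Lemma lin_rslope f a b k : a < b ->
  (forall t, a <= t <= b -> f t = f a + k%:~R * (t - a)) ->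
  forall t, a <= t < b -> rslope f t = k.
Proof. by move=> ab fk t tab; apply/out_slopeE/(lin_right ab fk). Qed.

Lemma lin_lslope f a b k : a < b ->
  (forall t, a <= t <= b -> f t = f a + k%:~R * (t - a)) ->
  forall t, a < t <= b -> lslope f t = - k.
Proof. by move=> ab fk t tab; apply/out_slopeE/(lin_left ab fk). Qed.

Lemma pieces_kink0 f a s t : pieces f a s -> a < t < last a s -> t \notin s ->
  kink f t = 0.
Proof.
elim: s a => [|b s IH] a /=; first by move=> _ /andP[at_ /(lt_trans at_)]; rewrite ltxx.
move=> [ab [k fk] ps] /andP[at_ tl]; rewrite inE negb_or => /andP[tb ts].
have [lt|gt|eq] := ltgtP t b; last by rewrite eq eqxx in tb.
  rewrite /kink (lin_rslope ab fk) ?(lin_lslope ab fk) ?at_ ?lt ?ltW //; lia.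
by apply: (IH b) => //; rewrite gt.
Qed.

(** Summation by parts: the kinks add up to the slope lost between a and b, and their moments about
    a to the error made by using the final slope throughout. The guard t < b drops the endpoint,
    where only the left slope is meaningful. *)
Lemma pieces_sum f a s : (0 < size s)%N -> pieces f a s ->
  let b := last a s in let k1 := - lslope f b in
  rslope f a = k1 + \sum_(t <- s | t < b) kink f t /\
  f b = f a + k1%:~R * (b - a) + \sum_(t <- s | t < b) (kink f t)%:~R * (t - a).
Proof.
elim: s a => [|b s IH] a //= _ [ab [k fk] ps].
have ra : rslope f a = k by apply: (lin_rslope ab fk); rewrite lexx.
have lb : lslope f b = - k by apply: (lin_lslope ab fk); rewrite lexx ab.
case: s IH ps => [|c s] IH ps.
  rewrite /= !big_cons !big_nil ltxx !addr0 ra lb opprK; split=> //.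
  by rewrite fk // lexx ltW.
have bl : b < last b (c :: s).
  by case: ps => bc _ /pieces_le; apply: lt_le_trans.
have kb : kink f b = k - rslope f b by rewrite /kink lb; lia.
case: (IH b isT ps) => E1 E2; rewrite !(big_cons _ _ b) bl; split.
  rewrite kb ra E1; ring.
rewrite E2 (fk b) ?lexx ?ltW //.
have -> : \sum_(t <- c :: s | t < last b (c :: s)) (kink f t)%:~R * (t - a) =
   \sum_(t <- c :: s | t < last b (c :: s)) (kink f t)%:~R * (t - b)
   + (\sum_(t <- c :: s | t < last b (c :: s)) kink f t)%:~R * (b - a).
  rewrite rmorph_sum /= mulr_suml -big_split /=; apply: eq_bigr => i _; ring.
rewrite kb E1 !(rmorphD, rmorphN, rmorphB) /=; ring.
Qed.

(** Compactness, through the supremum c of the points up to which a finite list of pieces exists: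
    the left germ at c includes c itself, and the right germ goes beyond c unless c = b. This
    replaces breakpoint lists by a condition on germs, which is stable under sums and minima. *)
Lemma locally_linear_pieces f a b : a < b ->
  (forall t, a <= t < b -> right_lin f t) ->
  (forall t, a < t <= b -> left_lin f t) ->
  exists2 s, pieces f a s & last a s = b.
Proof.
move=> ab fr fl.
pose S := [set c : R | a <= c <= b /\ exists2 s, pieces f a s & last a s = c].
have Sa : S a by split; [rewrite lexx ltW|exists [::]].
have hS : has_sup S by split; [exists a|exists b => c [/andP[]]].
pose c := sup S.
have cb : c <= b by apply: ge_sup; [exists a|move=> x [/andP[]]].
have ac : a <= c by apply: ub_le_sup => //; case: hS.
have Sc : S c.
  have [->|cna] := eqVneq c a; first by [].
  have altc : a < c by rewrite lt_def cna.
  case: (fl c); first by rewrite altc.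
  move=> e e0 fe.
  have [x Sx xc] : exists2 x, S x & c - e < x.
    by apply: sup_adherent.
  have xc' : x <= c by apply: ub_le_sup => //; case: hS.
  have [<-//|xnc] := eqVneq x c.
  have xltc : x < c by rewrite lt_def eq_sym xnc.
  split; first by rewrite ac.
  case: Sx => /andP[ax xb] [s ps lx].
  exists (rcons s c); last by rewrite last_rcons.
  apply: pieces_rcons; rewrite ?lx // ; exists (- lslope f c) => t /andP[xt tc].
  have := fe (c - t); rewrite subKr => ->; last lra.
  have := fe (c - x); rewrite subKr => ->; last lra.
  by rewrite mulrNz; ring.
have [<-|cnb] := eqVneq c b; first by case: Sc.
have cltb : c < b by rewrite lt_def eq_sym cnb.
case: (fr c); first by rewrite ac.
move=> e e0 fe; pose d := c + Num.min (e / 2) (b - c).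
have m0 : 0 < Num.min (e / 2) (b - c) by rewrite lt_min subr_gt0 cltb andbT; lra.
have [m1 m2] : Num.min (e / 2) (b - c) <= e / 2 /\ Num.min (e / 2) (b - c) <= b - c.
  by rewrite !ge_min !lexx orbT.
suff /ub_le_sup : S d by move=> /(_ (proj2 hS)); rewrite -/c /d; lra.
split; first by rewrite /d; lra.
case: Sc => _ [s ps lx]; exists (rcons s d); last by rewrite last_rcons.
apply: pieces_rcons; rewrite ?lx //; first by rewrite /d; lra.
exists (rslope f c) => t /andP[ct td].
have := fe (t - c); rewrite (addrC c) subrK addr0 => -> //; move: td; rewrite /d; lra.
Qed.

(** Nonnegative kinks mean concavity, so the tangents at both ends lie above the function. *)
Lemma concave_right f a b : a < b ->
  (forall t, a <= t < b -> right_lin f t) ->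
  (forall t, a < t <= b -> left_lin f t) ->
  (forall t, a < t < b -> 0 <= kink f t) ->
  f b <= f a + (rslope f a)%:~R * (b - a) /\
  f a <= f b + (lslope f b)%:~R * (b - a).
Proof.
move=> ab fr fl fk; have [s ps ls] := locally_linear_pieces ab fr fl.
have s0 : (0 < size s)%N by case: s ls {ps} => //= E; rewrite E ltxx in ab.
have [E1 E2] := pieces_sum s0 ps; rewrite !ls in E1 E2.
have gt t : t \in s -> a < t.
  by case/piecesP: ps => /(order_path_min lt_trans)/allP H _ /H.
split; last first.
  rewrite E2 mulrNz; set S := \sum_(t <- s | _) _.
  have : 0 <= S.
    rewrite /S big_seq_cond; apply: sumr_ge0 => t /andP[ts tb].
    by rewrite mulr_ge0 ?ler0z ?fk ?gt // subr_ge0 ltW ?gt.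
  by lra.
have -> : f b = f a + (rslope f a)%:~R * (b - a)
    - \sum_(t <- s | t < b) (kink f t)%:~R * (b - t).
  rewrite E1 {1}E2 rmorphD /= mulrDl rmorph_sum /= mulr_suml -!addrA; congr (_ + (_ + _)).
  by rewrite -sumrB; apply: eq_bigr => t _; ring.
rewrite gerDl oppr_le0 big_seq_cond; apply: sumr_ge0 => t /andP[ts tb].
by rewrite mulr_ge0 ?ler0z ?fk ?gt // subr_ge0 ltW.
Qed.

End Germs.

(** * Piecewise linear functions and their divisors on a metric graph *)

Section WeightedSum.
Context {R : realType} {K : choiceType}.
Implicit Types (w : K -> R) (A B : {freeg K / int}) (p : K).

(** The integral of w against the divisor A. Degrees, moments and Green potentials over a part of
    the graph are all of this form. *)
Definition wsum w A : R := \sum_(p <- dom A) (coeff p A)%:~R * w p.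

Lemma wsum_sub w A (l : seq K) : uniq l ->
  (forall p, coeff p A != 0 -> w p != 0 -> p \in l) ->
  wsum w A = \sum_(p <- l) (coeff p A)%:~R * w p.
Proof.
move=> ul H; rewrite /wsum.
rewrite (bigID (mem l)) /= [X in _ + X]big1_seq ?addr0; last first.
  move=> p /andP[pl]; rewrite mem_dom => cp.
  by have [->|wp] := eqVneq (w p) 0; [rewrite mulr0|rewrite (H p) in pl].
rewrite [RHS](bigID (mem (dom A))) /= [X in _ = _ + X]big1_seq ?addr0; last first.
  by move=> p /andP[pl _]; rewrite coeff_outdom ?mul0r.
rewrite -big_filter -[RHS]big_filter; apply: perm_big; apply: uniq_perm.
- exact/filter_uniq/uniq_dom.
- exact/filter_uniq.
- by move=> p; rewrite !mem_filter /= andbC.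
Qed.

Lemma wsum_sup w A (l : seq K) : uniq l -> {subset dom A <= l} ->
  wsum w A = \sum_(p <- l) (coeff p A)%:~R * w p.
Proof. by move=> ul sl; apply: wsum_sub => // p cp _; apply: sl; rewrite mem_dom. Qed.

Lemma wsumD w A B : wsum w (A + B) = wsum w A + wsum w B.
Proof.
pose l := undup (dom (A + B) ++ dom A ++ dom B).
have ul : uniq l by apply: undup_uniq.
have sl : {subset dom (A + B) ++ dom A ++ dom B <= l} by move=> p; rewrite mem_undup.
rewrite !(@wsum_sup w _ l ul) -?big_split /=.
- by apply: eq_bigr => p _; rewrite coeffD intrD mulrDl.
- by move=> p pB; apply: sl; rewrite !mem_cat pB !orbT.
- by move=> p pA; apply: sl; rewrite !mem_cat pA !orbT.
- by move=> p pAB; apply: sl; rewrite !mem_cat pAB.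
Qed.

Lemma wsum0 w : wsum w 0 = 0.
Proof. by rewrite /wsum dom0 big_nil. Qed.

Lemma wsumN w A : wsum w (- A) = - wsum w A.
Proof. by apply/eqP; rewrite -addr_eq0 -wsumD addNr wsum0. Qed.

Lemma wsumB w A B : wsum w (A - B) = wsum w A - wsum w B.
Proof. by rewrite wsumD wsumN. Qed.

Lemma wsum_sum w (I : Type) (r : seq I) (P : pred I) (F : I -> {freeg K / int}) :
  wsum w (\sum_(i <- r | P i) F i) = \sum_(i <- r | P i) wsum w (F i).
Proof. exact: (big_morph _ (wsumD w) (wsum0 w)). Qed.

Lemma wsumU w c p : wsum w << c *g p >> = c%:~R * w p.
Proof.
rewrite (@wsum_sup w _ [:: p]) // ?big_seq1 ?coeffU ?eqxx ?mulr1 //.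
have [->|c0] := eqVneq c 0; first by rewrite freegU0 dom0.
by rewrite domU.
Qed.

Lemma wsumU1 w p : wsum w << p >> = w p.
Proof. by rewrite wsumU mul1r. Qed.

Lemma wsumMn w A m : wsum w (A *+ m) = wsum w A *+ m.
Proof. by elim: m => [|m IH]; rewrite ?mulr0n ?wsum0 // !mulrS wsumD IH. Qed.

Lemma eq_wsum w1 w2 A : w1 =1 w2 -> wsum w1 A = wsum w2 A.
Proof. by move=> e; apply: eq_bigr => p _; rewrite e. Qed.

Lemma wsumDw w1 w2 A : wsum (fun p => w1 p + w2 p) A = wsum w1 A + wsum w2 A.
Proof. by rewrite /wsum -big_split /=; apply: eq_bigr => p _; rewrite mulrDr. Qed.

Lemma wsumZw c w A : wsum (fun p => c * w p) A = c * wsum w A.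
Proof. by rewrite /wsum mulr_sumr; apply: eq_bigr => p _; ring. Qed.

Lemma wsum_sumw (I : Type) (r : seq I) (W : I -> K -> R) A :
  wsum (fun p => \sum_(i <- r) W i p) A = \sum_(i <- r) wsum (W i) A.
Proof.
rewrite /wsum exchange_big /=; apply: eq_bigr => p _.
by rewrite mulr_sumr.
Qed.

Lemma wsum_ge0 w A : (forall p, 0 <= coeff p A) -> (forall p, 0 <= w p) ->
  0 <= wsum w A.
Proof. by move=> A0 w0; apply: sumr_ge0 => p _; rewrite mulr_ge0 ?ler0z. Qed.

(** An effective divisor whose integral against w is 0 has no chips where w is positive. *)
Lemma wsum_eq0 (w w' : K -> R) A : (forall p, 0 <= coeff p A) ->
  (forall p, 0 <= w p) -> (forall p, w p = 0 -> w' p = 0) ->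
  wsum w A = 0 -> wsum w' A = 0.
Proof.
move=> A0 w0 ww /eqP; rewrite /wsum psumr_eq0; last first.
  by move=> p _; rewrite mulr_ge0 ?ler0z.
move=> /allP H; apply: big1_seq => p /= /H; rewrite mulf_eq0 => /orP[/eqP->|/eqP/ww->].
  by rewrite mul0r.
by rewrite mulr0.
Qed.

Lemma wsum_coeff p A : wsum (fun q => (q == p)%:R) A = (coeff p A)%:~R.
Proof.
rewrite (@wsum_sub _ _ [:: p]) // ?big_seq1 ?eqxx ?mulr1 // => q _.
by rewrite inE; case: (q == p); rewrite // mulr0n eqxx.
Qed.

Lemma wsum_int (w : K -> int) A :
  wsum (fun p => (w p)%:~R) A = (\sum_(p <- dom A) coeff p A * w p)%:~R.
Proof. by rewrite rmorph_sum; apply: eq_bigr => p _; rewrite -intrM. Qed.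

Lemma wsum_deg A : wsum (fun=> 1) A = (deg A)%:~R.
Proof.
rewrite -{2}[A]freeg_sumE raddf_sum rmorph_sum; apply: eq_bigr => p _ /=.
by rewrite mulr1 degU.
Qed.

Lemma coeff_sumU (l : seq K) (c : K -> int) p : uniq l ->
  coeff p (\sum_(q <- l) << c q *g q >>) = if p \in l then c p else 0.
Proof.
move=> ul; rewrite raddf_sum /=; case: ifPn => pl.
  rewrite (bigD1_seq p) //= coeffU eqxx mulr1 big1 ?addr0 // => q qp.
  by rewrite coeffU (negPf qp) mulr0.
rewrite big1_seq // => q /= ql; rewrite coeffU; case: eqP => [qp|]; rewrite ?mulr0 //.
by rewrite -qp ql in pl.
Qed.

End WeightedSum.

(** * Functions on a metric graph with prescribed slopes and divisor *)

Section Graph.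
Context {R : realType} {G : metric_graph R}.
Implicit Types (phi psi : gpoint G -> R) (e : edge G) (p : gpoint G) (v : vert G).
Implicit Types (A B D E F : divisor G).

Lemma at_edge_src e t : t <= 0 -> at_edge e t = vtx (src e).
Proof.
move=> t0; rewrite /at_edge t0; apply: val_inj.
by rewrite val_insubd /= ltNge t0.
Qed.

Lemma at_edge_tgt e t : len e <= t -> at_edge e t = vtx (tgt e).
Proof.
move=> lt; rewrite /at_edge leNgt (lt_le_trans (len_gt0 e) lt).
by apply: val_inj; rewrite val_insubd /= (ltNge t) lt andbF.
Qed.

Lemma val_at_edge e t : 0 < t < len e -> val (at_edge e t) = inr (e, t).
Proof. by move=> H; rewrite /at_edge val_insubd /= H. Qed.

Lemma gpointP p : (exists v, p = vtx v) \/
  exists e t, 0 < t < len e /\ p = at_edge e t.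
Proof.
case: p => -[v|[e t]] H; [left|right].
  by exists v; apply: val_inj.
by exists e, t; split=> //; apply: val_inj; rewrite val_at_edge.
Qed.

Lemma at_edge_inj e e' t t' : 0 < t < len e -> 0 < t' < len e' ->
  at_edge e t = at_edge e' t' -> e = e' /\ t = t'.
Proof. by move=> H H' /(congr1 val); rewrite !val_at_edge // => -[]. Qed.

Lemma vtx_inj : injective (@vtx R G).
Proof. by move=> v w []. Qed.

Lemma at_edge_neq_vtx e t v : 0 < t < len e -> (at_edge e t == vtx v) = false.
Proof. by move=> H; apply/negP => /eqP /(congr1 val); rewrite val_at_edge. Qed.

Definition onedge phi e (t : R) : R := phi (at_edge e t).

Definition loc_lin phi := forall e,
  (forall t, 0 <= t < len e -> right_lin (onedge phi e) t) /\
  (forall t, 0 < t <= len e -> left_lin (onedge phi e) t).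

Lemma onedge_pieces phi e : loc_lin phi ->
  exists2 s, pieces (onedge phi e) 0 s & last 0 s = len e.
Proof.
by move=> /(_ e)[fr fl]; exact: locally_linear_pieces (len_gt0 e) fr fl.
Qed.

Lemma is_PLP phi : is_PL phi <-> loc_lin phi.
Proof.
split=> [H e|H e].
  have [s [ps ls fs]] := H e.
  have P : pieces (onedge phi e) 0 s by apply/piecesP.
  split=> t; rewrite -ls; [exact: pieces_right|exact: pieces_left].
have [s /piecesP[ps fs] ls] := onedge_pieces e H.
by exists s; split.
Qed.

Definition slope0 phi e := rslope (onedge phi e) 0.
Definition slope1 phi e := - lslope (onedge phi e) (len e).

Lemma ord_vtx phi v : ord_at phi (vtx v) =
  \sum_(e | tgt e == v) slope1 phi e - \sum_(e | src e == v) slope0 phi e.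
Proof.
rewrite /ord_at /rays /= big_cat /= !big_map !big_filter !big_enum_cond /= addrC.
rewrite -sumrN; congr (_ + _); apply: eq_bigr => e _ //.
congr (- out_slope _); apply: funext => h.
by rewrite /onedge /= add0r.
Qed.

Lemma ord_edge phi e t : 0 < t < len e ->
  ord_at phi (at_edge e t) = kink (onedge phi e) t.
Proof.
by move=> H; rewrite /ord_at /rays val_at_edge // !big_cons big_nil addr0.
Qed.

(** The ends of e have weight 0: their chips are accounted for by the equations at the vertices. *)
Definition edge_wt e (w : R -> R) p : R :=
  if val p is inr (e', t) then (if e' == e then w t else 0) else 0.

Lemma edge_wt_in e w e' t : 0 < t < len e' ->
  edge_wt e w (at_edge e' t) = if e' == e then w t else 0.
Proof. by move=> H; rewrite /edge_wt val_at_edge. Qed.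

(** The formulas of [pieces_sum] on e, read as the degree and the first moment of the chips inside
    e. Together with the equations at the vertices they are also sufficient, by
    [div_build_exists]. *)
Lemma div_edge phi A e : loc_lin phi -> is_div phi A ->
  wsum (edge_wt e (fun=> 1)) A = (slope0 phi e - slope1 phi e)%:~R /\
  phi (vtx (tgt e)) = phi (vtx (src e)) + (slope1 phi e)%:~R * len e
    + wsum (edge_wt e id) A.
Proof.
move=> ll dA; have [s ps ls] := onedge_pieces e ll.
have s0 : (0 < size s)%N by case: s ls {ps} => //= E; have := len_gt0 e; rewrite -E ltxx.
have us : uniq s.
  by apply: (sorted_uniq lt_trans (@lt_irreflexive _ _)); case/piecesP: ps => /path_sorted.
have gt0 t : t \in s -> 0 < t.
  by case/piecesP: ps => /(order_path_min lt_trans)/allP H _ /H.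
pose l := [seq at_edge e t | t <- s & t < len e].
have inl_ t : t \in [seq t <- s | t < len e] -> 0 < t < len e.
  by rewrite mem_filter => /andP[-> /gt0->].
have ul : uniq l.
  rewrite map_inj_in_uniq ?filter_uniq // => t t' /inl_ ht /inl_ ht' /at_edge_inj.
  by case/(_ ht ht').
have W w : wsum (edge_wt e w) A =
    \sum_(t <- s | t < len e) (kink (onedge phi e) t)%:~R * w t.
  rewrite (@wsum_sub _ _ _ _ l) //; last first.
    move=> p; have [[v ->]|[e' [t [ht ->]]]] := gpointP p.
      by rewrite /edge_wt /= eqxx => _.
    rewrite edge_wt_in // => k0; case: (e' =P e) => [ee _|]; last by rewrite eqxx.
    subst e'; move: k0; rewrite dA ord_edge // => k0.
    apply: map_f; rewrite mem_filter; have /andP[_ ->] := ht.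
    apply: contraNT k0 => ts; apply/eqP; apply: (pieces_kink0 ps) => //.
    by rewrite ls.
  rewrite big_map -[RHS]big_filter; apply: eq_big_seq => t /inl_ ht.
  by rewrite dA ord_edge // edge_wt_in // eqxx.
have [E1 E2] := pieces_sum s0 ps; rewrite !ls in E1 E2.
rewrite !W; split.
  rewrite /slope0 /slope1 E1 rmorphB rmorphD /= addrAC subrr add0r.
  by rewrite rmorph_sum /=; apply: eq_bigr => t _; rewrite mulr1.
move: E2; rewrite /onedge at_edge_tgt // at_edge_src // => ->.
by rewrite subr0; congr (_ + _); apply: eq_bigr => t _; rewrite subr0.
Qed.

Lemma hinge_right (x t : R) :
  has_slope (fun h => Num.max 0 (t + h - x)) (if x <= t then 1 else 0).
Proof.
have [xt|tx] := leP x t.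
  exists 1 => // h /andP[h0 _]; rewrite !(max_idPr _) ?mul1r; lra.
exists (x - t); first by rewrite subr_gt0.
move=> h /andP[h0 hx]; rewrite !(max_idPl _) ?mul0r; lra.
Qed.

Lemma hinge_left (x t : R) :
  has_slope (fun h => Num.max 0 (t - h - x)) (if x < t then -1 else 0).
Proof.
have [xt|tx] := ltP x t.
  exists (t - x); first by rewrite subr_gt0.
  by move=> h /andP[h0 hx]; rewrite !(max_idPr _); lra.
by exists 1 => // h /andP[h0 _]; rewrite !(max_idPl _); lra.
Qed.

Section Build.
Variables (A : divisor G) (P : vert G -> R) (k0 k1 : edge G -> int).
Hypothesis HE : forall e, wsum (edge_wt e (fun=> 1)) A = (k0 e - k1 e)%:~R.
Hypothesis HP : forall e,
  P (tgt e) = P (src e) + (k1 e)%:~R * len e + wsum (edge_wt e id) A.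
Hypothesis HV : forall v, coeff (vtx v) A =
  \sum_(e | tgt e == v) k1 e - \sum_(e | src e == v) k0 e.

(** A line of initial slope [k0 e], bent at each chip x by a hinge that starts at x: the second
    antiderivative of the chips on e. *)
Definition build_edge e (t : R) : R := P (src e) + (k0 e)%:~R * t
  - wsum (edge_wt e (fun x => Num.max 0 (t - x))) A.

Definition build p : R :=
  match val p with inl v => P v | inr (e, t) => build_edge e t end.

Lemma build_on e t : 0 <= t <= len e -> onedge build e t = build_edge e t.
Proof.
move=> /andP[t0 tl]; rewrite /onedge.
have [->|tn0] := eqVneq t 0.
  rewrite at_edge_src // /build /build_edge /= mulr0 addr0.
  rewrite /wsum big1 ?subr0 // => p _; have [[v ->]|[e' [x [hx ->]]]] := gpointP p.
    by rewrite /edge_wt /= mulr0.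
  rewrite edge_wt_in //; case: ifP; rewrite ?mulr0 // (max_idPl _) ?mulr0 //; lra.
(* At the far end every hinge is active, so that [HE] and [HP] turn the formula into the prescribed
   value there. *)
have [->|tnl] := eqVneq t (len e).
  rewrite at_edge_tgt // /build /build_edge /= HP.
  suff -> : wsum (edge_wt e (fun x => Num.max 0 (len e - x))) A =
     len e * wsum (edge_wt e (fun=> 1)) A - wsum (edge_wt e id) A.
    by rewrite HE rmorphB /=; ring.
  rewrite -wsumZw -[wsum (edge_wt e id) A]mul1r -mulNr -wsumZw -wsumDw; apply: eq_wsum => p.
  have [[v ->]|[e' [x [hx ->]]]] := gpointP p; first by rewrite /edge_wt /=; ring.
  rewrite !edge_wt_in //; case: eqP => [ee|_]; last by ring.
  subst e'; rewrite (max_idPr _); [ring|lra].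
by rewrite /build val_at_edge // lt_def tn0 t0 /= lt_def eq_sym tnl.
Qed.

Definition mass (P : pred R) e : int := \sum_(p <- dom A)
  coeff p A * (if val p is inr (e', x) then (e' == e) && P x else false).

Lemma build_right e t : 0 <= t < len e ->
  has_slope (fun h => onedge build e (t + h)) (k0 e - mass (fun x => x <= t) e).
Proof.
move=> /andP[t0 tl]; apply: (@has_slope_near _ (fun h => build_edge e (t + h))).
  exists (len e - t); first by rewrite subr_gt0.
  by move=> h hh; rewrite build_on //; lra.
rewrite /build_edge; apply: has_slopeD.
  exists 1 => // h _; ring.
apply: has_slopeN; apply: has_slope_sum => p.
apply: has_slope_mulz; rewrite /edge_wt.
case: (val p) => [v|[e' x]]; first exact: has_slope_cst.
case: (e' == e) => /=; last exact: has_slope_cst.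
by have := hinge_right x t; case: (x <= t).
Qed.

Lemma build_left e t : 0 < t <= len e ->
  has_slope (fun h => onedge build e (t - h)) (- (k0 e - mass (fun x => x < t) e)).
Proof.
move=> /andP[t0 tl]; apply: (@has_slope_near _ (fun h => build_edge e (t - h))).
  by exists t => // h hh; rewrite build_on //; lra.
rewrite /build_edge opprB addrC; apply: has_slopeD.
  exists 1 => // h _; rewrite mulrNz; ring.
rewrite -[mass _ _]opprK; apply: has_slopeN; rewrite /mass -sumrN.
apply: has_slope_sum => p; rewrite -mulrN.
apply: has_slope_mulz; rewrite /edge_wt.
case: (val p) => [v|[e' x]]; first by rewrite oppr0; exact: has_slope_cst.
case: (e' == e) => /=; last by rewrite oppr0; exact: has_slope_cst.
by have := hinge_left x t; case: (x < t).
Qed.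

Lemma build_loc_lin : loc_lin build.
Proof.
move=> e; split=> t ht; [apply: right_linP|apply: left_linP]; eexists.
  exact: build_right.
exact: build_left.
Qed.

Lemma build_slope0 e : slope0 build e = k0 e.
Proof.
rewrite /slope0 /rslope (out_slopeE (build_right _)) ?lexx ?len_gt0 //.
rewrite /mass big1 ?subr0 // => p _; have [[v ->]|[e' [x [hx ->]]]] := gpointP p.
  by rewrite mulr0.
by rewrite val_at_edge // leNgt; case/andP: hx => -> _; rewrite andbF mulr0.
Qed.

Lemma build_slope1 e : slope1 build e = k1 e.
Proof.
rewrite /slope1 /lslope (out_slopeE (build_left _)) ?lexx ?len_gt0 // opprK.
suff : (mass (fun x => x < len e) e)%:~R = (k0 e - k1 e)%:~R :> R.
  by move=> /intr_inj->; lia.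
rewrite -HE /mass -wsum_int; apply: eq_wsum => p.
have [[v ->]|[e' [x [hx ->]]]] := gpointP p; first by [].
rewrite edge_wt_in // val_at_edge //; case: eqP => [ee|//].
by subst e'; case/andP: hx => _ ->.
Qed.

Lemma build_div : is_div build A.
Proof.
move=> p; have [[v ->]|[e [t [ht ->]]]] := gpointP p.
  rewrite ord_vtx HV; congr (_ - _); apply: eq_bigr => e _.
    by rewrite build_slope1.
  by rewrite build_slope0.
rewrite ord_edge // /kink /rslope /lslope.
rewrite (out_slopeE (build_right _)); last lra.
rewrite (out_slopeE (build_left _)); last lra.
rewrite !opprB addrA subrK /mass -sumrB.
have : wsum (fun q => ((q == at_edge e t) : int)%:~R) A =
    (coeff (at_edge e t) A)%:~R :> R.
  by rewrite -wsum_coeff; apply: eq_wsum => q; case: (q == _).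
rewrite wsum_int => /intr_inj <-.
apply: eq_bigr => q _; rewrite -mulrBr; congr (_ * _).
have [[v ->]|[e' [x [hx ->]]]] := gpointP q.
  by rewrite eq_sym at_edge_neq_vtx //.
rewrite val_at_edge //; case: (eqVneq e' e) => [ee|en] /=; last first.
  by case: eqP => // /at_edge_inj[]// E1; rewrite E1 eqxx in en.
subst e'; case: ltgtP => [xt|tx|->]; rewrite ?eqxx ?subrr //;
  by case: eqP => // /at_edge_inj[]// _ E1; rewrite E1 ltxx in xt || rewrite E1 ltxx in tx.
Qed.

End Build.

Lemma div_build_exists A (P : vert G -> R) (k0 k1 : edge G -> int) :
  (forall e, wsum (edge_wt e (fun=> 1)) A = (k0 e - k1 e)%:~R) ->
  (forall e, P (tgt e) = P (src e) + (k1 e)%:~R * len e + wsum (edge_wt e id) A) ->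
  (forall v, coeff (vtx v) A = \sum_(e | tgt e == v) k1 e - \sum_(e | src e == v) k0 e) ->
  exists2 phi, loc_lin phi &
    is_div phi A /\ forall e, slope0 phi e = k0 e /\ slope1 phi e = k1 e.
Proof.
move=> HE HP HV; exists (build A P k0); first exact: build_loc_lin HE HP.
split=> [|e]; first exact: build_div HE HP HV.
by rewrite (build_slope0 HE HP) (build_slope1 HE HP).
Qed.
End Graph.

(** * Principal divisors, linear equivalence and the rank *)

Section Principal.
Context {R : realType} {G : metric_graph R}.
Implicit Types (phi psi : gpoint G -> R) (e : edge G) (p : gpoint G) (v : vert G).
Implicit Types (A B D E F : divisor G).

Lemma loc_lin_slope0 phi e : loc_lin phi ->
  has_slope (onedge phi e) (slope0 phi e).
Proof.
move=> /(_ e)[/(_ 0)H _]; apply: has_slope_near (H _).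
  by exists 1 => // h _; rewrite add0r.
by rewrite lexx len_gt0.
Qed.

Lemma loc_lin_slope1 phi e : loc_lin phi ->
  has_slope (fun h => onedge phi e (len e - h)) (- slope1 phi e).
Proof.
move=> /(_ e)[_ /(_ (len e))H]; rewrite /slope1 opprK; apply: H.
by rewrite lexx len_gt0.
Qed.

Lemma loc_linD phi psi : loc_lin phi -> loc_lin psi -> loc_lin (fun p => phi p + psi p).
Proof.
move=> lphi lpsi e; have [r1 l1] := lphi e; have [r2 l2] := lpsi e.
split=> t ht; [apply: right_linP|apply: left_linP]; eexists.
  exact: has_slopeD (r1 t ht) (r2 t ht).
exact: has_slopeD (l1 t ht) (l2 t ht).
Qed.

Lemma loc_linN phi : loc_lin phi -> loc_lin (fun p => - phi p).
Proof.
move=> lphi e; have [r1 l1] := lphi e.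
split=> t ht; [apply: right_linP|apply: left_linP]; eexists.
  exact: has_slopeN (r1 t ht).
exact: has_slopeN (l1 t ht).
Qed.

Lemma loc_linDc phi (c : R) : loc_lin phi -> loc_lin (fun p => phi p + c).
Proof.
move=> lphi e; have [r1 l1] := lphi e.
split=> t ht; [apply: right_linP|apply: left_linP]; eexists.
  exact: has_slopeDc (r1 t ht).
exact: has_slopeDc (l1 t ht).
Qed.

Lemma loc_lin_cst (c : R) : loc_lin (fun _ : gpoint G => c).
Proof.
move=> e.
split=> t ht; [apply: right_linP|apply: left_linP]; exists 0; exact: has_slope_cst.
Qed.

Lemma loc_lin_min (I : Type) (r : seq I) (phi0 : gpoint G -> R) (phi : I -> gpoint G -> R) :
  loc_lin phi0 -> (forall i, loc_lin (phi i)) ->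
  loc_lin (fun p => \big[Num.min/phi0 p]_(i <- r) phi i p).
Proof.
move=> l0 ll e; split=> t ht; [apply: right_linP|apply: left_linP].
  exact: (has_slope_minl _ (proj1 (l0 e) t ht) (fun i => proj1 (ll i e) t ht)).
exact: (has_slope_minl _ (proj2 (l0 e) t ht) (fun i => proj2 (ll i e) t ht)).
Qed.

Lemma rslopeD (f g : R -> R) t : right_lin f t -> right_lin g t ->
  rslope (fun t => f t + g t) t = rslope f t + rslope g t.
Proof. by move=> lf lg; apply/out_slopeE/has_slopeD. Qed.

Lemma lslopeD (f g : R -> R) t : left_lin f t -> left_lin g t ->
  lslope (fun t => f t + g t) t = lslope f t + lslope g t.
Proof. by move=> lf lg; apply/out_slopeE/has_slopeD. Qed.

Lemma rslopeN (f : R -> R) t : right_lin f t ->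
  rslope (fun t => - f t) t = - rslope f t.
Proof. by move=> lf; apply/out_slopeE/has_slopeN. Qed.

Lemma lslopeN (f : R -> R) t : left_lin f t ->
  lslope (fun t => - f t) t = - lslope f t.
Proof. by move=> lf; apply/out_slopeE/has_slopeN. Qed.

Lemma kinkN (f : R -> R) t : right_lin f t -> left_lin f t ->
  kink (fun t => - f t) t = - kink f t.
Proof. by move=> rf lf; rewrite /kink rslopeN ?lslopeN //; lia. Qed.

Lemma in_cc_cO (t b : R) : 0 < t < b -> 0 <= t < b /\ 0 < t <= b.
Proof. by move=> /andP[a c]; rewrite a c !ltW. Qed.

Lemma is_divD phi psi A B : loc_lin phi -> loc_lin psi ->
  is_div phi A -> is_div psi B -> is_div (fun p => phi p + psi p) (A + B).
Proof.
move=> lphi lpsi dA dB p; rewrite coeffD dA dB.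
have [[v ->]|[e [t [ht ->]]]] := gpointP p.
  rewrite !ord_vtx addrACA -opprD -!big_split /=.
  congr (_ - _); apply: eq_bigr => e _.
    rewrite /slope1 /onedge lslopeD; first by lia.
      by apply: (proj2 (lphi e)); rewrite lexx len_gt0.
    by apply: (proj2 (lpsi e)); rewrite lexx len_gt0.
  rewrite /slope0 /onedge rslopeD //.
    by apply: (proj1 (lphi e)); rewrite lexx len_gt0.
  by apply: (proj1 (lpsi e)); rewrite lexx len_gt0.
have [h1 h2] := in_cc_cO ht; have [r1 l1] := lphi e; have [r2 l2] := lpsi e.
rewrite !ord_edge // /kink /onedge rslopeD ?lslopeD //; try by [apply: r1|apply: r2|apply: l1|apply: l2].
by rewrite /onedge; lia.
Qed.

Lemma is_divN phi A : loc_lin phi -> is_div phi A -> is_div (fun p => - phi p) (- A).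
Proof.
move=> lphi dA p; rewrite coeffN dA.
have [[v ->]|[e [t [ht ->]]]] := gpointP p.
  rewrite !ord_vtx opprD -!sumrN.
  congr (_ + _); apply: eq_bigr => e _.
    rewrite /slope1 /onedge lslopeN //.
    by apply: (proj2 (lphi e)); rewrite lexx len_gt0.
  rewrite /slope0 /onedge rslopeN //.
  by apply: (proj1 (lphi e)); rewrite lexx len_gt0.
have [h1 h2] := in_cc_cO ht; have [r1 l1] := lphi e.
by rewrite !ord_edge // /onedge kinkN //; [apply: r1|apply: l1].
Qed.

(** Kinks vanish away from the finitely many breakpoints, so the orders have finite support. *)
Lemma div_exists phi : loc_lin phi -> exists A, is_div phi A.
Proof.
move=> ll.
have /choice[s hs] : forall e, exists s, pieces (onedge phi e) 0 s /\ last 0 s = len e.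
  by move=> e; have [s ps ls] := onedge_pieces e ll; exists s.
pose l := undup ([seq vtx v | v <- enum (vert G)] ++
  flatten [seq [seq at_edge e t | t <- s e] | e <- enum (edge G)]).
exists (\sum_(q <- l) << ord_at phi q *g q >>) => p.
rewrite coeff_sumU ?undup_uniq //; case: ifPn => //.
rewrite mem_undup mem_cat negb_or => /andP[pv pe]; apply/esym.
have [[v pE]|[e [t [ht pE]]]] := gpointP p.
  by case/negP: pv; rewrite pE map_f // mem_enum.
rewrite pE ord_edge //; have [ps ls] := hs e.
apply: (pieces_kink0 ps); first by rewrite ls.
apply: contra pe => ts; rewrite pE; apply/flatten_mapP; exists e.
  by rewrite mem_enum.
exact: map_f.
Qed.

Definition principal A := exists2 phi, loc_lin phi & is_div phi A.

Lemma lin_equivP D D' : lin_equiv D D' <-> principal (D - D').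
Proof. by split=> -[phi /is_PLP lphi dphi]; exists phi => //; apply/is_PLP. Qed.

Lemma principalD A B : principal A -> principal B -> principal (A + B).
Proof.
by move=> [phi l1 d1] [psi l2 d2]; eexists; [exact: loc_linD l1 l2|exact: is_divD].
Qed.

Lemma principalN A : principal A -> principal (- A).
Proof. by move=> [phi l1 d1]; eexists; [exact: loc_linN l1|exact: is_divN]. Qed.

(** Whatever the divisor A of a constant function is, the sum of this function and its opposite has
    divisor A - A. *)
Lemma principal0 : principal 0.
Proof.
have [A dA] := div_exists (loc_lin_cst 0).
have := is_divD (loc_lin_cst 0) (loc_linN (loc_lin_cst 0)) dA (is_divN (loc_lin_cst 0) dA).
rewrite (subrr A) => H.
exact: (ex_intro2 _ _ _ (loc_linD (loc_lin_cst 0) (loc_linN (loc_lin_cst 0))) H).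
Qed.

Lemma lin_equiv_refl D : lin_equiv D D.
Proof. by apply/lin_equivP; rewrite subrr; apply: principal0. Qed.

Lemma lin_equiv_sym D E : lin_equiv D E -> lin_equiv E D.
Proof. by move=> /lin_equivP/principalN; rewrite opprB => /lin_equivP. Qed.

Lemma lin_equiv_trans D E F : lin_equiv D E -> lin_equiv E F -> lin_equiv D F.
Proof.
move=> /lin_equivP p1 /lin_equivP p2; apply/lin_equivP.
by have := principalD p1 p2; rewrite addrA subrK.
Qed.

Lemma lin_equivD D E F : lin_equiv D E -> lin_equiv (D + F) (E + F).
Proof. by move=> /lin_equivP H; apply/lin_equivP; rewrite opprD addrACA subrr addr0. Qed.

Lemma pic_eqP D E : pic D = pic E <-> lin_equiv D E.
Proof.
split=> [eq|DE].
  have : pic E E by apply: lin_equiv_refl.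
  by rewrite -eq.
apply/seteqP; split=> F; rewrite /pic /=; apply: lin_equiv_trans => //.
exact: lin_equiv_sym.
Qed.

Lemma principal_deg A : principal A -> deg A = 0.
Proof.
move=> [phi ll dA]; apply: (@intr_inj R); rewrite -wsum_deg.
(* The weight 1 is split into the indicators of the vertices and of the open edges. Each slope at an
   end of an edge then occurs twice, with opposite signs. *)
have E p : 1 = \sum_(v : vert G) (p == vtx v)%:R + \sum_(e : edge G) edge_wt e (fun=> 1) p :> R.
  have [[v ->]|[e [t [ht ->]]]] := gpointP p.
    rewrite (bigD1 v) //= eqxx big1 ?big1 ?addr0 // => w wv.
    by rewrite (inj_eq vtx_inj) eq_sym (negPf wv).
  rewrite big1 ?add0r => [|v _]; last by rewrite at_edge_neq_vtx.
  rewrite (bigD1 e) //= edge_wt_in // eqxx big1 ?addr0 // => e' ee.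
  by rewrite edge_wt_in // eq_sym (negPf ee).
rewrite (eq_wsum _ E) wsumDw !wsum_sumw.
under eq_bigr do rewrite wsum_coeff.
under [X in _ + X]eq_bigr do rewrite (proj1 (div_edge _ ll dA)).
rewrite -!rmorph_sum -rmorphD /=; congr (_%:~R).
under eq_bigr do rewrite dA ord_vtx.
rewrite sumrB sumrB.
have S (f : edge G -> int) (h : edge G -> vert G) :
    \sum_v \sum_(e | h e == v) f e = \sum_e f e.
  by rewrite [RHS](partition_big h xpredT).
by rewrite !S; ring.
Qed.

Lemma lin_equiv_deg D E : lin_equiv D E -> deg D = deg E.
Proof. by move=> /lin_equivP/principal_deg/eqP; rewrite degB subr_eq0 => /eqP. Qed.

Lemma eq_effective_equiv D E : lin_equiv D E -> eq_effective D -> eq_effective E.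
Proof.
move=> DE [F F0 DF]; exists F => //.
exact: lin_equiv_trans (lin_equiv_sym DE) DF.
Qed.

Lemma rank_ge_equiv D E n : lin_equiv D E -> rank_ge D n -> rank_ge E n.
Proof.
by move=> DE H F F0 dF; apply: eq_effective_equiv (H F F0 dF); apply: lin_equivD.
Qed.

Lemma effectiveD D E : effective D -> effective E -> effective (D + E).
Proof. by move=> D0 E0 p; rewrite coeffD addr_ge0. Qed.

Lemma effectiveU p : effective << p >>.
Proof. by move=> q; rewrite coeffU mul1r; case: (p == q). Qed.

Lemma effective_sum (I : Type) (r : seq I) (P : pred I) (F : I -> divisor G) :
  (forall i, P i -> effective (F i)) -> effective (\sum_(i <- r | P i) F i).
Proof.
move=> H; apply: big_ind => //; last exact: effectiveD.
by move=> q; rewrite coeff0.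
Qed.

Lemma effectiveMn D n : effective D -> effective (D *+ n).
Proof. by move=> D0 p; rewrite coeffMn mulrn_wge0. Qed.

Lemma effective_deg_ge0 D : effective D -> 0 <= deg D.
Proof.
move=> D0; rewrite -(ler0z R) -wsum_deg; exact: wsum_ge0.
Qed.

Lemma eq_effective_deg D : eq_effective D -> 0 <= deg D.
Proof. by case=> F /effective_deg_ge0 F0 /lin_equiv_deg->. Qed.

Lemma rank_ge_deg (p : gpoint G) D n : rank_ge D n -> n%:Z <= deg D.
Proof.
move=> /(_ (<< p >> *+ n)) H; rewrite -subr_ge0.
have dn : deg (<< p >> *+ n) = n by rewrite degMn degU; lia.
have := eq_effective_deg (H _ dn); rewrite degB dn; apply.
exact/effectiveMn/effectiveU.
Qed.

(** Chips at p fill E up to degree n and are returned afterwards. *)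
Lemma rank_ge_le (p : gpoint G) D m n : (m <= n)%N -> rank_ge D n -> rank_ge D m.
Proof.
move=> mn H E E0 dE; have [] := H (E + << p >> *+ (n - m)).
- by apply: effectiveD => //; apply/effectiveMn/effectiveU.
- by rewrite degD dE degMn degU; lia.
move=> F F0 eqF; exists (F + << p >> *+ (n - m)).
  by apply: effectiveD => //; apply/effectiveMn/effectiveU.
by have := lin_equivD (<< p >> *+ (n - m)) eqF; rewrite opprD addrA subrK.
Qed.

Lemma rank_ge0 D : rank_ge D 0 <-> eq_effective D.
Proof.
split=> [H|H E E0 dE].
  have := H 0; rewrite subr0 deg0; apply=> // p; by rewrite coeff0.
suff -> : E = 0 by rewrite subr0.
by apply: fgpos_eq0P => //; apply/fgposP.
Qed.

(** The maximum chosen in [rk] exists because the degree of D bounds every n with [rank_ge D n]; the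
    bound is obtained by placing n chips at p. *)
Lemma rk_ge (p : gpoint G) D (n : nat) : n%:Z <= rk D <-> rank_ge D n.
Proof.
rewrite /rk; case: asboolP => eD; last first.
  split=> [|H]; first by rewrite leNgt.
  by case: eD; apply/rank_ge0/(rank_ge_le p _ H).
set S := [set _ | _].
suff /(xgetPex 0%N) : exists m, S m.
  move: (xget _ _) => m -[Hm Mm]; split=> H.
    by apply: (rank_ge_le p) Hm; move: H; lia.
  by have := Mm _ H; lia.
have [m Sm Mm] : exists2 m, rank_ge D m & forall k, rank_ge D k -> (k <= m)%N.
  have ex0 : exists m, `[< rank_ge D m >] by exists 0%N; apply/asboolP/rank_ge0.
  have ub m : `[< rank_ge D m >] -> (m <= `|deg D|)%N.
    by move=> /asboolP/(rank_ge_deg p); lia.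
  case: (ex_maxnP ex0 ub) => m /asboolP Hm Mm; exists m => // k Hk.
  by apply: Mm; apply/asboolP.
by exists m.
Qed.

Lemma rk_ge_m1 D : -1 <= rk D.
Proof. by rewrite /rk; case: asboolP => // _; lia. Qed.

Lemma rk_equiv D E : lin_equiv D E -> rk D = rk E.
Proof.
move=> DE; rewrite /rk.
have -> : `[< eq_effective D >] = `[< eq_effective E >].
  by apply/asbool_equiv_eq; split; apply: eq_effective_equiv => //; apply: lin_equiv_sym.
case: ifP => // _; congr (Posz (xget _ _)).
have -> : rank_ge D = rank_ge E; last by [].
apply: funext => n; apply: propext.
by split; apply: rank_ge_equiv => //; apply: lin_equiv_sym.
Qed.

Lemma slope0_le phi psi e : loc_lin phi -> loc_lin psi -> (forall q, phi q <= psi q) ->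
  phi (vtx (src e)) = psi (vtx (src e)) -> slope0 phi e <= slope0 psi e.
Proof.
move=> l1 l2 le eq; apply: has_slope_le (loc_lin_slope0 e l1) (loc_lin_slope0 e l2) _ _.
  by rewrite /onedge at_edge_src.
by move=> h; apply: le.
Qed.

Lemma slope1_ge phi psi e : loc_lin phi -> loc_lin psi -> (forall q, phi q <= psi q) ->
  phi (vtx (tgt e)) = psi (vtx (tgt e)) -> slope1 psi e <= slope1 phi e.
Proof.
move=> l1 l2 le eq; rewrite -lerN2.
apply: has_slope_le (loc_lin_slope1 e l1) (loc_lin_slope1 e l2) _ _.
  by rewrite subr0 /onedge at_edge_tgt.
by move=> h; apply: le.
Qed.

Lemma kink_le phi psi e t : loc_lin phi -> loc_lin psi -> (forall q, phi q <= psi q) ->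
  0 < t < len e -> phi (at_edge e t) = psi (at_edge e t) ->
  rslope (onedge phi e) t <= rslope (onedge psi e) t /\
  lslope (onedge phi e) t <= lslope (onedge psi e) t.
Proof.
move=> l1 l2 le /in_cc_cO[h1 h2] eq; have [r1 s1] := l1 e; have [r2 s2] := l2 e.
split.
  apply: has_slope_le (r1 t h1) (r2 t h1) _ _; first by rewrite addr0.
  by move=> h; apply: le.
apply: has_slope_le (s1 t h2) (s2 t h2) _ _; first by rewrite subr0.
by move=> h; apply: le.
Qed.

(** Where phi touches psi from below, its outgoing slopes are at most those of psi, and orders are
    minus the sums of these slopes. *)
Lemma ord_le phi psi p : loc_lin phi -> loc_lin psi -> (forall q, phi q <= psi q) ->
  phi p = psi p -> ord_at psi p <= ord_at phi p.
Proof.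
move=> l1 l2 le; have [[v ->]|[e [t [ht ->]]]] := gpointP p => eq.
  rewrite !ord_vtx lerB //; apply: ler_sum => e /eqP ev.
    by apply: slope1_ge; rewrite ?ev.
  by apply: slope0_le; rewrite ?ev.
have [] := kink_le l1 l2 le ht eq; rewrite !ord_edge // /kink; lia.
Qed.

(** A half-edge is an edge with one of its ends, [true] for the target; [hslope] is the slope going
    out from that end. *)
Definition hend (d : edge G * bool) : vert G := if d.2 then tgt d.1 else src d.1.
Definition hslope phi (d : edge G * bool) : int :=
  if d.2 then - slope1 phi d.1 else slope0 phi d.1.

Lemma ord_vtx_half phi v : ord_at phi (vtx v) = - \sum_(d | hend d == v) hslope phi d.
Proof.
rewrite ord_vtx.
have -> : \sum_(d | hend d == v) hslope phi d =
    \sum_(e : edge G) \sum_(b : bool | hend (e, b) == v) hslope phi (e, b).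
  by rewrite pair_big_dep /=; apply: eq_big => [[e b]|[e b]].
under [in RHS]eq_bigr do rewrite big_mkcond big_bool /hend /hslope /=.
rewrite big_split /= -!big_mkcond /= [X in - (X + _)]sumrN; ring.
Qed.

(** The comparison of orders with the slope gap along one half-edge d kept: this gap pays for
    several chips at one vertex. *)
Lemma ord_le_half phi psi d : loc_lin phi -> loc_lin psi -> (forall q, phi q <= psi q) ->
  phi (vtx (hend d)) = psi (vtx (hend d)) ->
  ord_at psi (vtx (hend d)) + (hslope psi d - hslope phi d) <= ord_at phi (vtx (hend d)).
Proof.
move=> l1 l2 le eq; rewrite !ord_vtx_half (bigD1 d) //= [in leRHS](bigD1 d) //=.
set s := \sum_(_ | _) hslope psi _; set s' := \sum_(_ | _) hslope phi _.
suff : s' <= s by lia.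
apply: ler_sum => -[e []] /andP[/eqP ev _]; rewrite /hslope /=.
  by rewrite lerN2; apply: slope1_ge => //; rewrite -[tgt e]/(hend (e, true)) ev.
by apply: slope0_le => //; rewrite -[src e]/(hend (e, false)) ev.
Qed.

Lemma hslope_le phi psi d : loc_lin phi -> loc_lin psi -> (forall q, phi q <= psi q) ->
  phi (vtx (hend d)) = psi (vtx (hend d)) -> hslope phi d <= hslope psi d.
Proof.
case: d => e [] l1 l2 le eq; rewrite /hslope /=.
  by rewrite lerN2; apply: slope1_ge.
exact: slope0_le.
Qed.

Lemma hslopeDc phi (c : R) d : loc_lin phi -> hslope (fun p => phi p + c) d = hslope phi d.
Proof.
case: d => e [] ll; rewrite /hslope /=.
  congr (- - _); apply: out_slopeE; apply: has_slopeDc.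
  by apply: (proj2 (ll e)); rewrite lexx len_gt0.
apply: out_slopeE; apply: has_slopeDc.
by apply: (proj1 (ll e)); rewrite lexx len_gt0.
Qed.

Lemma is_divDc phi (c : R) A : loc_lin phi -> is_div phi A -> is_div (fun p => phi p + c) A.
Proof.
move=> ll dA p; rewrite dA; apply/eqP; rewrite eq_le; apply/andP.
have [B dB] := div_exists (loc_lin_cst c).
have B0 : B = 0.
  apply/eqP/freeg_eqP => q; rewrite coeff0 dB.
  have [[v ->]|[e [t [ht ->]]]] := gpointP q.
    rewrite ord_vtx !big1 // => e _.
      by apply: out_slopeE; apply: has_slope_cst.
    by rewrite /slope1 (_ : lslope _ _ = 0) //; apply: out_slopeE; apply: has_slope_cst.
  have r0 : rslope (onedge (fun=> c) e) t = 0 by apply/out_slopeE/has_slope_cst.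
  have l0 : lslope (onedge (fun=> c) e) t = 0 by apply/out_slopeE/has_slope_cst.
  by rewrite ord_edge // /kink r0 l0 subr0.
have := is_divD ll (loc_lin_cst c) dA dB p.
by rewrite B0 addr0 dA => ->.
Qed.

End Principal.

(** * Lower bounds for the rank *)

Section ChipSwap.
Context {R : realType} {G : metric_graph R}.
Implicit Types (phi psi : gpoint G -> R) (e : edge G) (p : gpoint G) (v : vert G).
Implicit Types (A B D E F : divisor G).

Lemma wsum_at_edge e e' (w : R -> R) x : 0 <= x <= len e ->
  wsum (edge_wt e' w) << at_edge e x >> =
  if (e' == e) && (0 < x < len e) then w x else 0.
Proof.
move=> /andP[x0 xl]; rewrite wsumU1.
have [->|xn0] := eqVneq x 0; first by rewrite at_edge_src // ltxx andbF.
have [->|xnl] := eqVneq x (len e); first by rewrite at_edge_tgt // ltxx !andbF.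
have hx : 0 < x < len e by rewrite !lt_def xn0 x0 eq_sym xnl.
by rewrite edge_wt_in // hx andbT eq_sym.
Qed.

Lemma coeff_at_edge e v x : 0 <= x <= len e ->
  coeff (vtx v) << at_edge e x >> =
  (x == 0)%:Z * (src e == v)%:Z + (x == len e)%:Z * (tgt e == v)%:Z.
Proof.
move=> /andP[x0 xl]; rewrite coeffU mul1r.
have [->|xn0] := eqVneq x 0.
  by rewrite at_edge_src // (inj_eq vtx_inj) (lt_eqF (len_gt0 e)) mul1r addr0; case: eqP.
have [->|xnl] := eqVneq x (len e).
  by rewrite at_edge_tgt // (inj_eq vtx_inj) mul0r add0r mul1r; case: eqP.
by rewrite at_edge_neq_vtx // !lt_def xn0 x0 eq_sym xnl.
Qed.

(** The equality of the first moments, a + b = c + d, allows a function that vanishes at every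
    vertex and outside of e. *)
Lemma chip_swap e a b c d : a + b = c + d ->
  0 <= a <= len e -> 0 <= b <= len e -> 0 <= c <= len e -> 0 <= d <= len e ->
  principal (<< at_edge e a >> + << at_edge e b >> - << at_edge e c >> - << at_edge e d >>).
Proof.
move=> abcd ha hb hc hd.
pose S (f : R -> int) := f a + f b - f c - f d.
(* Chips at an end of e are not inside e; they enter through the slope at that end. *)
pose k0 e' : int := if e' == e then - S (fun x => (x == 0)%:Z) else 0.
pose k1 e' : int := if e' == e then S (fun x => (x == len e)%:Z) else 0.
have cases x : 0 <= x <= len e ->
    (0 < x < len e)%R%:Z = 1 - (x == 0)%:Z - (x == len e)%:Z.
  have l0 := len_gt0 e; move=> /andP[x0 xl].
  have [->|xn0] := eqVneq x 0; first by rewrite ltxx (lt_eqF l0).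
  have [->|xnl] := eqVneq x (len e); first by rewrite ltxx andbF.
  by rewrite !lt_def xn0 x0 eq_sym xnl xl.
set A := _ - _.
have HE e' : wsum (edge_wt e' (fun=> 1)) A = (k0 e' - k1 e')%:~R.
  rewrite !(wsumD, wsumN) !wsum_at_edge //.
  rewrite /k0 /k1; case: eqP => _ /=; last by rewrite subr0; ring.
  have I (b0 : bool) : (if b0 then 1 else 0) = (b0%:Z)%:~R :> R by case: b0.
  by rewrite !I -!(intrD, intrB) /=; congr (_%:~R); rewrite /S (cases a ha) (cases b hb) (cases c hc) (cases d hd); ring.
have HP e' : 0 = 0 + (k1 e')%:~R * len e' + wsum (edge_wt e' id) A.
  rewrite !(wsumD, wsumN) !wsum_at_edge //.
  rewrite /k1; case: eqP => [->|_] /=; last by ring.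
  have I x : 0 <= x <= len e -> (if 0 < x < len e then x else 0) =
      x - len e * (x == len e)%:Z%:~R :> R.
    move=> /andP[x0 xl]; have [->|xn0] := eqVneq x 0.
      by rewrite ltxx (lt_eqF (len_gt0 e)) /= mulr0 subr0.
    have [->|xnl] := eqVneq x (len e); first by rewrite ltxx andbF mulr1 subrr.
    by rewrite !lt_def xn0 x0 eq_sym xnl xl mulr0 subr0.
  by rewrite (I a ha) (I b hb) (I c hc) (I d hd) /S !(rmorphD, rmorphB) /=; lra.
have HV v : coeff (vtx v) A =
    \sum_(e' | tgt e' == v) k1 e' - \sum_(e' | src e' == v) k0 e'.
  rewrite !(coeffD, coeffN) !coeff_at_edge // /k0 /k1.
  have P (h : edge G -> vert G) (k : int) :
      \sum_(e' | h e' == v) (if e' == e then k else 0) = (h e == v)%:Z * k.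
    rewrite -big_mkcondr /=; have [hv|hv] := eqVneq (h e) v.
      rewrite (big_pred1 e) ?mul1r // => e'.
      by rewrite /=; have [->|] := eqVneq e' e; rewrite ?hv ?eqxx ?andbF.
    rewrite big_pred0 ?mul0r // => e'.
    by have [->|] := eqVneq e' e; rewrite ?(negPf hv) ?andbF.
  by rewrite !P /S; ring.
have [phi ll [dphi _]] := div_build_exists (P := fun=> 0) HE HP HV.
by exists phi.
Qed.

End ChipSwap.

(** * Moving a chip to an interior point of an edge *)

Section SegmentSupport.
Context {R : realType} {G : metric_graph R}.
Implicit Types (phi psi : gpoint G -> R) (e : edge G) (p : gpoint G) (v : vert G).
Implicit Types (A B D E F : divisor G).

(** The chips at x and y move by the same distance in opposite directions, one to q and the other to
    x + y - q. Since e is not a loop, x and y are different points even when they are its two ends,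
    so both chips can be taken from F. *)
Lemma segment_chips e q x y F : src e != tgt e -> effective F ->
  0 <= x < q -> q < y <= len e ->
  1 <= coeff (at_edge e x) F -> 1 <= coeff (at_edge e y) F ->
  exists2 F', effective F' & principal (F' - F) /\ 1 <= coeff (at_edge e q) F'.
Proof.
move=> st F0 /andP[x0 xq] /andP[qy yl] Fx Fy.
have xy : (at_edge e x == at_edge e y) = false.
  have [xe|xn0] := eqVneq x 0.
    rewrite xe at_edge_src //; have [->|ynl] := eqVneq y (len e).
      by rewrite at_edge_tgt // (inj_eq vtx_inj) (negPf st).
    by rewrite eq_sym at_edge_neq_vtx // (lt_def y) eq_sym ynl yl andbT; lra.
  have [->|ynl] := eqVneq y (len e).
    by rewrite [at_edge e (len e)]at_edge_tgt // at_edge_neq_vtx //; lra.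
  have hx : 0 < x < len e by lra.
  have hy : 0 < y < len e by rewrite (lt_def y) eq_sym ynl yl andbT; lra.
  by apply/eqP => /(at_edge_inj hx hy)[_]; lra.
exists (F + (<< at_edge e q >> + << at_edge e (x + y - q) >>
          - << at_edge e x >> - << at_edge e y >>)).
  move=> p; rewrite !(coeffD, coeffN) !coeffU !mul1r.
  have := F0 p; have [<-|px] := eqVneq (at_edge e x) p.
    by rewrite (eq_sym (at_edge e y)) xy; case: (_ == _); case: (_ == _); lia.
  by have [<-|py] := eqVneq (at_edge e y) p; case: (_ == _); case: (_ == _); lia.
split; first by rewrite addrAC subrr add0r; apply: chip_swap; lra.
rewrite !(coeffD, coeffN) !coeffU !mul1r eqxx.
have hq : 0 < q < len e by lra.
have ne z : z != q -> 0 <= z <= len e -> (at_edge e z == at_edge e q) = false.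
  move=> zq /andP[z0 zl]; have [->|zn0] := eqVneq z 0.
    by rewrite [at_edge e 0]at_edge_src // eq_sym at_edge_neq_vtx.
  have [->|znl] := eqVneq z (len e).
    by rewrite [at_edge e (len e)]at_edge_tgt // eq_sym at_edge_neq_vtx.
  apply/eqP => /at_edge_inj[] //; first by rewrite !lt_def zn0 z0 eq_sym znl.
  by move=> _ zE; rewrite zE eqxx in zq.
rewrite (ne x) ?(ne y); try lra; have := F0 (at_edge e q); case: (_ == _); lia.
Qed.

Lemma ge1_of_ge0 (k : int) : 0 <= k -> k <> 0 -> 1 <= k.
Proof. lia. Qed.

(** An intermediate value argument. For the truncation of f at the height of q, either q is a kink
    and receives a chip, or the resulting divisor has chips on both sides of q, and [segment_chips]
    brings one of them to q. *)
Lemma segment_support e q F1 F2 : src e != tgt e -> 0 < q < len e ->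
  effective F1 -> effective F2 -> principal (F2 - F1) ->
  1 <= coeff (vtx (src e)) F1 -> 1 <= coeff (vtx (tgt e)) F2 ->
  exists2 F', effective F' & principal (F' - F1) /\ 1 <= coeff (at_edge e q) F'.
Proof.
move=> st hq F10 F20 [f lf df] F1v F2w.
have [F1q|F1q] := pselect (coeff (at_edge e q) F1 = 0); last first.
  by exists F1 => //; rewrite subrr; split; [exact: principal0|exact: ge1_of_ge0].
have [F2q|F2q] := pselect (coeff (at_edge e q) F2 = 0); last first.
  by exists F2 => //; split; [exists f|exact: ge1_of_ge0].
have ordf p : ord_at f p = coeff p F2 - coeff p F1 by rewrite -df coeffB.
have kf : kink (onedge f e) q = 0 by rewrite -ord_edge // ordf F1q F2q subrr.
set c := f (at_edge e q).
(* Truncating f at height c moves F1 part of the way to F2. *)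
pose g p := Num.min (f p) c.
have lg : loc_lin g.
  by have := loc_lin_min [:: tt] (loc_lin_cst c) (fun=> lf);
     rewrite (_ : (fun p => _) = g) //; apply: funext => p; rewrite big_seq1_id.
have lc : loc_lin (fun _ : gpoint G => c) by exact: loc_lin_cst.
have gf p : g p <= f p by rewrite /g ge_min lexx.
have gc p : g p <= c by rewrite /g ge_min lexx orbT.
have ordc p : ord_at (fun _ : gpoint G => c) p = 0.
  have [B dB] := div_exists lc.
  have := is_divD lc lc dB dB p; have := is_divDc c lc dB p; rewrite coeffD dB.
  by rewrite -dB => <- H; lia.
have ordgc p : c <= f p -> 0 <= ord_at g p.
  by move=> cf; rewrite -(ordc p); apply: ord_le => //; rewrite /g (min_idPr cf).
have ordgf p : f p <= c -> ord_at f p <= ord_at g p.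
  by move=> cf; apply: ord_le => //; rewrite /g (min_idPl cf).
have [A dA] := div_exists lg.
pose F := F1 + A.
have FE p : coeff p F = coeff p F1 + ord_at g p by rewrite coeffD dA.
have F0 : effective F.
  move=> p; rewrite FE; have := F10 p; have := F20 p.
  by case: (leP (f p) c) => [/ordgf|/ltW/ordgc]; rewrite ?ordf; lia.
have pF : principal (F - F1) by rewrite addrAC subrr add0r; exists g.
have gq : g (at_edge e q) = c by rewrite /g minxx.
have [h1 h2] := in_cc_cO hq.
have [rf lf'] := lf e.
have rgq : rslope (onedge g e) q = Num.min (rslope (onedge f e) q) 0.
  apply: out_slopeE; have := has_slope_min (rf q h1) (has_slope_cst c).
  by rewrite addr0 ltxx.
have lgq : lslope (onedge g e) q = Num.min (lslope (onedge f e) q) 0.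
  apply: out_slopeE; have := has_slope_min (lf' q h2) (has_slope_cst c).
  by rewrite subr0 ltxx.
(* The outgoing slopes of f at q are opposite. If they are nonzero, exactly one of them is cut to 0,
   which leaves a positive kink. *)
have [k0|k0] := eqVneq (rslope (onedge f e) q) 0; last first.
  exists F => //; split=> //; rewrite FE F1q add0r ord_edge // /kink rgq lgq.
  by move: kf k0; rewrite /kink; lia.
have l0 : lslope (onedge f e) q = 0 by move: kf; rewrite /kink k0; lia.
have [rg lg'] := lg e.
(* To either side of q, g is at most c, and constant where F has no chips. *)
have kg t : 0 < t < len e -> coeff (at_edge e t) F = 0 -> kink (onedge g e) t <= 0.
  by move=> ht; rewrite FE ord_edge // => H; have := F10 (at_edge e t); lia.
have [x hx Fx] : exists2 x, 0 <= x < q & 1 <= coeff (at_edge e x) F.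
  have [//|nx] := pselect (exists2 x, 0 <= x < q & 1 <= coeff (at_edge e x) F).
  have Fz t : 0 <= t < q -> coeff (at_edge e t) F = 0.
    move=> ht; have [//|/ge1_of_ge0 H] := pselect (coeff (at_edge e t) F = 0).
    by case: nx; exists t => //; apply: H.
  have q0 : 0 < q by lra.
  exists 0; first by rewrite lexx.
  rewrite at_edge_src // FE.
  suff : 0 <= ord_at g (vtx (src e)) by move: F1v; lia.
  (* Without chips on [0, q), g is convex there with slope 0 at q, so it cannot be below c at the
     source. There g thus has nonnegative order, and the chip of F1 stays. *)
  apply: ordgc; rewrite leNgt; apply/negP => fc.
  have : g (vtx (src e)) < c by rewrite /g (min_idPl (ltW fc)).
  have [||| _] := @concave_right _ (fun t => - onedge g e t) 0 q q0.
  - move=> t ht; apply: right_linP; eexists; apply: has_slopeN; apply: rg; lra.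
  - move=> t ht; apply: left_linP; eexists; apply: has_slopeN; apply: lg'; lra.
  - move=> t ht; rewrite kinkN ?oppr_ge0; first by apply: kg; [lra|apply: Fz; lra].
      by apply: rg; lra.
    by apply: lg'; lra.
  rewrite lslopeN ?lgq ?l0 ?minxx ?oppr0 ?mul0r ?addr0; last by apply: lg'; lra.
  by rewrite /onedge gq at_edge_src //; lra.
have [y hy Fy] : exists2 y, q < y <= len e & 1 <= coeff (at_edge e y) F.
  have [//|ny] := pselect (exists2 y, q < y <= len e & 1 <= coeff (at_edge e y) F).
  have Fz t : q < t <= len e -> coeff (at_edge e t) F = 0.
    move=> ht; have [//|/ge1_of_ge0 H] := pselect (coeff (at_edge e t) F = 0).
    by case: ny; exists t => //; apply: H.
  have gE t : q < t <= len e -> g (at_edge e t) = c.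
    move=> /andP[qt tl]; apply/eqP; rewrite eq_le gc /=.
    have [||| + _] := @concave_right _ (fun t => - onedge g e t) q t qt.
    - move=> u hu; apply: right_linP; eexists; apply: has_slopeN; apply: rg; lra.
    - move=> u hu; apply: left_linP; eexists; apply: has_slopeN; apply: lg'; lra.
    - move=> u hu; rewrite kinkN ?oppr_ge0; first by apply: kg; [lra|apply: Fz; lra].
        by apply: rg; lra.
      by apply: lg'; lra.
    rewrite rslopeN ?rgq ?k0 ?minxx ?oppr0 ?mul0r ?addr0; last by apply: rg; lra.
    by rewrite /onedge gq; lra.
  have cf t : q < t <= len e -> c <= f (at_edge e t) by move=> /gE<-.
  have ql : q < len e by lra.
  (* Where g is constant and F has no chips, F1 has none either, so f is concave. Starting with
     slope 0 it ends at height at most c, so F retains the chip of F2 at the target. *)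
  have [||| + _] := @concave_right _ (onedge f e) q (len e) ql.
  - by move=> t ht; apply: rf; lra.
  - by move=> t ht; apply: lf'; lra.
  - move=> t ht; have hte : 0 < t < len e by lra.
    rewrite -ord_edge // ordf; have := F20 (at_edge e t).
    have := ordgc (at_edge e t) (cf t _); have := Fz t; rewrite FE.
    have -> : q < t <= len e by lra.
    by move=> /(_ isT) H1 /(_ isT); have := F10 (at_edge e t); lia.
  rewrite k0 mul0r addr0 {1}/onedge at_edge_tgt // => fc.
  exists (len e); first lra.
  rewrite at_edge_tgt // FE; have := ordgf _ fc; rewrite ordf; move: F2w; lia.
have [F' F'0 [pF' F'q]] := segment_chips st F0 hx hy Fx Fy.
exists F' => //; split=> //.
by have := principalD pF' pF; rewrite addrA subrK.
Qed.

End SegmentSupport.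

(** * Tropical Cramer's rule with perturbed entries *)

Section TropicalCramer.
Context {R : realType}.

(** A pair stands for its first entry plus an infinitesimal multiple of the second, so no size of
    the perturbation has to be chosen. *)
Definition lexle (x y : R * int) : bool :=
  (x.1 < y.1) || ((x.1 == y.1) && (x.2 <= y.2)).

Lemma lexle_refl x : lexle x x.
Proof. by rewrite /lexle eqxx lexx orbT. Qed.

Lemma lexle_trans : transitive lexle.
Proof.
move=> [y1 y2] [x1 x2] [z1 z2]; rewrite /lexle /=.
move=> /orP[xy|/andP[/eqP-> xy]] /orP[yz|/andP[/eqP<- yz]].
- by rewrite (lt_trans xy yz).
- by rewrite xy.
- by rewrite yz.
- by rewrite eqxx (le_trans xy yz) orbT.
Qed.

Lemma lexle_total x y : lexle x y || lexle y x.
Proof.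
case: x y => [x1 x2] [y1 y2]; rewrite /lexle /=.
by case: ltgtP => //= _; rewrite le_total.
Qed.

Lemma lexleD a1 a2 x1 x2 y1 y2 :
  lexle (a1 + x1, a2 + x2) (a1 + y1, a2 + y2) = lexle (x1, x2) (y1, y2).
Proof. by rewrite /lexle /= ltrD2l lerD2l (inj_eq (addrI _)). Qed.

Lemma lexle_min (T : finType) (P : pred T) (f : T -> R * int) x0 : P x0 ->
  exists2 x, P x & forall y, P y -> lexle (f x) (f y).
Proof.
move=> Px0.
have H (s : seq T) : x0 \in s -> exists2 x, P x & forall y, y \in s -> P y -> lexle (f x) (f y).
  elim: s x0 Px0 => // y s IH x0 Px0; rewrite inE.
  have [/hasP[z zs Pz] _|/hasPn nP] := boolP (has P s); last first.
    move=> /orP[/eqP<-|/nP]; last by rewrite Px0.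
    exists x0 => // z; rewrite inE => /orP[/eqP->|/nP/negPf->] // _; exact: lexle_refl.
  have [x Px Hx] := IH z Pz zs.
  have [Py|nPy] := boolP (P y); last first.
    exists x => // u; rewrite inE => /orP[/eqP-> Py|]; last exact: Hx.
    by rewrite Py in nPy.
  case/orP: (lexle_total (f x) (f y)) => le.
    by exists x => // u; rewrite inE => /orP[/eqP->|] //; apply: Hx.
  exists y => // u; rewrite inE => /orP[/eqP-> _|us Pu]; first exact: lexle_refl.
  exact: lexle_trans le (Hx u us Pu).
have [x Px Hx] := H (enum T) (mem_enum T x0).
by exists x => // y Py; apply: Hx => //; rewrite mem_enum.
Qed.

(* The minors of a tropical matrix of size r by r + 1 are coefficients for which
   the minimum is attained twice in each row: in a minimal bijection between
   the columns and the rows with the k-th row repeated, the two copies of this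
   row can be exchanged. *)
Lemma tropical_cramer r (a : 'I_r -> 'I_r.+1 -> R) (b : 'I_r -> 'I_r.+1 -> int) :
  exists (C : 'I_r.+1 -> R) (C' : 'I_r.+1 -> int), forall k, exists j1 j2,
    [/\ j1 != j2,
      forall j, lexle (a k j1 + C j1, b k j1 + C' j1) (a k j + C j, b k j + C' j)
    & forall j, lexle (a k j2 + C j2, b k j2 + C' j2) (a k j + C j, b k j + C' j)].
Proof.
(* A permutation s matches the row k with the column [s (lift ord0 k)] and leaves out the column
   [s ord0]. The least W with [s ord0 = j] is thus the minor without the column j. *)
pose W (s : 'S_r.+1) : R * int :=
  (\sum_k a k (s (fintype.lift ord0 k)), \sum_k b k (s (fintype.lift ord0 k))).
have /choice[M HM] : forall j, exists s : 'S_r.+1, s ord0 = j /\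
    forall s' : 'S_r.+1, s' ord0 = j -> lexle (W s) (W s').
  move=> j; have : [pred s : 'S_r.+1 | s ord0 == j] (tperm ord0 j) by rewrite /= tpermL.
  case/(lexle_min W) => s /eqP sj Hs; exists s; split=> // s' s'j; apply: Hs.
  by rewrite /= s'j.
exists (fun j => (W (M j)).1), (fun j => (W (M j)).2) => k.
have [j1 _ H1] := @lexle_min _ xpredT
  (fun j => (a k j + (W (M j)).1, b k j + (W (M j)).2)) ord0 isT.
have [Mj1 Hj1] := HM j1.
pose l := fintype.lift ord0 k; pose j2 := M j1 l.
exists j1, j2; split.
- by rewrite -{1}Mj1 /j2 (inj_eq perm_inj) /l neq_lift.
- by move=> j; apply: H1.
move=> j; apply: lexle_trans (H1 j isT).
pose s := (tperm ord0 l * M j1)%g.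
have s0 : s ord0 = j2 by rewrite permM tpermL.
have sl : s l = j1 by rewrite permM tpermR.
have so i : i != k -> s (fintype.lift ord0 i) = M j1 (fintype.lift ord0 i).
  by move=> ik; rewrite permM tpermD // ?neq_lift // /l (inj_eq lift_inj) eq_sym.
have [Mj2 Hj2] := HM j2.
apply: (@lexle_trans (a k j2 + (W s).1, b k j2 + (W s).2)).
  by rewrite lexleD; have := Hj2 s s0; rewrite /lexle.
have E (T : zmodType) (m : 'I_r -> 'I_r.+1 -> T) :
    m k j2 + \sum_i m i (s (fintype.lift ord0 i)) =
    m k j1 + \sum_i m i (M j1 (fintype.lift ord0 i)).
  rewrite (bigD1 k) //= [in RHS](bigD1 k) //= -/l sl -/j2 addrCA.
  by do 2 congr (_ + _); apply: eq_bigr => i ik; rewrite so.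
by rewrite /W /= !E; apply: lexle_refl.
Qed.

End TropicalCramer.

(** * Rank from interpolation at the vertices *)

Section Interpolation.
Context {R : realType} {G : metric_graph R}.
Implicit Types (phi psi : gpoint G -> R) (e : edge G) (p : gpoint G) (v : vert G).
Implicit Types (A B D E F : divisor G).

Lemma effective_decomp E (n : nat) : effective E -> deg E = n%:Z ->
  exists2 s : seq (gpoint G), size s = n & E = \sum_(p <- s) << p >>.
Proof.
move=> E0 dE; pose s := flatten [seq nseq `|coeff p E|%N p | p <- dom E].
have ES : E = \sum_(p <- s) << p >>.
  rewrite -[LHS]freeg_sumE big_flatten big_map /=; apply: eq_bigr => p _.
  rewrite big_nseq iter_addr_0; have := E0 p; case: (coeff p E) => // k _.
  by rewrite freegU_muln natz absz_nat.
exists s => //; have := dE; rewrite ES raddf_sum /=.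
under eq_bigr do rewrite degU.
by rewrite big_const_seq count_predT iter_addr_0 natz => -[].
Qed.

(** Points are traded for vertices one at a time: if D' is equivalent to effective divisors with a
    chip at either end of an edge, [segment_support] gives one with a chip at any point in
    between. *)
Lemma vertices_rank_determining D r : (forall e, src e != tgt e) ->
  (forall s : seq (vert G), size s = r -> eq_effective (D - \sum_(v <- s) << vtx v >>)) ->
  rank_ge D r.
Proof.
move=> st H E E0 /(effective_decomp E0)[s sr ->].
(* The list [vs] holds the vertices that replace points already removed from [ps]; both ends of an
   edge are tried for each such point. *)
suff : forall (ps : seq (gpoint G)) (vs : seq (vert G)), (size ps + size vs = r)%N ->
    eq_effective (D - \sum_(p <- ps) << p >> - \sum_(v <- vs) << vtx v >>).
  by move/(_ s [::]); rewrite big_nil subr0 addn0; apply.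
elim=> [|p ps IH] vs; first by rewrite big_nil subr0; apply: H.
rewrite addSnnS => sz; rewrite big_cons.
have E1 : D - (<< p >> + \sum_(j <- ps) << j >>) - \sum_(v <- vs) << vtx v >> =
    D - \sum_(j <- ps) << j >> - \sum_(v <- vs) << vtx v >> - << p >>.
  by apply/eqP/freeg_eqP => q; rewrite !(coeffB, coeffD); ring.
rewrite E1; set D' := D - \sum_(j <- ps) _ - _ in E1 *.
have IHv v : eq_effective (D' - << vtx v >>).
  have := IH (v :: vs) sz.
  rewrite big_cons (_ : _ - (_ + _) = D' - << vtx v >>) //.
  by apply/eqP/freeg_eqP => q; rewrite /D' !(coeffB, coeffD); ring.
have [[v ->]|[e [q [hq ->]]]] := gpointP p; first exact: IHv.
have plus v : exists F, [/\ effective F, 1 <= coeff (vtx v) F & lin_equiv D' F].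
  have [F F0 DF] := IHv v; exists (F + << vtx v >>); split.
  - by apply: effectiveD => //; apply: effectiveU.
  - by rewrite coeffD coeffU eqxx; have := F0 (vtx v); lia.
  - by have := lin_equivD << vtx v >> DF; rewrite subrK.
have [F1 [F10 F1v DF1]] := plus (src e).
have [F2 [F20 F2v DF2]] := plus (tgt e).
have pF : principal (F2 - F1).
  by apply/lin_equivP/(lin_equiv_trans (lin_equiv_sym DF2)).
have [F F0 [/lin_equivP FF1 Fq]] := segment_support (st e) hq F10 F20 pF F1v F2v.
exists (F - << at_edge e q >>).
  move=> p'; rewrite coeffB coeffU; have := F0 p'.
  by have [<-|_] := eqVneq (at_edge e q) p'; rewrite ?mulr0 ?mulr1; lia.
by apply/lin_equivD/(lin_equiv_trans DF1)/lin_equiv_sym.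
Qed.

Section InterpolationRank.
Variables (D : divisor G) (r : nat) (phi : 'I_r.+1 -> gpoint G -> R).
Variables (F : 'I_r.+1 -> divisor G) (d : vert G -> edge G * bool).
Hypothesis phi_lin : forall x, loc_lin (phi x).
Hypothesis phi_div : forall x, is_div (phi x) (F x - D).
Hypothesis F_eff : forall x, effective (F x).
Hypothesis hend_d : forall v, hend (d v) = v.
Hypothesis slope_inj : forall v, injective (fun x => hslope (phi x) (d v)).

(** A vertex prescribed m times gives m rows, separated by the factor k in the second coordinate.
    Each row gives two active functions of different slopes, and the slope intervals of the rows do
    not overlap. The order of the minimum at the vertex therefore gains at least m. *)
Lemma interpolation (c : 'I_r -> vert G) :
  eq_effective (D - \sum_k << vtx (c k) >>).
Proof.
pose sl v x := hslope (phi x) (d v).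
(* The second coordinate perturbs the chips at a vertex to different positions
   on the half-edge [d v]. *)
have [C [C' HC]] := tropical_cramer (fun k x => phi x (vtx (c k)))
  (fun k x => (k : nat)%:Z * sl (c k) x).
pose th p := \big[Num.min/phi ord0 p + C ord0]_x (phi x p + C x).
have lth : loc_lin th by apply: loc_lin_min => [|x]; apply: loc_linDc.
have th_le p x : th p <= phi x p + C x by apply: bigmin_le.
have th_eq p : exists x, th p = phi x p + C x.
  rewrite /th; elim/big_ind: _ => [|x y [i ->] [j ->]|x _]; [by exists ord0| |by exists x].
  by rewrite /Num.min; case: ifP => _; [exists i|exists j].
have ordx x p : ord_at (fun p => phi x p + C x) p = coeff p (F x) - coeff p D.
  by rewrite -coeffB; symmetry; apply: is_divDc.
have [A dA] := div_exists lth.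
exists (D + A - \sum_k << vtx (c k) >>); last first.
  apply/lin_equivP; rewrite opprB addrA subrK opprD addrA subrr add0r.
  by apply: principalN; exists th.
move=> p; rewrite !(coeffB, coeffD) dA raddf_sum /=.
have [[v ->]|[e [q [hq ->]]]] := gpointP p; last first.
  rewrite big1 => [|k _]; last by rewrite coeffU eq_sym at_edge_neq_vtx ?mulr0.
  have [x xE] := th_eq (at_edge e q); rewrite subr0.
  have : ord_at (fun p => phi x p + C x) (at_edge e q) <= ord_at th (at_edge e q).
    by apply: ord_le => //; exact: loc_linDc.
  by rewrite ordx; have := F_eff x (at_edge e q); lia.
pose cnt t : nat := (\sum_(k < r | (k < t)%N) (c k == v))%N.
have -> : \sum_(k < r) coeff (vtx v) << vtx (c k) >> = (cnt r)%:Z.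
  under eq_bigr do rewrite coeffU (inj_eq vtx_inj) mul1r.
  rewrite -natr_sum natz; congr Posz; apply: eq_bigl => k; by rewrite ltn_ord.
pose act x := th (vtx v) = phi x (vtx v) + C x.
pose cost (k : nat) x := k%:Z * sl v x + C' x.
have twice (k : 'I_r) : c k = v -> exists y z, [/\ act y, act z, sl v z < sl v y,
    forall x, act x -> cost k y <= cost k x & forall x, act x -> cost k z <= cost k x].
  move=> ck; have [j1 [j2 [j12]]] := HC k; rewrite ck => H1 H2.
  have [x0 x0E] := th_eq (vtx v).
  have A_ j : (forall i, lexle (phi j (vtx v) + C j, k%:Z * sl v j + C' j)
      (phi i (vtx v) + C i, k%:Z * sl v i + C' i)) ->
      act j /\ forall x, act x -> cost k j <= cost k x.
    move=> Hj; have aj : act j.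
      apply/eqP; rewrite eq_le th_le /= x0E.
      by have := Hj x0; rewrite /lexle /= => /orP[/ltW|/andP[/eqP-> _]].
    split=> // x; rewrite /act aj => xj; have := Hj x.
    by rewrite /lexle /= xj ltxx eqxx.
  have [a1 m1] := A_ j1 H1; have [a2 m2] := A_ j2 H2.
  have := lt_total (x := sl v j1) (y := sl v j2).
  rewrite (inj_eq (@slope_inj v)) j12 => /(_ isT)/orP[lt|lt].
    by exists j2, j1.
  by exists j1, j2.
(* Slopes of later minimizers are at most those of earlier ones. *)
have key t : (t <= r)%N -> exists y z, [/\ act y, act z, (cnt t)%:Z <= sl v y - sl v z
    & cnt t = 0%N \/ exists2 k : 'I_r, (k < t)%N & forall x, act x -> cost k z <= cost k x].
  elim: t => [_|t IH tr].
    have [x ax] := th_eq (vtx v); exists x, x.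
    have -> : cnt 0%N = 0%N by rewrite /cnt big_pred0.
    by rewrite subrr; split=> //; left.
  have [y [z [ay az yz H]]] := IH (ltnW tr).
  have cntS : cnt t.+1 = ((c (Ordinal tr) == v) + cnt t)%N.
    rewrite /cnt (bigD1 (Ordinal tr)) //=; congr (_ + _)%N; apply: eq_bigl => k.
    by rewrite ltnS -val_eqE /= ltn_neqAle andbC.
  have [cv|cv] := eqVneq (c (Ordinal tr)) v; last first.
    rewrite cntS (negPf cv) add0n; exists y, z; split=> //.
    by case: H => [->|[k kt Hk]]; [left|right; exists k => //; apply: ltnW].
  have [y' [z' [ay' az' yz' Hy' Hz']]] := twice _ cv.
  rewrite cntS cv eqxx; case: H => [c0|[k kt Hk]].
    exists y', z'; split=> //; first by rewrite c0; lia.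
    by right; exists (Ordinal tr).
  exists y, z'; split=> //; last by right; exists (Ordinal tr).
  (* Here y' minimises the cost of the later row and z that of the earlier row k. Adding the two
     inequalities leaves the difference of the row numbers times [sl v y' - sl v z], which is at
     most 0. *)
  suff : sl v y' <= sl v z by lia.
  have := Hk _ ay'; have := Hy' _ az; rewrite /cost /=; nia.
have [y [z [ay az yz _]]] := key r (leqnn r).
have vE := hend_d v; have ey : hslope (fun p => phi y p + C y) (d v) = sl v y by rewrite hslopeDc.
have ez : hslope (fun p => phi z p + C z) (d v) = sl v z by rewrite hslopeDc.
have ly x : loc_lin (fun p => phi x p + C x) by exact: loc_linDc.
(* Both functions are active at v: y gives the order to start from, and z bounds the slope of [th]
   along [d v]. *)
have H1 : ord_at (fun p => phi y p + C y) (vtx v) + (sl v y - hslope th (d v)) <= ord_at th (vtx v).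
  by have := ord_le_half (d := d v) lth (ly y) (th_le^~ y); rewrite ey vE; apply.
have H2 : hslope th (d v) <= sl v z.
  by rewrite -ez; apply: hslope_le => //; rewrite vE.
by rewrite ordx in H1; have := F_eff y (vtx v); lia.
Qed.

Lemma interpolation_rank : (forall e, src e != tgt e) -> rank_ge D r.
Proof.
move=> st; apply: vertices_rank_determining => // s sr.
have [v0 _|s0] := pickP (vert G); last first.
  have -> : s = [::] by case: s {sr} => // v; have := s0 v.
  rewrite big_nil subr0; exists (F ord0) => //.
  apply/lin_equiv_sym/lin_equivP; by exists (phi ord0).
have := interpolation (fun k : 'I_r => nth v0 s k).
by rewrite -(big_mkord xpredT (fun k => << vtx (nth v0 s k) >>)) -sr -(big_nth v0 xpredT (fun v => << vtx v >>)).
Qed.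

End InterpolationRank.
End Interpolation.

(** * Linear equivalence on a loop of loops *)

Section LoopGraph.
Context {R : realType} {n : nat} (L : loop_of_loops R n).
Local Notation G := (lol_graph L).
Implicit Types (A D E F : divisor G) (k j : 'I_n) (p : gpoint G) (w : R -> R).

Let Evw k : edge G := lol_vw k.
Let Ewv k : edge G := lol_wv k.
Let Eb k : edge G := lol_bridge k.
Let Vv k : vert G := lol_v k.
Let Vw k : vert G := lol_w k.

(* The loop gamma_k is parametrised by [0, loop_len L k), so that w_k is at 0
   and v_k at [wv_len L k]. *)
Definition loop_wt k w p : R :=
  match val p with
  | inl (inl i) => if i == k then w (wv_len L k) else 0
  | inl (inr i) => if i == k then w 0 else 0
  | inr (inl (inl i), t) => if i == k then w (wv_len L k + t) else 0
  | inr (inl (inr i), t) => if i == k then w t else 0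
  | inr (inr i, t) => 0
  end.

Definition loop_sum k w A : R := wsum (loop_wt k w) A.
Definition bridge_sum k w A : R := wsum (edge_wt (Eb k) w) A.

(* The Green function of the loop with pole w_k, evaluated at v_k. *)
Definition tent k (x : R) : R :=
  if x <= wv_len L k then x * vw_len L k / loop_len L k
  else wv_len L k * (loop_len L k - x) / loop_len L k.

Lemma loop_len_gt0 k : 0 < loop_len L k.
Proof. by rewrite addr_gt0 ?vw_len_gt0 ?wv_len_gt0. Qed.

Lemma tent0 k : tent k 0 = 0.
Proof. by rewrite /tent ltW ?wv_len_gt0 // !mul0r. Qed.

Lemma tent_v k : tent k (wv_len L k) = wv_len L k * vw_len L k / loop_len L k.
Proof. by rewrite /tent lexx. Qed.

Lemma loop_wtE k w p : loop_wt k w p =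
  w (wv_len L k) * (p == vtx (Vv k))%:R + w 0 * (p == vtx (Vw k))%:R +
  edge_wt (Ewv k) w p + edge_wt (Evw k) (fun t => w (wv_len L k + t)) p.
Proof.
have [[v ->]|[e [t [ht ->]]]] := gpointP p.
  rewrite !(inj_eq vtx_inj) /loop_wt /edge_wt /= !addr0.
  case: v => i.
    have -> : (inl i == Vv k) = (i == k) by [].
    have -> : (inl i == Vw k) = false by [].
    by rewrite mulr0 addr0; case: eqP => _; rewrite ?mulr1 ?mulr0.
  have -> : (inr i == Vv k) = false by [].
  have -> : (inr i == Vw k) = (i == k) by [].
  by rewrite mulr0 add0r; case: eqP => _; rewrite ?mulr1 ?mulr0.
rewrite !edge_wt_in // !at_edge_neq_vtx // !mulr0 !add0r /loop_wt val_at_edge //.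
case: e ht => [[i|i]|i] ht /=; rewrite ?add0r ?addr0 //.
Qed.

Lemma loop_sumE k w A : loop_sum k w A =
  w (wv_len L k) * (coeff (vtx (Vv k)) A)%:~R + w 0 * (coeff (vtx (Vw k)) A)%:~R +
  wsum (edge_wt (Ewv k) w) A + wsum (edge_wt (Evw k) (fun t => w (wv_len L k + t))) A.
Proof. by rewrite /loop_sum (eq_wsum _ (loop_wtE k w)) !wsumDw !wsumZw !wsum_coeff. Qed.

Lemma loop_sum1E k A : loop_sum k (fun=> 1) A =
  (coeff (vtx (Vv k)) A)%:~R + (coeff (vtx (Vw k)) A)%:~R +
  wsum (edge_wt (Ewv k) (fun=> 1)) A + wsum (edge_wt (Evw k) (fun=> 1)) A.
Proof. by rewrite loop_sumE; do 2 congr (_ + _); congr (_ + _); apply: mul1r. Qed.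

Lemma wsum_edge_affine (e : edge G) (a b : R) (w : R -> R) A :
  (forall t, 0 < t < len e -> w t = a + b * t) ->
  wsum (edge_wt e w) A = a * wsum (edge_wt e (fun=> 1)) A + b * wsum (edge_wt e id) A.
Proof.
move=> H; rewrite -!wsumZw -wsumDw; apply: eq_wsum => p.
have [[v ->]|[e' [t [ht ->]]]] := gpointP p; first by rewrite /edge_wt /=; ring.
by rewrite !edge_wt_in //; case: eqP => [ee|_]; [subst e'; rewrite H //|]; ring.
Qed.

Lemma loop_sum_idE k A : loop_sum k id A =
  wv_len L k * (coeff (vtx (Vv k)) A)%:~R + wsum (edge_wt (Ewv k) id) A +
  (wv_len L k * wsum (edge_wt (Evw k) (fun=> 1)) A + wsum (edge_wt (Evw k) id) A).
Proof.
rewrite loop_sumE mul0r addr0; congr (_ + _).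
rewrite (@wsum_edge_affine _ (wv_len L k) 1) ?mul1r // => t _; by rewrite mul1r.
Qed.

Lemma loop_sum_tentE k A : loop_len L k * loop_sum k (tent k) A =
  wv_len L k * vw_len L k * (coeff (vtx (Vv k)) A)%:~R
  + vw_len L k * wsum (edge_wt (Ewv k) id) A +
  (wv_len L k * vw_len L k * wsum (edge_wt (Evw k) (fun=> 1)) A
   - wv_len L k * wsum (edge_wt (Evw k) id) A).
Proof.
have L0 := loop_len_gt0 k; rewrite loop_sumE tent0 mul0r addr0 tent_v.
rewrite (@wsum_edge_affine (Ewv k) 0 (vw_len L k / loop_len L k)); last first.
  by move=> t /andP[t0 ty]; rewrite /tent ltW // add0r; ring.
rewrite (@wsum_edge_affine (Evw k) (wv_len L k * vw_len L k / loop_len L k)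
  (- wv_len L k / loop_len L k)); last first.
  move=> t /andP[t0 ty]; rewrite /tent leNgt ltrDl t0 /= /loop_len.
  by field; rewrite -/(loop_len L k) gt_eqF.
have Q (y l c m1 m2 D D1 Lk : R) : 0 < Lk ->
    Lk * (y * l / Lk * c + (0 * D1 + l / Lk * m1) + (y * l / Lk * D + - y / Lk * m2)) =
    y * l * c + l * m1 + (y * l * D - y * m2).
  by move=> H; field; rewrite gt_eqF.
exact: Q.
Qed.

Lemma sum_tgt_v k (f : edge G -> int) :
  \sum_(e : edge G | tgt e == Vv k) f e = f (Ewv k) + f (Eb k).
Proof.
rewrite /= !big_sumType /= [X in X + _ + _]big_pred0 // add0r.
by congr (_ + _); apply: big_pred1.
Qed.

Lemma sum_src_v k (f : edge G -> int) :
  \sum_(e : edge G | src e == Vv k) f e = f (Evw k).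
Proof.
rewrite /= !big_sumType /= [X in _ + X + _]big_pred0 // [X in _ + X]big_pred0 // !addr0.
exact: big_pred1.
Qed.

Lemma sum_tgt_w k (f : edge G -> int) :
  \sum_(e : edge G | tgt e == Vw k) f e = f (Evw k).
Proof.
rewrite /= !big_sumType /= [X in _ + X + _]big_pred0 // [X in _ + X]big_pred0 // !addr0.
exact: big_pred1.
Qed.

Lemma sum_src_w k (f : edge G -> int) :
  \sum_(e : edge G | src e == Vw k) f e = f (Ewv k) + f (Eb (ordS k)).
Proof.
rewrite /= !big_sumType /= [X in X + _ + _]big_pred0 // add0r.
congr (_ + _); first exact: big_pred1.
apply: big_pred1 => i /=.
by apply/eqP/eqP => [[<-]|->]; rewrite ?ord_predK // /lol_w ordSK.
Qed.

(* [s k] and [t k] are the slopes along the bridges, arriving at v_k and leaving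
   w_k.  The last condition says that the function closes up around the cycle of
   bridges. *)
Definition slope_data A (s t : 'I_n -> int) : Prop :=
  [/\ forall k, loop_sum k (fun=> 1) A = (s k - t k)%:~R,
      forall k, bridge_sum k (fun=> 1) A = (t (ord_pred k) - s k)%:~R,
      forall k, exists z : int,
        loop_sum k id A = (s k)%:~R * wv_len L k + z%:~R * loop_len L k
    & \sum_k ((s k)%:~R * bridge_len L k + bridge_sum k id A) +
      \sum_k ((s k)%:~R * tent k (wv_len L k) - loop_sum k (tent k) A) = 0].

Lemma principal_slope_data A : principal A -> exists s t, slope_data A s t.
Proof.
move=> [phi ll dA].
pose s k := slope1 phi (Eb k); pose t k := slope0 phi (Eb (ordS k)).
have HE e := div_edge e ll dA.
have cv k : coeff (vtx (Vv k)) A = slope1 phi (Ewv k) + s k - slope0 phi (Evw k).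
  by rewrite dA ord_vtx sum_tgt_v sum_src_v.
have cw k : coeff (vtx (Vw k)) A = slope1 phi (Evw k) - slope0 phi (Ewv k) - t k.
  by rewrite dA ord_vtx sum_tgt_w sum_src_w opprD addrA.
exists s, t; split=> [k|k|k|].
- rewrite loop_sum1E cv cw (proj1 (HE (Ewv k))) (proj1 (HE (Evw k))) -!intrD.
  by congr (_%:~R); ring.
- by rewrite /bridge_sum (proj1 (HE (Eb k))) /s /t ord_predK.
- exists (- slope1 phi (Evw k)).
  rewrite loop_sum_idE cv (proj1 (HE (Evw k))).
  have := proj2 (HE (Evw k)); have := proj2 (HE (Ewv k)).
  have Q (y l a b c s' m1 m2 u v : R) : v = u + b * y + m1 -> u = v + a * l + m2 ->
      y * (b + s' - c) + m1 + (y * (c - a) + m2) = s' * y + - a * (l + y) by lra.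
  by rewrite !(rmorphD, rmorphB, rmorphN) /=; apply: Q.
rewrite -big_split /=.
(* Pairing with the Green function gives the increase of phi from v_k to w_k, so the closing sum
   telescopes. *)
have E k : (s k)%:~R * bridge_len L k + bridge_sum k id A +
   ((s k)%:~R * tent k (wv_len L k) - loop_sum k (tent k) A) =
   phi (vtx (Vw k)) - phi (vtx (Vw (ord_pred k))).
  have L0 := loop_len_gt0 k.
  have HB : phi (vtx (Vv k)) = phi (vtx (Vw (ord_pred k)))
    + (s k)%:~R * bridge_len L k + bridge_sum k id A := proj2 (HE (Eb k)).
  have H1 : phi (vtx (Vv k)) = phi (vtx (Vw k)) + (slope1 phi (Ewv k))%:~R * wv_len L k
    + wsum (edge_wt (Ewv k) id) A := proj2 (HE (Ewv k)).
  have H2 : phi (vtx (Vw k)) = phi (vtx (Vv k)) + (slope1 phi (Evw k))%:~R * vw_len L k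
    + wsum (edge_wt (Evw k) id) A := proj2 (HE (Evw k)).
  suff : (s k)%:~R * tent k (wv_len L k) - loop_sum k (tent k) A =
     phi (vtx (Vw k)) - phi (vtx (Vv k)) by move=> ->; rewrite HB; ring.
  apply: (mulfI (lt0r_neq0 L0)); rewrite mulrBr loop_sum_tentE cv (proj1 (HE (Evw k))).
  have -> : wsum (edge_wt (Ewv k) id) A = phi (vtx (Vv k)) - phi (vtx (Vw k))
    - (slope1 phi (Ewv k))%:~R * wv_len L k by rewrite H1; ring.
  have -> : wsum (edge_wt (Evw k) id) A = phi (vtx (Vw k)) - phi (vtx (Vv k))
    - (slope1 phi (Evw k))%:~R * vw_len L k by rewrite H2; ring.
  rewrite mulrCA tent_v [X in _ * X](_ : _ = wv_len L k * vw_len L k); last first.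
    by field; rewrite gt_eqF.
  have Q (y l b a s' c u v : R) :
      s' * (y * l) - (y * l * (b + s' - c) + l * (v - u - b * y) +
        (y * l * (c - a) - y * (u - v - a * l))) = (l + y) * (u - v) by ring.
  by rewrite !(rmorphD, rmorphB, rmorphN) /=; apply: Q.
under eq_bigr do rewrite E.
rewrite sumrB; apply/eqP; rewrite subr_eq0; apply/eqP.
by rewrite [LHS](reindex_inj (@ord_pred_inj n)).
Qed.

Lemma wsum_edge_int (e : edge G) A :
  exists z : int, wsum (edge_wt e (fun=> 1)) A = z%:~R.
Proof.
exists (\sum_(p <- dom A) coeff p A * (if val p is inr (e', t) then e' == e else false)).
rewrite -wsum_int; apply: eq_wsum => p; rewrite /edge_wt.
by case: (val p) => [//|[e' t]]; case: (_ == _).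
Qed.

(** The integers in the moment congruences supply one slope in each loop, the degrees supply the
    others, and partial sums of the increases along bridges and loops supply the values at the
    vertices. *)
Lemma slope_data_principal A s t : slope_data A s t ->
  exists2 phi, loc_lin phi & is_div phi A /\
    forall k, slope1 phi (Eb k) = s k /\ slope0 phi (Eb k) = t (ord_pred k).
Proof.
move=> [Ha Hb Hc Hd].
have /choice[z Hz] := Hc.
have /choice[dg Hdg] : forall e : edge G, exists z : int,
  wsum (edge_wt e (fun=> 1)) A = z%:~R by move=> e; apply: wsum_edge_int.
pose a1 k := - z k; pose a0 k := a1 k + dg (Evw k).
pose b1 k := coeff (vtx (Vv k)) A + a0 k - s k; pose b0 k := b1 k + dg (Ewv k).
pose k1 (e : edge G) : int := match e with
  inl (inl k) => a1 k | inl (inr k) => b1 k | inr k => s k end.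
pose k0 (e : edge G) : int := match e with
  inl (inl k) => a0 k | inl (inr k) => b0 k | inr k => t (ord_pred k) end.
pose c k := (s k)%:~R * bridge_len L k + bridge_sum k id A.
pose d k := (s k)%:~R * tent k (wv_len L k) - loop_sum k (tent k) A.
have Hd' : \sum_k (c k + d k) = 0 by rewrite big_split.
(* The value is 0 just before the first bridge, at w of the last loop, where the partial sum is
   complete; agreement there is the closing condition. *)
pose P (v : vert G) : R := match v with
  | inl k => \sum_(i < n | (i < k)%N) (c i + d i) + c k
  | inr k => \sum_(i < n | (i <= k)%N) (c i + d i) end.
have Pw k : P (Vw k) = P (Vv k) + d k.
  rewrite /= (bigD1 k) //= [LHS]addrC -[RHS]addrA; congr (_ + _).
  by apply: eq_bigl => i; rewrite ltn_neqAle andbC.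
have Pb k : P (Vv k) = P (Vw (ord_pred k)) + c k.
  rewrite /=; congr (_ + _); case: (posnP k) => [k0'|kp].
    rewrite big_pred0 => [|i]; last by rewrite k0'.
    rewrite -[LHS]Hd'; apply: eq_bigl => i.
    have ni := ltn_ord i.
    by rewrite /= k0' add0n modn_small; [apply/esym|]; lia.
  apply: eq_bigl => i /=.
  have -> : ((k + n).-1 = k.-1 + n)%N by lia.
  by rewrite modnDr modn_small; [|have := ltn_ord k]; lia.
have L0 := loop_len_gt0.
have Ed k : d k = (a1 k)%:~R * vw_len L k + wsum (edge_wt (Evw k) id) A.
  have := Hz k; rewrite loop_sum_idE => E.
  apply: (mulfI (lt0r_neq0 (L0 k))); rewrite /d mulrBr loop_sum_tentE.
  rewrite mulrCA tent_v [X in _ * X](_ : _ = wv_len L k * vw_len L k); last first.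
    by field; rewrite gt_eqF.
  have a1E : (a1 k)%:~R = - (z k)%:~R :> R by rewrite /a1 rmorphN.
  have Q (y l cv m1 m2 D ss zz : R) :
      y * cv + m1 + (y * D + m2) = ss * y + zz * (l + y) ->
      ss * (y * l) - (y * l * cv + l * m1 + (y * l * D - y * m2)) =
      (l + y) * (- zz * l + m2).
    move=> H; have -> : (l + y) * (- zz * l + m2) =
       - l * (ss * y + zz * (l + y)) + ss * (y * l) + (l + y) * m2 by ring.
    by rewrite -H; ring.
  by rewrite a1E; apply: Q.
have HE (e : edge G) : wsum (edge_wt e (fun=> 1)) A = (k0 e - k1 e)%:~R.
  case: e => [[k|k]|k]; last exact: Hb.
    by rewrite Hdg; congr (_%:~R); rewrite /k0 /k1 /a0; ring.
  by rewrite Hdg; congr (_%:~R); rewrite /k0 /k1 /b0; ring.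
have HP (e : edge G) :
    P (tgt e) = P (src e) + (k1 e)%:~R * len e + wsum (edge_wt e id) A.
  case: e => [[k|k]|k].
  - by rewrite [LHS](Pw k) Ed addrA.
  - have Q (a b x y u : R) : b = a + x -> x + (y + u) = 0 -> a = b + y + u.
      by move=> ->; lra.
    apply: (Q _ _ (d k)); first exact: Pw.
    have Q' (zz ell y m1 m2 cv D ss : R) :
        y * cv + m1 + (y * D + m2) = ss * y + zz * (ell + y) ->
        - zz * ell + m2 + ((cv + (- zz + D) - ss) * y + m1) = 0 by lra.
    have k1E : (k1 (Ewv k))%:~R = (coeff (vtx (Vv k)) A)%:~R +
       (- (z k)%:~R + wsum (edge_wt (Evw k) (fun=> 1)) A) - (s k)%:~R :> R.
      by rewrite Hdg /k1 /b1 /a0 /a1 !(rmorphD, rmorphB, rmorphN).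
    have a1E : (a1 k)%:~R = - (z k)%:~R :> R by rewrite /a1 rmorphN.
    rewrite Ed k1E a1E; apply: Q'; rewrite -loop_sum_idE; exact: Hz.
  - by rewrite [LHS](Pb k) addrA.
have HV (v : vert G) : coeff (vtx v) A =
    \sum_(e | tgt e == v) k1 e - \sum_(e | src e == v) k0 e.
  case: v => k.
    by rewrite sum_tgt_v sum_src_v /k0 /k1 /= /b1; ring.
  rewrite sum_tgt_w sum_src_w /k0 /k1 /= ordSK /b0 /b1 /a0.
  have := Ha k; rewrite loop_sum1E !Hdg -!intrD => /intr_inj.
  rewrite -[inr k]/(Vw k) -/(Ewv k); move=> H.
  have Q (a cv cv' g g' ss tt : int) : cv + cv' + g + g' = ss - tt ->
      cv' = a - (cv + (a + g') - ss + g + tt) by lia.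
  exact: Q H.
have [phi ll [dphi sl]] := div_build_exists HE HP HV.
by exists phi => //; split=> // k; have [-> ->] := sl (Eb k).
Qed.

End LoopGraph.

(** * Points on the loops, bounds and symmetry of the Green function *)

Section LoopPoints.
Context {R : realType} {n : nat} (L : loop_of_loops R n).
Local Notation G := (lol_graph L).
Implicit Types (A D E F : divisor G) (k j : 'I_n) (p : gpoint G) (w : R -> R).

Definition loop_pos j (x : R) : R :=
  x * vw_len L j - (Num.floor (x * vw_len L j / loop_len L j))%:~R * loop_len L j.

Lemma loop_pos_itv j x : 0 <= loop_pos j x < loop_len L j.
Proof.
have L0 := loop_len_gt0 L j; rewrite /loop_pos; set d := x * _.
have := floor_itv (d / loop_len L j); rewrite intrD.
rewrite ler_pdivlMr // ltr_pdivrMr //; lra.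
Qed.

Lemma loop_pos_congr j x : exists z : int, loop_pos j x = x * vw_len L j + z%:~R * loop_len L j.
Proof. by eexists (- _); rewrite /loop_pos mulrNz mulNr. Qed.

Lemma lt1_int_eq0 (z : int) (u : R) : 0 < u -> - u < z%:~R * u < u -> z = 0.
Proof.
move=> u0 /andP[h1 h2].
have : z%:~R < 1 :> R by rewrite -(ltr_pM2r u0) mul1r.
have : -1 < z%:~R :> R by rewrite -(ltr_pM2r u0) mulN1r.
by rewrite -[-1]/((-1)%:~R) -[1]/(1%:~R) !ltr_int; lia.
Qed.

Lemma loop_pos_eq j x x' : loop_pos j x = loop_pos j x' <->
  exists z : int, (x - x') * vw_len L j = z%:~R * loop_len L j.
Proof.
have [z E] := loop_pos_congr j x; have [z' E'] := loop_pos_congr j x'.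
split=> [eq|[u eq]].
  exists (z' - z); rewrite rmorphB /= mulrBl mulrBl.
  by move: eq; rewrite E E'; lra.
have := loop_pos_itv j x; have := loop_pos_itv j x'.
have L0 := loop_len_gt0 L j.
have D : loop_pos j x - loop_pos j x' = (u + z - z')%:~R * loop_len L j.
  by rewrite E E' !(rmorphB, rmorphD) /=; move: eq; lra.
move=> h h'; suff : u + z - z' = 0.
  by move=> u0; move: D; rewrite u0 mul0r => /eqP; rewrite subr_eq0 => /eqP.
by apply: (@lt1_int_eq0 _ (loop_len L j)) => //; rewrite -D; lra.
Qed.

Lemma loop_wt_point k j w x :
  loop_wt k w (loop_point L j x) = if j == k then w (loop_pos j x) else 0.
Proof.
rewrite /loop_point -/(loop_pos j x); have /andP[x0 xL] := loop_pos_itv j x.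
case: leP => [xy|yx].
  have [->|xn0] := eqVneq (loop_pos j x) 0; first by rewrite at_edge_src.
  have [->|xny] := eqVneq (loop_pos j x) (wv_len L j).
    rewrite at_edge_tgt // /loop_wt /=; by case: eqP => // ->.
  by rewrite /loop_wt val_at_edge //= !lt_def xn0 x0 eq_sym xny xy.
rewrite /loop_wt val_at_edge /=; last first.
  by rewrite subr_gt0 yx /= ltrBlDr -/(loop_len L j).
by case: eqP => // <-; rewrite addrC subrK.
Qed.

Lemma bridge_wt_point k j w x :
  edge_wt (lol_bridge k : edge G) w (loop_point L j x) = 0.
Proof.
rewrite /loop_point -/(loop_pos j x); have /andP[x0 xL] := loop_pos_itv j x.
case: leP => [xy|yx].
  have [->|xn0] := eqVneq (loop_pos j x) 0; first by rewrite at_edge_src.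
  have [->|xny] := eqVneq (loop_pos j x) (wv_len L j); first by rewrite at_edge_tgt.
  by rewrite edge_wt_in //= !lt_def xn0 x0 eq_sym xny xy.
rewrite edge_wt_in //=.
by rewrite subr_gt0 yx /= ltrBlDr -/(loop_len L j).
Qed.

Lemma loop_point_pos j x x' :
  loop_point L j x = loop_point L j x' <-> loop_pos j x = loop_pos j x'.
Proof.
split=> eq; last by rewrite /loop_point -/(loop_pos j x) -/(loop_pos j x') eq.
by have := loop_wt_point j j id x; rewrite eq loop_wt_point eqxx.
Qed.

Lemma loop_point_eq j x x' : loop_point L j x = loop_point L j x' <->
  exists z : int, (x - x') * vw_len L j = z%:~R * loop_len L j.
Proof. by rewrite loop_point_pos; apply: loop_pos_eq. Qed.

Lemma loop_wt_v k j w : loop_wt k w (vtx (lol_v j : vert G)) =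
  if j == k then w (wv_len L k) else 0.
Proof. by []. Qed.

Lemma loop_wt_w k j w : loop_wt k w (vtx (lol_w j : vert G)) =
  if j == k then w 0 else 0.
Proof. by []. Qed.

Lemma tent_ge0 k x : 0 <= x <= loop_len L k -> 0 <= tent L k x.
Proof.
move=> /andP[x0 xL]; have L0 := loop_len_gt0 L k; have y0 := wv_len_gt0 L k.
have l0 := vw_len_gt0 L k.
rewrite /tent; case: (leP x (wv_len L k)) => _; rewrite divr_ge0 ?(ltW L0) // mulr_ge0 ?(ltW y0) ?(ltW l0) //.
by rewrite subr_ge0.
Qed.

Lemma tent_le k x : 0 <= x <= loop_len L k -> tent L k x <= tent L k (wv_len L k).
Proof.
move=> /andP[x0 xL]; have L0 := loop_len_gt0 L k; have y0 := wv_len_gt0 L k.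
have l0 := vw_len_gt0 L k.
rewrite tent_v /tent; case: (leP x (wv_len L k)) => xy; rewrite ler_pM2r ?invr_gt0 //.
  by rewrite ler_pM2r.
by rewrite ler_pM2l // /loop_len lerBlDr lerD2l ltW.
Qed.

(** The reflection maps each of the two edges of the loop to itself, and [tent] is affine on each: z
    = 0 is the case of the edge from w to v, z = 1 that of the edge from v to w. *)
Lemma tent_sym k x x' : 0 <= x < loop_len L k -> 0 <= x' < loop_len L k ->
  (exists z : int, x + x' = wv_len L k + z%:~R * loop_len L k) ->
  tent L k x + tent L k x' = tent L k (wv_len L k).
Proof.
have L0 := loop_len_gt0 L k; have y0 := wv_len_gt0 L k; have l0 := vw_len_gt0 L k.
have LE : loop_len L k = vw_len L k + wv_len L k by [].
move=> hx hx' [z E].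
have : z = 0 \/ z = 1.
  have h1 : -1 < z%:~R :> R by rewrite -(ltr_pM2r L0); lra.
  have h2 : z%:~R < 2%:~R :> R by rewrite -(ltr_pM2r L0); lra.
  by move: h1 h2; rewrite -[-1]/((-1)%:~R) !ltr_int; lia.
rewrite tent_v /tent; case=> z0; move: E; rewrite z0.
  rewrite mul0r addr0 => E; rewrite !ifT; try lra.
  by rewrite -!mulrDl E.
rewrite mul1r => E.
have tE u : wv_len L k <= u -> (if u <= wv_len L k then u * vw_len L k / loop_len L k
    else wv_len L k * (loop_len L k - u) / loop_len L k) =
    wv_len L k * (loop_len L k - u) / loop_len L k.
  move=> h1; case: (leP u (wv_len L k)) => // h2.
  have -> : u = wv_len L k by lra.
  by rewrite LE addrK.
have [h h'] : wv_len L k <= x /\ wv_len L k <= x' by lra.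
rewrite (tE x h) (tE x' h') -mulrDl -mulrDr; congr (_ * _ / _); lra.
Qed.

(* The points <x> and <-1-x> are exchanged by the reflection of the loop that
   swaps v and w. *)
Lemma tent_loop_pos k x x' :
  (exists z : int, (x + x' + 1) * vw_len L k = z%:~R * loop_len L k) ->
  tent L k (loop_pos k x) + tent L k (loop_pos k x') = tent L k (wv_len L k).
Proof.
move=> [z E]; apply: tent_sym; rewrite ?loop_pos_itv //.
have [u ->] := loop_pos_congr k x; have [u' ->] := loop_pos_congr k x'.
exists (z + u + u' - 1); rewrite !(rmorphB, rmorphD) /=.
by move: E; rewrite /loop_len; lra.
Qed.

Lemma loop_wt_ge0 k p : 0 <= loop_wt k (fun=> 1 : R) p.
Proof. by rewrite /loop_wt; case: (val p) => [[i|i]|[[[i|i]|i] t]] //; case: eqP. Qed.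

Lemma loop_wt_tent k p : 0 <= loop_wt k (tent L k) p /\
  loop_wt k (tent L k) p <= tent L k (wv_len L k) * loop_wt k (fun=> 1) p.
Proof.
have L0 := loop_len_gt0 L k; have y0 := wv_len_gt0 L k; have l0 := vw_len_gt0 L k.
have LE : loop_len L k = vw_len L k + wv_len L k by [].
have H x : 0 <= x <= loop_len L k -> forall b : bool,
  0 <= (if b then tent L k x else 0) /\
  (if b then tent L k x else 0) <= tent L k (wv_len L k) * (if b then 1 else 0).
  move=> hx [] /=; rewrite ?mulr1 ?mulr0 //; split; [exact: tent_ge0|exact: tent_le].
rewrite /loop_wt; case: p => -[[i|i]|[[[i|i]|i] t]] /= ht.
- by apply: H; lra.
- by apply: H; lra.
- have [ik|_] := eqVneq i k; last by rewrite mulr0.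
  rewrite ik in ht *; change (lol_len _ _) with (vw_len L k) in ht; apply: (H _ _ true); lra.
- have [ik|_] := eqVneq i k; last by rewrite mulr0.
  rewrite ik in ht *; change (lol_len _ _) with (wv_len L k) in ht; apply: (H _ _ true); lra.
- by rewrite mulr0.
Qed.

Lemma edge_wt_bounds (e : edge G) p :
  [/\ 0 <= edge_wt e (fun=> 1) p :> R, 0 <= edge_wt e id p
    & edge_wt e id p <= len e * edge_wt e (fun=> 1) p].
Proof.
have [[v ->]|[e' [t [ht ->]]]] := gpointP p; first by rewrite /edge_wt /= mulr0.
rewrite !edge_wt_in //; case: eqP => [ee|_]; last by rewrite mulr0.
by subst e'; rewrite mulr1 ler01; have /andP[t0 tl] := ht; split=> //; apply: ltW.
Qed.

Lemma loop_sum_int k A : exists z : int, loop_sum k (fun=> 1) A = z%:~R.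
Proof.
exists (\sum_(p <- dom A) coeff p A * (if loop_wt k (fun=> 1 : R) p == 1 then 1 else 0)).
rewrite /loop_sum -wsum_int; apply: eq_wsum => p.
rewrite /loop_wt; case: (val p) => [[i|i]|[[[i|i]|i] t]];
  rewrite ?(eq_sym 0 1) ?oner_eq0 //; by case: eqP; rewrite ?eqxx // eq_sym oner_eq0.
Qed.

(** Every vertex has valence 3, so it occurs once in the canonical divisor. *)
Lemma canonical_sum (w : gpoint G -> R) : wsum w (canonical_div G) =
  \sum_k (w (vtx (lol_v k : vert G)) + w (vtx (lol_w k : vert G))).
Proof.
have val3 (v : vert G) : (valence (vtx v))%:Z - 2 = 1.
  have -> : (valence (vtx v))%:Z =
      \sum_(e : edge G | src e == v) 1 + \sum_(e : edge G | tgt e == v) 1.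
    have C (P : pred (edge G)) : (count P (enum (edge G)))%:Z = \sum_(e | P e) 1.
      by rewrite -sum1_count big_enum_cond -natz natr_sum; apply: eq_bigl => e; rewrite inE.
    by rewrite /valence /rays /= size_cat !size_map !size_filter PoszD !C.
  by case: v => k; rewrite ?sum_tgt_v ?sum_tgt_w ?sum_src_v ?sum_src_w.
rewrite wsum_sum; under eq_bigr do rewrite val3 wsumU1.
by rewrite big_sumType big_split.
Qed.

End LoopPoints.

(** * The double cover and the coordinates of Prym divisors *)

Section Cover.
Context {R : realType} {n : nat} (Gamma : loop_of_loops R n).
Local Notation L := (dcover Gamma).
Local Notation G := (lol_graph L).
Local Notation H := (lol_graph Gamma).
Implicit Types (D : divisor G) (j : 'I_n) (k : 'I_(n + n)) (p : gpoint G) (w : R -> R).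

Lemma idx_proj_l j : idx_proj (lshift n j) = j.
Proof. by rewrite /idx_proj -[lshift n j]/(unsplit (inl j)) unsplitK. Qed.

Lemma idx_proj_r j : idx_proj (rshift n j) = j.
Proof. by rewrite /idx_proj -[rshift n j]/(unsplit (inr j)) unsplitK. Qed.

Lemma idx_antipode_l j : idx_antipode (lshift n j) = rshift n j.
Proof. by rewrite /idx_antipode -[lshift n j]/(unsplit (inl j)) unsplitK. Qed.

Lemma idx_antipode_r j : idx_antipode (rshift n j) = lshift n j.
Proof. by rewrite /idx_antipode -[rshift n j]/(unsplit (inr j)) unsplitK. Qed.

Lemma lr_ordP k : (exists j, k = lshift n j) \/ (exists j, k = rshift n j).
Proof. by case: (split_ordP k) => j ->; [left|right]; exists j. Qed.

Lemma eq_lr j j' : (lshift n j == rshift n j') = false.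
Proof. by apply/eqP => /(congr1 (@nat_of_ord _)) /=; have := ltn_ord j; lia. Qed.

Lemma ord_pred_l j : ord_pred (lshift n j) =
  if j == 0%N :> nat then rshift n (ord_pred j) else lshift n (ord_pred j).
Proof.
have nj := ltn_ord j; apply: val_inj => /=; case: eqP => j0 /=.
  by rewrite j0 !add0n !modn_small; lia.
have -> : ((j + (n + n)).-1 = j.-1 + (n + n))%N by lia.
have -> : ((j + n).-1 = j.-1 + n)%N by lia.
by rewrite !modnDr !modn_small; lia.
Qed.

Lemma ord_pred_r j : ord_pred (rshift n j) =
  if j == 0%N :> nat then lshift n (ord_pred j) else rshift n (ord_pred j).
Proof.
have nj := ltn_ord j; apply: val_inj => /=; case: eqP => j0 /=.
  rewrite j0 !add0n addn0.
  have -> : ((n + (n + n)).-1 = n.-1 + (n + n))%N by lia.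
  by rewrite !modnDr !modn_small; lia.
have -> : ((n + j + (n + n)).-1 = (n + j.-1) + (n + n))%N by lia.
have -> : ((j + n).-1 = j.-1 + n)%N by lia.
by rewrite !modnDr !modn_small; lia.
Qed.

(** The projection formula, through which degrees and moments of the norm become sums over the two
    preimages. *)
Lemma wsum_norm (w : gpoint H -> R) D :
  wsum w (norm_div D) = wsum (fun p => w (cover_proj p)) D.
Proof.
have nB D1 D2 : norm_div (D1 - D2) = norm_div D1 - norm_div D2.
  exact: lift_is_additive.
have n0 : norm_div (0 : divisor G) = 0 by rewrite -[0 in LHS]subr0 nB subrr.
have nD D1 D2 : norm_div (D1 + D2) = norm_div D1 + norm_div D2.
  by rewrite -[D2 in LHS]opprK nB -[- D2]sub0r nB n0 sub0r opprK.
rewrite -{1}[D]freeg_sumE (big_morph _ nD n0) wsum_sum; apply: eq_bigr => p _.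
rewrite /norm_div liftU (_ : _ *: _ = << coeff p D *g cover_proj p >>) ?wsumU //.
by apply/eqP/freeg_eqP => q; rewrite coeffZ !coeffU mul1r.
Qed.

Lemma cover_proj_edge (e : edge G) t : 0 < t < len e -> cover_proj (at_edge e t) =
  match e with
  | inl (inl i) => @at_edge R H (lol_vw (idx_proj i)) t
  | inl (inr i) => @at_edge R H (lol_wv (idx_proj i)) t
  | inr i => @at_edge R H (lol_bridge (idx_proj i)) t
  end.
Proof. by move=> ht; rewrite /cover_proj /lol_map val_at_edge //; case: e ht => [[i|i]|i]. Qed.

Lemma proj_case (T : nmodType) k j (c : T) :
  (if idx_proj k == j then c else 0) =
  (if k == lshift n j then c else 0) + (if k == rshift n j then c else 0).
Proof.
case: (lr_ordP k) => -[i ->].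
  by rewrite idx_proj_l eq_lr addr0 (inj_eq (@lshift_inj n n)).
by rewrite idx_proj_r (eq_sym _ (lshift n j)) eq_lr add0r (inj_eq (@rshift_inj n n)).
Qed.

Lemma loop_wt_proj j w p : loop_wt j w (cover_proj p) =
  loop_wt (lshift n j) w p + loop_wt (rshift n j) w p.
Proof.
have [[v ->]|[e [t [ht ->]]]] := gpointP p.
  by case: v => i; rewrite /loop_wt /cover_proj /lol_map /= proj_case ?idx_proj_l ?idx_proj_r.
rewrite cover_proj_edge //; case: e ht => [[i|i]|i] ht.
- by rewrite /loop_wt !val_at_edge //= proj_case idx_proj_l idx_proj_r.
- by rewrite /loop_wt !val_at_edge //= proj_case.
- by rewrite /loop_wt !val_at_edge //= addr0.
Qed.

Lemma bridge_wt_proj j w p : edge_wt (lol_bridge j : edge H) w (cover_proj p) =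
  edge_wt (lol_bridge (lshift n j) : edge G) w p + edge_wt (lol_bridge (rshift n j) : edge G) w p.
Proof.
have [[v ->]|[e [t [ht ->]]]] := gpointP p.
  by case: v => i; rewrite /edge_wt /cover_proj /lol_map /= addr0.
rewrite cover_proj_edge // !(edge_wt_in _ _ ht); case: e ht => [[i|i]|i] ht.
- by rewrite edge_wt_in //= addr0.
- by rewrite edge_wt_in //= addr0.
- by rewrite edge_wt_in //; have := proj_case i j (w t); rewrite /lol_bridge.
Qed.

Lemma loop_sum_norm j w D : loop_sum j w (norm_div D) =
  loop_sum (lshift n j) w D + loop_sum (rshift n j) w D.
Proof. by rewrite /loop_sum wsum_norm -wsumDw; apply: eq_wsum => p; apply: loop_wt_proj. Qed.

Lemma bridge_sum_norm j w D : bridge_sum j w (norm_div D) =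
  bridge_sum (lshift n j) w D + bridge_sum (rshift n j) w D.
Proof. by rewrite /bridge_sum wsum_norm -wsumDw; apply: eq_wsum => p; apply: bridge_wt_proj. Qed.

Lemma tent_l j : tent L (lshift n j) = tent Gamma j.
Proof. by rewrite /tent /loop_len /= idx_proj_l. Qed.

Lemma tent_r j : tent L (rshift n j) = tent Gamma j.
Proof. by rewrite /tent /loop_len /= idx_proj_r. Qed.

Lemma loop_len_l j : loop_len L (lshift n j) = loop_len Gamma j.
Proof. by rewrite /loop_len /= idx_proj_l. Qed.

Lemma loop_len_r j : loop_len L (rshift n j) = loop_len Gamma j.
Proof. by rewrite /loop_len /= idx_proj_r. Qed.

Lemma loop_sum_canonical j w :
  loop_sum j w (canonical_div H) = w (wv_len Gamma j) + w 0.
Proof.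
rewrite /loop_sum canonical_sum big_split /=.
under eq_bigr do rewrite loop_wt_v.
under [X in _ + X]eq_bigr do rewrite loop_wt_w.
by rewrite -!big_mkcond !big_pred1_eq.
Qed.

Lemma bridge_sum_canonical j w : bridge_sum j w (canonical_div H) = 0.
Proof. by rewrite /bridge_sum canonical_sum big1 // => k _; rewrite /edge_wt /= addr0. Qed.

Lemma prym_coordsP (xi : 'I_(n + n) -> R) : prym_coords Gamma xi <->
  forall j, exists z : int,
    (xi (lshift n j) + xi (rshift n j) + 1) * vw_len Gamma j = z%:~R * loop_len Gamma j.
Proof.
split=> [Hx j|Hx k].
  have := Hx (lshift n j); rewrite idx_antipode_l => /loop_point_eq[z].
  by rewrite /= loop_len_r idx_proj_r => E; exists z; rewrite -E; congr (_ * _); ring.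
apply/loop_point_eq; case: (lr_ordP k) => -[j ->].
  have [z E] := Hx j; exists z; rewrite idx_antipode_l loop_len_r /= idx_proj_r -E.
  by congr (_ * _); ring.
have [z E] := Hx j; exists z; rewrite idx_antipode_r loop_len_l /= idx_proj_l -E.
by congr (_ * _); ring.
Qed.

Section HatT.
Variable p0 : gpoint G.
Hypothesis hp0 : in_first_bridge p0.

Lemma first_bridge : exists (j0 : 'I_n) (t0 : R), [/\ j0 = 0%N :> nat,
  0 < t0 < bridge_len Gamma j0,
  p0 = @at_edge R G (lol_bridge (lshift n j0)) t0 &
  antipode p0 = @at_edge R G (lol_bridge (rshift n j0)) t0].
Proof.
have [k [t [k0 ht ->]]] := hp0.
have [[j kE]|[j kE]] := lr_ordP k; last first.
  by move: k0; rewrite kE /=; have := ltn_ord j; lia.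
exists j, t; move: ht; rewrite kE /= idx_proj_l => ht; split=> //.
  by move: k0; rewrite kE.
rewrite /antipode /lol_map val_at_edge /=; last by rewrite idx_proj_l.
by rewrite idx_antipode_l.
Qed.

(** The number of chips of [hatT_div] on the bridge k; the indices 0 and n are those of the bridges
    through [p0] and its antipode. *)
Definition hatT_bridge_deg (r : nat) k : int :=
  if odd r then (k == n :> nat)%:Z - (k == 0%N :> nat)%:Z else 0.

Lemma hatT_loop_sum (r : nat) xi k w :
  loop_sum k w (hatT_div p0 r xi) = w (loop_pos L k (xi k)).
Proof.
have [j0 [t0 [_ ht E1 E2]]] := first_bridge.
rewrite /loop_sum /hatT_div wsumD wsum_sum.
under eq_bigr do rewrite wsumU1 loop_wt_point.
rewrite -big_mkcond big_pred1_eq E2 E1; case: ifP => _; last by rewrite wsum0 addr0.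
rewrite wsumB !wsumU1 /loop_wt !val_at_edge /= ?idx_proj_l ?idx_proj_r //.
by rewrite subrr addr0.
Qed.

(** One offset t0 serves both bridges, so that their moments cancel in antipodal pairs. *)
Lemma hatT_bridge_sum (r : nat) xi : exists t0 : R, forall k w,
  bridge_sum k w (hatT_div p0 r xi) = w t0 * (hatT_bridge_deg r k)%:~R.
Proof.
have [j0 [t0 [j00 ht E1 E2]]] := first_bridge; exists t0 => k w.
rewrite /bridge_sum /hatT_div wsumD wsum_sum big1 ?add0r => [|k' _]; last first.
  by rewrite wsumU1 bridge_wt_point.
rewrite E2 E1 /hatT_bridge_deg; case: ifP => _; last by rewrite wsum0 mulr0.
rewrite wsumB !wsumU1 !edge_wt_in /= ?idx_proj_l ?idx_proj_r //.
have -> : (inr (rshift n j0) == inr k :> edge G) = (k == n :> nat).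
  have -> : (inr (rshift n j0) == inr k :> edge G) = (rshift n j0 == k) by [].
  by rewrite -val_eqE /= j00 addn0 eq_sym.
have -> : (inr (lshift n j0) == inr k :> edge G) = (k == 0%N :> nat).
  have -> : (inr (lshift n j0) == inr k :> edge G) = (lshift n j0 == k) by [].
  by rewrite -val_eqE /= j00 eq_sym.
by case: (_ == _); case: (_ == _); rewrite ?subrr ?mulr0 ?subr0 ?sub0r ?mulr1 ?mulrN1.
Qed.

Lemma hatT_bridge_deg_lr r j :
  hatT_bridge_deg r (lshift n j) + hatT_bridge_deg r (rshift n j) = 0.
Proof.
rewrite /hatT_bridge_deg; case: odd; last by [].
by have := ltn_ord j; move=> /=; case: eqP; case: eqP; case: eqP; case: eqP; lia.
Qed.

(** A function with all bridge slopes 0 suffices. On each loop of Gamma the reflection exchanges the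
    two chips of the norm, as it does v and w, so both pairs have congruent moments and the same sum
    of Green values; the chips over the first bridge cancel. *)
Lemma norm_hatT r xi : prym_coords Gamma xi ->
  lin_equiv (norm_div (hatT_div p0 r xi)) (canonical_div H).
Proof.
move=> /prym_coordsP Hx; have [t0 Hb] := hatT_bridge_sum r xi.
have bs j w : bridge_sum j w (norm_div (hatT_div p0 r xi) - canonical_div H) = 0.
  rewrite /bridge_sum wsumB -!/(bridge_sum _ _ _) bridge_sum_norm !Hb -mulrDr -rmorphD.
  by rewrite /= hatT_bridge_deg_lr mulr0 bridge_sum_canonical subrr.
have ls j w : loop_sum j w (norm_div (hatT_div p0 r xi) - canonical_div H) =
    w (loop_pos L (lshift n j) (xi (lshift n j))) + w (loop_pos L (rshift n j) (xi (rshift n j)))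
    - (w (wv_len Gamma j) + w 0).
  by rewrite /loop_sum wsumB -!/(loop_sum _ _ _) loop_sum_norm !hatT_loop_sum loop_sum_canonical.
apply/lin_equivP.
have [|phi ll [dphi _]] := @slope_data_principal _ _ Gamma
  (norm_div (hatT_div p0 r xi) - canonical_div H) (fun=> 0) (fun=> 0); last by exists phi.
split=> [j|j|j|].
- by rewrite ls subrr.
- by rewrite bs.
- rewrite ls /= addr0.
  have [z E] := Hx j; have [u ->] := loop_pos_congr L (lshift n j) (xi (lshift n j)).
  have [u' ->] := loop_pos_congr L (rshift n j) (xi (rshift n j)).
  exists (z + u + u' - 1); rewrite mul0r add0r.
  rewrite loop_len_l loop_len_r /= idx_proj_l idx_proj_r !(rmorphB, rmorphD) /=.
  by move: E; rewrite /loop_len; lra.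
- rewrite big1 ?add0r => [|j _]; last by rewrite mul0r bs addr0.
  apply: big1 => j _.
  rewrite mul0r ls tent0 addr0.
  have := @tent_loop_pos _ _ L (lshift n j) (xi (lshift n j)) (xi (rshift n j)).
  rewrite tent_l /= idx_proj_l loop_len_l => /(_ (Hx j)).
  rewrite (_ : loop_pos L (rshift n j) _ = loop_pos L (lshift n j) (xi (rshift n j))).
    by move=> ->; rewrite !subrr.
  by rewrite /loop_pos loop_len_l loop_len_r /= idx_proj_l idx_proj_r.
Qed.

End HatT.
End Cover.

(** * The normal form of a Prym class *)

Section NormalForm.
Context {R : realType} {n : nat} (Gamma : loop_of_loops R n).
Local Notation L := (dcover Gamma).
Local Notation G := (lol_graph L).
Local Notation H := (lol_graph Gamma).
Implicit Types (D : divisor G) (j : 'I_n) (k : 'I_(n + n)) (p : gpoint G) (w : R -> R).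

Lemma big_lr (T : nmodType) (F : 'I_(n + n) -> T) :
  \sum_k F k = \sum_j (F (lshift n j) + F (rshift n j)).
Proof. by rewrite big_split_ord big_split. Qed.

Definition glue_lr (T : Type) (f g : 'I_n -> T) k : T :=
  match split k with inl j => f j | inr j => g j end.

Lemma glue_l T (f g : 'I_n -> T) j : glue_lr f g (lshift n j) = f j.
Proof. by rewrite /glue_lr -[lshift n j]/(unsplit (inl j)) unsplitK. Qed.

Lemma glue_r T (f g : 'I_n -> T) j : glue_lr f g (rshift n j) = g j.
Proof. by rewrite /glue_lr -[rshift n j]/(unsplit (inr j)) unsplitK. Qed.

Variable p0 : gpoint G.
Hypothesis hp0 : in_first_bridge p0.

Lemma hatT_odd (r : nat) xi : hatT_div p0 (odd r) xi = hatT_div p0 r xi.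
Proof. by rewrite /hatT_div; case: (odd r). Qed.

(** The degrees fix the bridge slopes of the wanted function on the first half up to a constant c,
    and the slope data of the norm carry them over to the second half. The bridge where the second
    half begins then fixes 2c, and this is where the parity [eps] comes from. *)
Lemma prym_normal_form D : pic (norm_div D) = pic (canonical_div H) ->
  exists (eps : bool) (xi : 'I_(n + n) -> R),
    prym_coords Gamma xi /\ lin_equiv D (hatT_div p0 eps xi).
Proof.
move=> /pic_eqP/lin_equiv_sym/lin_equivP/principal_slope_data[sg [ta [Ha Hb Hc Hd]]].
have lsK j w : loop_sum j w (canonical_div H - norm_div D) =
    w (wv_len Gamma j) + w 0 - (loop_sum (lshift n j) w D + loop_sum (rshift n j) w D).
  by rewrite /loop_sum wsumB -!/(loop_sum _ _ _) loop_sum_norm loop_sum_canonical.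
have bsK j w : bridge_sum j w (canonical_div H - norm_div D) =
    - (bridge_sum (lshift n j) w D + bridge_sum (rshift n j) w D).
  by rewrite /bridge_sum wsumB -!/(bridge_sum _ _ _) bridge_sum_norm bridge_sum_canonical sub0r.
have /choice[d Hdeg] : forall k, exists z : int, loop_sum k (fun=> 1) D = z%:~R.
  by move=> k; apply: loop_sum_int.
have /choice[b Hbr] : forall k, exists z : int, bridge_sum k (fun=> 1) D = z%:~R.
  by move=> k; apply: wsum_edge_int.
have E1 j : sg j - ta j = 2 - d (lshift n j) - d (rshift n j).
  apply: (@intr_inj R); rewrite -Ha lsK !Hdeg !rmorphB /=; lra.
have E2 j : ta (ord_pred j) - sg j = - b (lshift n j) - b (rshift n j).
  apply: (@intr_inj R); rewrite -Hb bsK !Hbr !(rmorphB, rmorphN) /=; lra.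
have [j0 [_ [j00 _ _ _]]] := first_bridge hp0.
(* With one chip of the normal form on each loop, S j and T j are the slopes arriving at v_j and
   leaving w_j, normalised by S j0 = 0. *)
pose S j : int := \sum_(i < n | (i < j)%N) (d (lshift n i) - 1)
          + \sum_(i < n | (0 < i <= j)%N) b (lshift n i).
pose T j : int := S j - 1 + d (lshift n j).
have TS j : j != 0%N :> nat -> T (ord_pred j) = S j - b (lshift n j).
  move=> jn0; have nj := ltn_ord j.
  have pj : ((j + n).-1 %% n)%N = j.-1.
    have -> : ((j + n).-1 = j.-1 + n)%N by lia.
    by rewrite modnDr modn_small; lia.
  rewrite /T /S [X in _ = _ + X - _](bigD1 j) /=; last by lia.
  rewrite [X in _ = X + _ - _](bigD1 (ord_pred j)) /=; last by rewrite pj; lia.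
  rewrite (eq_bigl (fun i : 'I_n => (i < j)%N && (i != ord_pred j))); last first.
    by move=> i; rewrite -val_eqE /= pj; lia.
  rewrite [X in _ + X - 1](eq_bigl (fun i : 'I_n => (0 < i <= j)%N && (i != j))); last first.
    by move=> i; rewrite -val_eqE /= pj; lia.
  by ring.
have S0 : S j0 = 0.
  by rewrite /S !big_pred0 // => i; rewrite j00; lia.
pose cn : int := T (ord_pred j0); pose u : int := cn + b (rshift n j0) - sg j0.
(* The bridge into the second half requires c + c = eps - u, so [eps] has to absorb the parity of
   u. *)
pose eps := odd `|u|%N.
have [c cE] : exists c : int, c + c = eps%:Z - u.
  have := odd_double_half `|u|%N; rewrite -/eps -mul2n => hu.
  exists (if 0 <= u then - (`|u|./2)%:Z else (`|u|./2)%:Z + eps%:Z).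
  by case: ifP; move: hu; lia.
(* The slopes over j add up to [sg j], so that the equations on antipodal pairs become those for the
   norm on Gamma. *)
pose s : 'I_(n + n) -> int := glue_lr (fun j => c + S j) (fun j => sg j - (c + S j)).
pose t : 'I_(n + n) -> int := glue_lr (fun j => c + T j) (fun j => ta j - (c + T j)).
(* The moment congruence at the loop k, solved for the position of its only chip. *)
pose xi k := (loop_sum k id D + (s k)%:~R * wv_len L k) / vw_len L k.
have xiE k : xi k * vw_len L k = loop_sum k id D + (s k)%:~R * wv_len L k.
  by rewrite /xi divfK // gt_eqF // vw_len_gt0.
have Hx : prym_coords Gamma xi.
  apply/prym_coordsP => j; have [z] := Hc j; rewrite lsK /= addr0.
  have := xiE (lshift n j); have := xiE (rshift n j).
  rewrite /s glue_l glue_r /= idx_proj_l idx_proj_r rmorphB /= => X1 X2 Z.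
  exists (1 - z); rewrite rmorphB /= mulrBl; move: Z; rewrite /loop_len mulrDl mulrDl.
  by rewrite X1 X2; lra.
exists eps, xi; split=> //.
have [t0 Hbs] := hatT_bridge_sum hp0 eps xi.
pose e k := hatT_bridge_deg (n := n) eps k.
have ls k w : loop_sum k w (hatT_div p0 eps xi - D) = w (loop_pos L k (xi k)) - loop_sum k w D.
  by rewrite /loop_sum wsumB -!/(loop_sum _ _ _) (hatT_loop_sum hp0).
have bs k w : bridge_sum k w (hatT_div p0 eps xi - D) = w t0 * (e k)%:~R - bridge_sum k w D.
  by rewrite /bridge_sum wsumB -!/(bridge_sum _ _ _) Hbs.
have elr j : e (lshift n j) + e (rshift n j) = 0 by apply: hatT_bridge_deg_lr.
have e0 j : j != 0%N :> nat -> e (lshift n j) = 0 /\ e (rshift n j) = 0.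
  move=> jn0; rewrite /e /hatT_bridge_deg; case: odd => //=.
  by have := ltn_ord j; do 4 case: eqP => ? //=; lia.
have ej0 : e (rshift n j0) = eps%:Z.
  rewrite /e /hatT_bridge_deg /= j00 oddb addn0 eqxx.
  by have := ltn_ord j0; case: (eps) => //; case: eqP => //; lia.
have SD : slope_data (hatT_div p0 eps xi - D) s t.
  split=> [k|k|k|].
  - rewrite ls Hdeg; transitivity ((1 - d k)%:~R : R); first by rewrite rmorphB.
    congr (_%:~R).
    case: (lr_ordP k) => -[j ->]; rewrite /s /t ?glue_l ?glue_r /T; first by ring.
    by have := E1 j; move: (sg j) (ta j) (S j) => * ; lia.
  - rewrite bs Hbr mul1r -intrB; congr (_%:~R).
    case: (lr_ordP k) => -[j ->]; rewrite ?ord_pred_l ?ord_pred_r; case: (eqVneq (j : nat) 0%N).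
    + move=> jz; have -> : j = j0 by apply: val_inj; rewrite /= jz j00.
      have := elr j0; rewrite ej0 /s /t glue_l glue_r S0 -/cn => El.
      by have := E2 j0; move: cE El; rewrite /u; lia.
    + by move=> jn0; rewrite (proj1 (e0 j jn0)) /s /t !glue_l TS //; ring.
    + move=> jz; have -> : j = j0 by apply: val_inj; rewrite /= jz j00.
      rewrite ej0 /s /t glue_l glue_r S0 -/cn.
      by move: cE; rewrite /u; lia.
    + move=> jn0; rewrite (proj2 (e0 j jn0)) /s /t !glue_r TS //.
      by have := E2 j; move: (sg j) (ta _) (S j) (b _) (b _) => *; lia.
  - rewrite ls; have [z ->] := loop_pos_congr L k (xi k); rewrite xiE.
    by exists z; rewrite /=; ring.
  - rewrite !big_lr; have := Hd; rewrite -!big_split /=; apply: etrans.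
    apply: eq_bigr => j _; rewrite !bs !ls bsK lsK tent0 addr0.
    have := @tent_loop_pos _ _ L (lshift n j) (xi (lshift n j)) (xi (rshift n j)).
    move/prym_coordsP: Hx => /(_ j).
    rewrite (_ : loop_pos L (rshift n j) _ = loop_pos L (lshift n j) (xi (rshift n j))); last first.
      by rewrite /loop_pos loop_len_l loop_len_r /= idx_proj_l idx_proj_r.
    rewrite !tent_l !tent_r loop_len_l /= idx_proj_l idx_proj_r => X /(_ X).
    have := congr1 (fun z : int => z%:~R : R) (elr j); rewrite rmorphD /= => El.
    have -> : (e (rshift n j))%:~R = - (e (lshift n j))%:~R :> R by lra.
    rewrite /s !glue_l !glue_r rmorphB /=.
    have Q (len g sl sr x x' ee bl br gl gr : R) : x + x' = g ->
        sl * len + (t0 * ee - bl) + ((sr - sl) * len + (t0 * - ee - br)) +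
        (sl * g - (x - gl) + ((sr - sl) * g - (x' - gr))) =
        sr * len + - (bl + br) + (sr * g - (g - (gl + gr))) by move=> <-; ring.
    exact: Q.
have [phi ll [dphi _]] := slope_data_principal SD.
by apply/lin_equiv_sym/lin_equivP; exists phi.
Qed.

End NormalForm.

(** * Strands and barriers *)

Section Strands.
Context {R : realType} {n : nat} (Gamma : loop_of_loops R n).
Local Notation L := (dcover Gamma).
Local Notation G := (lol_graph L).
Variable p0 : gpoint G.
Hypothesis hp0 : in_first_bridge p0.
Variables (r : nat) (xi : 'I_(n + n) -> R).
Hypothesis hx : prym_coords Gamma xi.
Implicit Types (D : divisor G) (j : 'I_n) (k : 'I_(n + n)) (w : R -> R) (s t : int).

Lemma slope_l j i : slope r (lshift n j) i = i%:Z - (uphalf r)%:Z.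
Proof.
rewrite /slope /= ltn_ord uphalf_half; case: ifP => ro; rewrite ?ro ?add0n //.
Qed.

Lemma loop_sum_point k k' w x :
  loop_sum k w << loop_point L k' x >> = if k' == k then w (loop_pos L k' x) else 0.
Proof. by rewrite /loop_sum wsumU1 loop_wt_point. Qed.

(* The slope along the bridges can change from s to t at the loop k, leaving
   the effective divisor [loop_residue k s t] on this loop. *)
Definition loop_step k s t : Prop :=
  [\/ t = s,
      t = s + 1 /\ loop_point L k (xi k) = loop_point L k s%:~R
    | s = t + 1 /\ loop_point L k (xi k) = loop_point L k t%:~R].

Definition loop_residue k s t : divisor G :=
  if t == s then << loop_point L k (xi k - s%:~R) >>
  else if t == s + 1 then 0
  else << loop_point L k (xi k) >> + << loop_point L k (-1 - xi k) >>.

Lemma loop_residue_up k s : loop_residue k s (s + 1) = 0.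
Proof.
have e1 : (s + 1 == s) = false by lia.
by rewrite /loop_residue e1 eqxx.
Qed.

Lemma loop_residue_down k t :
  loop_residue k (t + 1) t = << loop_point L k (xi k) >> + << loop_point L k (-1 - xi k) >>.
Proof.
have e1 : (t == t + 1) = false by lia.
have e2 : (t == t + 1 + 1) = false by lia.
by rewrite /loop_residue e1 e2.
Qed.

Lemma loop_residue_linger k s : loop_residue k s s = << loop_point L k (xi k - s%:~R) >>.
Proof. by rewrite /loop_residue eqxx. Qed.

Lemma loop_residue_eff k s t : effective (loop_residue k s t).
Proof.
rewrite /loop_residue; case: ifP => _; first exact: effectiveU.
case: ifP => _; last by apply: effectiveD; apply: effectiveU.
by move=> q; rewrite coeff0.
Qed.

Lemma loop_residue_out k k' s t w : k' != k -> loop_sum k w (loop_residue k' s t) = 0.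
Proof.
move=> /negPf kk; rewrite /loop_residue; case: ifP => _; first by rewrite loop_sum_point kk.
case: ifP => _; first by rewrite /loop_sum wsum0.
by rewrite /loop_sum wsumD -!/(loop_sum _ _ _) !loop_sum_point kk addr0.
Qed.

Lemma loop_residue_bridge k k' s t w : bridge_sum k w (loop_residue k' s t) = 0.
Proof.
rewrite /bridge_sum /loop_residue; case: ifP => _; first by rewrite wsumU1 bridge_wt_point.
case: ifP => _; first by rewrite wsum0.
by rewrite wsumD !wsumU1 !bridge_wt_point addr0.
Qed.

Lemma loop_residue_deg k s t : loop_step k s t ->
  loop_sum k (fun=> 1) (loop_residue k s t) = (s - t + 1)%:~R.
Proof.
case=> [->|[-> _]|[-> _]].
- by rewrite loop_residue_linger loop_sum_point eqxx subrr add0r.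
- by rewrite loop_residue_up /loop_sum wsum0 opprD addrA subrr sub0r addNr.
- rewrite loop_residue_down /loop_sum wsumD -!/(loop_sum _ _ _) !loop_sum_point eqxx.
  have -> : t + 1 - t + 1 = 2 by lia.
  by [].
Qed.

Lemma loop_residue_mom k s t : loop_step k s t -> exists z : int,
  loop_sum k id (loop_residue k s t) - loop_pos L k (xi k) =
  s%:~R * wv_len L k + z%:~R * loop_len L k.
Proof.
have LE : loop_len L k = vw_len L k + wv_len L k by [].
have [u uE] := loop_pos_congr L k (xi k).
case=> [->|[-> /loop_point_eq[z zE]]|[-> /loop_point_eq[z zE]]].
- rewrite loop_residue_linger loop_sum_point eqxx.
  have [u' ->] := loop_pos_congr L k (xi k - s%:~R); rewrite uE.
  exists (u' - u - s); rewrite !rmorphB /= LE; lra.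
- rewrite loop_residue_up /loop_sum wsum0 uE; exists (- z - u - s).
  rewrite !(rmorphB, rmorphN) /=; move: zE; rewrite LE; lra.
- rewrite loop_residue_down /loop_sum wsumD -!/(loop_sum _ _ _) !loop_sum_point eqxx.
  rewrite addrAC subrr add0r.
  have [u' ->] := loop_pos_congr L k (-1 - xi k).
  exists (u' - z - t - 1); rewrite !(rmorphB, rmorphD) /=; move: zE; rewrite LE; lra.
Qed.

Lemma xi_pair j : exists z : int,
  (xi (lshift n j) + xi (rshift n j) + 1) * vw_len Gamma j = z%:~R * loop_len Gamma j.
Proof. by move/prym_coordsP: hx. Qed.

Lemma loop_pos_lr j x : loop_pos L (rshift n j) x = loop_pos L (lshift n j) x.
Proof. by rewrite /loop_pos loop_len_l loop_len_r /= idx_proj_l idx_proj_r. Qed.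

(** Antisymmetry turns the coordinate i into -1 - i, so a step up at s becomes a step down to -1 - s
    on the antipodal loop. *)
Lemma loop_step_r j s t : loop_step (lshift n j) s t -> loop_step (rshift n j) (- s) (- t).
Proof.
have [z zE] := xi_pair j.
have refl i : loop_point L (lshift n j) (xi (lshift n j)) = loop_point L (lshift n j) i ->
    loop_point L (rshift n j) (xi (rshift n j)) = loop_point L (rshift n j) (-1 - i).
  move=> /loop_point_eq[u]; rewrite loop_len_l /= idx_proj_l => uE.
  apply/loop_point_eq; exists (z - u); rewrite loop_len_r /= idx_proj_r rmorphB /=; lra.
case=> [->|[-> /refl E]|[-> /refl E]]; first by constructor 1.
- constructor 3; split; first by lia.
  by rewrite E; congr (loop_point _ _ _); rewrite !(rmorphD, rmorphN) /=; lra.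
- constructor 2; split; first by lia.
  by rewrite E; congr (loop_point _ _ _); rewrite !(rmorphD, rmorphN) /=; lra.
Qed.

Lemma tent_pair j x x' : (exists z : int,
    (x + x' + 1) * vw_len Gamma j = z%:~R * loop_len Gamma j) ->
  tent Gamma j (loop_pos L (lshift n j) x) + tent Gamma j (loop_pos L (rshift n j) x') =
  tent Gamma j (wv_len Gamma j).
Proof.
move=> Hz; have := @tent_loop_pos _ _ L (lshift n j) x x'.
by rewrite loop_pos_lr tent_l loop_len_l /= idx_proj_l; apply.
Qed.

(** Lingering leaves one chip on each of the two loops, a step leaves two chips on one of them; in
    each case the reflection matches the two chips, so their Green values have a constant sum. *)
Lemma loop_residue_tent j s t : loop_step (lshift n j) s t ->
  loop_sum (lshift n j) (tent Gamma j) (loop_residue (lshift n j) s t) +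
  loop_sum (rshift n j) (tent Gamma j) (loop_residue (rshift n j) (- s) (- t)) =
  tent Gamma j (wv_len Gamma j).
Proof.
have [z zE] := xi_pair j.
case=> [->|[-> _]|[-> _]].
- rewrite !loop_residue_linger !loop_sum_point !eqxx; apply: tent_pair; exists z; rewrite -zE.
  by congr (_ * _); rewrite rmorphN /=; lra.
- rewrite loop_residue_up [X in X + _]/loop_sum wsum0 add0r.
  have {1}-> : - s = - (s + 1) + 1 by lia.
  rewrite loop_residue_down /loop_sum wsumD -!/(loop_sum _ _ _) !loop_sum_point eqxx loop_pos_lr.
  by apply: tent_pair; exists 0; rewrite mul0r; lra.
- have -> : - t = - (t + 1) + 1 by lia.
  rewrite loop_residue_down loop_residue_up [X in _ + X]/loop_sum wsum0 addr0.
  rewrite /loop_sum wsumD -!/(loop_sum _ _ _).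
  rewrite !loop_sum_point eqxx -(loop_pos_lr _ (-1 - _)).
  by apply: tent_pair; exists 0; rewrite mul0r; lra.
Qed.

(** [p m x] is the position of the strand x on arriving at the loop m of the first half. *)
Variable p : nat -> 'I_r.+1 -> nat.
Hypothesis p_start : forall x, p 0 x = x.
Hypothesis p_end : forall x : 'I_r.+1, p n x = (r - x)%N.
Hypothesis p_inj : forall m : nat, (m <= n)%N -> injective (p m).
Hypothesis p_step : forall j x, loop_step (lshift n j)
  (slope r (lshift n j) (p j x)) (slope r (lshift n j) (p j.+1 x)).

Let sl (m : nat) : int := m%:Z - (uphalf r)%:Z.
Let s x : 'I_(n + n) -> int := glue_lr (fun j => sl (p j x)) (fun j => - sl (p j x)).
Let t x : 'I_(n + n) -> int := glue_lr (fun j => sl (p j.+1 x)) (fun j => - sl (p j.+1 x)).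
Let F x : divisor G := \sum_k loop_residue k (s x k) (t x k).

Lemma strand_step x k : loop_step k (s x k) (t x k).
Proof.
case: (lr_ordP k) => -[j ->]; rewrite /s /t ?glue_l ?glue_r.
  by have := p_step j x; rewrite !slope_l.
by apply: loop_step_r; have := p_step j x; rewrite !slope_l.
Qed.

(** Degrees and moments are checked on each loop, and the closing sum vanishes on each antipodal
    pair. The reversal of the order enters at the two bridges between the halves. *)
Lemma strand_slope_data x : slope_data (F x - hatT_div p0 r xi) (s x) (t x).
Proof.
have [t0 Hb] := hatT_bridge_sum hp0 r xi.
have ls k w : loop_sum k w (F x - hatT_div p0 r xi) =
    loop_sum k w (loop_residue k (s x k) (t x k)) - w (loop_pos L k (xi k)).
  rewrite /loop_sum wsumB -!/(loop_sum _ _ _) (hatT_loop_sum hp0); congr (_ - _).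
  rewrite {1}/loop_sum /F wsum_sum (bigD1 k) //= big1 ?addr0 // => k' kk.
  exact: loop_residue_out.
have bs k w : bridge_sum k w (F x - hatT_div p0 r xi) = - (w t0 * (hatT_bridge_deg r k)%:~R).
  rewrite /bridge_sum wsumB -!/(bridge_sum _ _ _) Hb /bridge_sum wsum_sum big1 ?sub0r //.
  by move=> k' _; apply: loop_residue_bridge.
split=> [k|k|k|].
- rewrite ls loop_residue_deg; last exact: strand_step.
  by rewrite rmorphD /= addrK.
- rewrite bs mul1r -rmorphN /=; congr (_%:~R); rewrite /hatT_bridge_deg.
  (* Entering the second half, the slope goes from r - x - uphalf r to uphalf r - x. The difference
     is 1 for odd r and 0 for even r, as required by the chip at the antipode of [p0]. *)
  have uo : (uphalf r + uphalf r = r + odd r)%N.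
    by rewrite uphalf_half; have := odd_double_half r; lia.
  have jj (j : 'I_n) : (ord_pred j).+1 = (if j == 0%N :> nat then n else j).
    have nj := ltn_ord j; rewrite /=; case: eqP => [->|jn0].
      by rewrite add0n modn_small; lia.
    have -> : ((j + n).-1 = j.-1 + n)%N by lia.
    by rewrite modnDr modn_small; lia.
  have xr := ltn_ord x.
  case: (lr_ordP k) => -[j ->]; have nj := ltn_ord j; rewrite ?ord_pred_l ?ord_pred_r.
  + case: (eqVneq (j : nat) 0%N) => [j0|jn0]; rewrite /s /t ?glue_l ?glue_r jj.
      have jn : (lshift n j == n :> nat) = false by rewrite /=; lia.
      have jz : (lshift n j == 0%N :> nat) = true by rewrite /= j0 eqxx.
      by rewrite jn jz ?j0 ?eqxx p_end p_start /sl; move: uo; case: odd => uo; lia.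
    have jn : (lshift n j == n :> nat) = false by rewrite /=; lia.
    have jz : (lshift n j == 0%N :> nat) = false by rewrite /=; lia.
    by rewrite jn jz ?(negPf jn0) !subrr; case: odd.
  + case: (eqVneq (j : nat) 0%N) => [j0|jn0]; rewrite /s /t ?glue_l ?glue_r jj.
      have jn : (rshift n j == n :> nat) = true by rewrite /= j0 addn0 eqxx.
      have jz : (rshift n j == 0%N :> nat) = false by rewrite /=; lia.
      by rewrite jn jz ?j0 ?eqxx p_end p_start /sl; move: uo; case: odd => uo; lia.
    have jn : (rshift n j == n :> nat) = false by rewrite /=; lia.
    have jz : (rshift n j == 0%N :> nat) = false by rewrite /=; lia.
    by rewrite jn jz ?(negPf jn0) subrr opprK addNr; case: odd.
- by rewrite ls; apply/loop_residue_mom/strand_step.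
- rewrite !big_lr !big1 ?addr0 // => j _.
    rewrite !ls !tent_l !tent_r /s /t !glue_l !glue_r.
    have := @loop_residue_tent j (sl (p j x)) (sl (p j.+1 x)).
    have st : loop_step (lshift n j) (sl (p j x)) (sl (p j.+1 x)).
      by have := p_step j x; rewrite !slope_l.
    move=> /(_ st); have := tent_pair (xi_pair j).
    rewrite /= idx_proj_l idx_proj_r rmorphN /=.
    have Q (ss g a b c d : R) : a + b = g -> c + d = g ->
      ss * g - (c - a) + (- ss * g - (d - b)) = 0 by move=> E1 E2; lra.
    exact: Q.
  rewrite !bs /s !glue_l !glue_r /= idx_proj_l idx_proj_r rmorphN /=.
  have := congr1 (fun z : int => z%:~R : R) (hatT_bridge_deg_lr r j); rewrite rmorphD /=.
  move=> E; have -> : (hatT_bridge_deg r (rshift n j))%:~R = - (hatT_bridge_deg r (lshift n j))%:~R :> R.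
    by lra.
  by ring.
Qed.

Lemma strands_rank_ge : rank_ge (hatT_div p0 r xi) r.
Proof.
have /choice[phi Hphi] : forall x, exists phi : gpoint G -> R, [/\ loc_lin phi,
    is_div phi (F x - hatT_div p0 r xi) &
    forall k, slope1 phi (lol_bridge k : edge G) = s x k /\
              slope0 phi (lol_bridge k : edge G) = t x (ord_pred k)].
  move=> x; have [phi ll [dphi sl']] := slope_data_principal (strand_slope_data x).
  by exists phi.
(* Strands are compared along the bridge at each vertex, where distinct positions mean distinct
   slopes. *)
pose d (v : vert G) : edge G * bool := match v with
  | inl k => (lol_bridge k, true)
  | inr k => (lol_bridge (ordS k), false) end.
apply: (@interpolation_rank _ _ _ _ phi F d).
- by move=> x; case: (Hphi x).
- by move=> x; case: (Hphi x).
- by move=> x; apply: effective_sum => k _; apply: loop_residue_eff.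
- by case=> k; rewrite /hend /= ?ordSK.
- case=> k x x'; rewrite /hslope /=; case: (Hphi x) (Hphi x') => _ _ Hs [_ _ Hs'].
    rewrite (proj1 (Hs k)) (proj1 (Hs' k)) => /oppr_inj; rewrite /s.
    case: (lr_ordP k) => -[j ->]; rewrite ?glue_l ?glue_r /sl => E.
      by apply: (@p_inj j (ltnW (ltn_ord j))); move: E; lia.
    by apply: (@p_inj j (ltnW (ltn_ord j))); move: E; lia.
  rewrite (proj2 (Hs _)) (proj2 (Hs' _)) ordSK /t.
  case: (lr_ordP k) => -[j ->]; rewrite ?glue_l ?glue_r /sl => E.
    by apply: (@p_inj j.+1 (ltn_ord j)); move: E; lia.
  by apply: (@p_inj j.+1 (ltn_ord j)); move: E; lia.
- by case=> [[k|k]|k].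
Qed.

End Strands.

(** * Upper bounds for the rank from barriers *)

Section Barrier.
Context {R : realType} {n : nat} (Gamma : loop_of_loops R n).
Local Notation L := (dcover Gamma).
Local Notation G := (lol_graph L).
Variable p0 : gpoint G.
Hypothesis hp0 : in_first_bridge p0.
Variables (r : nat) (xi : 'I_(n + n) -> R).
Hypothesis hx : prym_coords Gamma xi.
Implicit Types (D : divisor G) (j : 'I_n) (k : 'I_(n + n)) (w : R -> R).

Lemma cyclic_ind (m : nat) (P : 'I_m -> Prop) (k0 : 'I_m) :
  (forall i, P (ord_pred i) -> P i) -> P k0 -> forall i, P i.
Proof.
move=> HP Pk0 l.
have H i : P (iter i (@ordS m) k0).
  by elim: i => //= i IH; apply: HP; rewrite ordSK.
have val_iter i : nat_of_ord (iter i (@ordS m) k0) = ((k0 + i) %% m)%N.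
  elim: i => [|i IH]; first by rewrite addn0 modn_small.
  by rewrite /= IH addnS -addn1 modnDml addn1.
suff <- : iter (l + m - k0) (@ordS m) k0 = l by [].
apply: val_inj; rewrite /= val_iter.
have -> : (k0 + (l + m - k0) = l + m)%N by have := ltn_ord k0; lia.
by rewrite modnDr modn_small.
Qed.

Lemma sum_neq0_lt0 (f : 'I_n -> R) : (0 < n)%N -> (forall j, f j < 0) -> \sum_j f j <> 0.
Proof.
move=> n0 f0; suff : \sum_j f j < 0 by move=> /[swap] ->; rewrite ltxx.
rewrite (bigD1 (Ordinal n0)) //= -[ltRHS]addr0 ltr_leD //.
by apply: sumr_le0 => i _; apply: ltW.
Qed.

Variable g : nat -> nat.
Hypothesis g_end : (g 0 + g n = r.+1)%N.
Hypothesis g_avoid : forall j, loop_point L (lshift n j) (xi (lshift n j)) <>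
  loop_point L (lshift n j) ((g j)%:Z - (uphalf r)%:Z - 1)%:~R.

Let x : 'I_(n + n) -> nat :=
  glue_lr (fun j => (g j - g j.+1)%N) (fun j => (g j.+1 - g j)%N).
(** [bin k] and [bout k] are the largest slopes below the barrier on arriving at and on leaving the
    loop k. Negating slopes exchanges the sides, whence -bl - 1 on the second half. *)
Let bl (i : nat) : int := (g i)%:Z - (uphalf r)%:Z - 1.
Let bin : 'I_(n + n) -> int := glue_lr (fun j => bl j) (fun j => - bl j - 1).
Let bout : 'I_(n + n) -> int := glue_lr (fun j => bl j.+1) (fun j => - bl j.+1 - 1).

(* The bridge slopes of a function in R(D - E) cannot cross the barrier given by
   g in the first half, and by its antipodal image in the second half. *)
Definition barrier_div : divisor G := \sum_k << vtx (lol_w k : vert G) >> *+ x k.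

Lemma barrier_eff : effective barrier_div.
Proof. by apply: effective_sum => k _; apply/effectiveMn/effectiveU. Qed.

Lemma barrier_deg : deg barrier_div =
  (\sum_(j < n) ((g j - g j.+1) + (g j.+1 - g j)))%N%:Z.
Proof.
rewrite /barrier_div raddf_sum /=; under eq_bigr do rewrite degMn degU.
rewrite -natz natr_sum big_lr; apply: eq_bigr => j _.
by rewrite /x glue_l glue_r natrD.
Qed.

Lemma barrier_loop k w : loop_sum k w barrier_div = w 0 * (x k)%:R.
Proof.
rewrite /loop_sum /barrier_div wsum_sum.
under eq_bigr do rewrite wsumMn wsumU1 loop_wt_w -mulr_natr.
rewrite (bigD1 k) //= eqxx big1 ?addr0 // => k' /negPf->; by rewrite mul0r.
Qed.

Lemma barrier_bridge k w : bridge_sum k w barrier_div = 0.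
Proof.
rewrite /bridge_sum /barrier_div wsum_sum big1 // => k' _.
by rewrite wsumMn wsumU1 mul0rn.
Qed.

Lemma bin_bout k : bin k - (x k)%:Z <= bout k.
Proof. by case: (lr_ordP k) => -[j ->]; rewrite /bin /bout /x ?glue_l ?glue_r /bl; lia. Qed.

(** The condition [g_end] makes the barrier continue across the bridges between the halves, allowing
    for the chips at [p0] and its antipode. *)
Lemma bout_pred k : bout (ord_pred k) + hatT_bridge_deg r k = bin k.
Proof.
have uo : (uphalf r + uphalf r = r + odd r)%N.
  by rewrite uphalf_half; have := odd_double_half r; lia.
have jj j : (ord_pred j).+1 = (if j == 0%N :> nat then n else j).
  have nj := ltn_ord j; rewrite /=; case: eqP => [->|jn0].
    by rewrite add0n modn_small; lia.
  have -> : ((j + n).-1 = j.-1 + n)%N by lia.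
  by rewrite modnDr modn_small; lia.
rewrite /hatT_bridge_deg.
case: (lr_ordP k) => -[j ->]; have nj := ltn_ord j; rewrite ?ord_pred_l ?ord_pred_r.
- have jn : (lshift n j == n :> nat) = false by rewrite /=; lia.
  have jz : (lshift n j == 0%N :> nat) = (j == 0%N :> nat) by [].
  rewrite jn jz; case: (eqVneq (j : nat) 0%N) => [j0|jn0]; rewrite /bin /bout ?glue_l ?glue_r jj.
    by rewrite j0 eqxx /bl; move: uo g_end; case: odd => uo ge; lia.
  by rewrite (negPf jn0); case: odd; rewrite ?subrr addr0.
- have jn : (rshift n j == n :> nat) = (j == 0%N :> nat) by rewrite /=; lia.
  have jz : (rshift n j == 0%N :> nat) = false by rewrite /=; lia.
  rewrite jn jz; case: (eqVneq (j : nat) 0%N) => [j0|jn0]; rewrite /bin /bout ?glue_l ?glue_r jj.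
    by rewrite j0 eqxx /bl; move: uo g_end; case: odd => uo ge; lia.
  by rewrite (negPf jn0); case: odd; rewrite ?subrr addr0.
Qed.

Lemma bin_avoid k : loop_point L k (xi k) <> loop_point L k (bin k)%:~R.
Proof.
case: (lr_ordP k) => -[j ->]; rewrite /bin ?glue_l ?glue_r; first exact: g_avoid.
move=> /loop_point_eq[z]; rewrite loop_len_r /= idx_proj_r => zE.
apply: (@g_avoid j); apply/loop_point_eq; rewrite loop_len_l /= idx_proj_l.
have [u uE] := xi_pair hx j; exists (u - z).
move: zE; rewrite -/(bl j) !(rmorphB, rmorphN) /= => zE.
rewrite [RHS]mulrBl -uE -zE; ring.
Qed.

Lemma bin_lr j : bin (lshift n j) + bin (rshift n j) = -1.
Proof. by rewrite /bin glue_l glue_r; lia. Qed.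

Lemma bout_lr j : bout (lshift n j) + bout (rshift n j) = -1.
Proof. by rewrite /bout glue_l glue_r; lia. Qed.

(** Slopes below the barrier at one loop are below it all the way round. The values [bin] of an
    antipodal pair add up to -1, so the slopes of a pair add up to at most -1, or to at least 1 if
    all are above. This fixes the sign of every term of the closing sum. *)
Lemma barrier_not_effective : ~ eq_effective (hatT_div p0 r xi - barrier_div).
Proof.
case=> F F0 /lin_equiv_sym/lin_equivP/principal_slope_data[s [t [Ha Hb Hc Hd]]].
have [j0 [t0' [j00 _ _ _]]] := first_bridge hp0.
have n0 : (0 < n)%N by have := ltn_ord j0; lia.
have [t0 Hbs] := hatT_bridge_sum hp0 r xi.
set A := F - _ in Ha Hb Hc Hd.
have ls k w : loop_sum k w A =
    loop_sum k w F - w (loop_pos L k (xi k)) + w 0 * (x k)%:R.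
  rewrite /A /loop_sum !wsumB -!/(loop_sum _ _ _) (hatT_loop_sum hp0) barrier_loop.
  by rewrite opprB addrA addrAC.
have bs k w : bridge_sum k w A = bridge_sum k w F - w t0 * (hatT_bridge_deg r k)%:~R.
  by rewrite /A /bridge_sum !wsumB -!/(bridge_sum _ _ _) Hbs barrier_bridge subr0.
have /choice[dF HdF] : forall k, exists z : int, loop_sum k (fun=> 1) F = z%:~R.
  by move=> k; apply: loop_sum_int.
have /choice[bF HbF] : forall k, exists z : int, bridge_sum k (fun=> 1) F = z%:~R.
  by move=> k; apply: wsum_edge_int.
have dF0 k : 0 <= dF k.
  by rewrite -(ler0z R) -HdF; apply: wsum_ge0 => // p; apply: loop_wt_ge0.
have bF0 k : 0 <= bF k.
  by rewrite -(ler0z R) -HbF; apply: wsum_ge0 => // p; case: (edge_wt_bounds (lol_bridge k : edge G) p).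
have Ea k : dF k - 1 + (x k)%:Z = s k - t k.
  apply: (@intr_inj R); rewrite -Ha ls HdF mul1r !(rmorphD, rmorphB) /=.
  by rewrite -pmulrn.
have Eb k : bF k - hatT_bridge_deg r k = t (ord_pred k) - s k.
  by apply: (@intr_inj R); rewrite -Hb bs HbF mul1r rmorphB.
(* The slope changes by 1 - dF k - x k. With a chip of F on the loop it falls at least as far as the
   barrier. Without one it might overtake the barrier only from s k = bin k, and then the moment
   congruence would put a wall there. *)
have low_step k : s k <= bin k -> t k <= bout k.
  have := bin_bout k; have := Ea k; have := dF0 k.
  have [d0|dn0] := eqVneq (dF k) 0; last by lia.
  suff : s k <> bin k by lia.
  move=> sb; apply: (@bin_avoid k); rewrite -sb; apply/loop_point_eq.
  have [z] := Hc k; rewrite ls mul0r addr0.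
  have -> : loop_sum k id F = 0.
    apply: (wsum_eq0 F0 (loop_wt_ge0 k)); last by rewrite -/(loop_sum _ _ _) HdF d0.
    move=> p; rewrite /loop_wt; case: (val p) => [[i|i]|[[[i|i]|i] u]] //;
      by case: eqP => // _ /eqP; rewrite oner_eq0.
  have [u ->] := loop_pos_congr L k (xi k); rewrite /loop_len sub0r => zE.
  by exists (- z - u - s k); rewrite !(rmorphB, rmorphN) /=; lra.
have low_pred k : s (ord_pred k) <= bin (ord_pred k) -> s k <= bin k.
  by move=> /low_step; have := bout_pred k; have := Eb k; have := bF0 k; lia.
have bmF k : 0 <= bridge_sum k id F /\ bridge_sum k id F <= bridge_len L k * (bF k)%:~R.
  split; first by apply: wsum_ge0 => // p; case: (edge_wt_bounds (lol_bridge k : edge G) p).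
  rewrite -HbF /bridge_sum -wsumZw -subr_ge0 -[X in _ - X]mul1r -mulNr -[- 1 * _]wsumZw -wsumDw.
  apply: wsum_ge0 => // p; rewrite mulN1r subr_ge0.
  by case: (edge_wt_bounds (lol_bridge k : edge G) p).
have GF k : 0 <= loop_sum k (tent L k) F /\
    loop_sum k (tent L k) F <= tent L k (wv_len L k) * (dF k)%:~R.
  split; first by apply: wsum_ge0 => // p; case: (loop_wt_tent k p).
  rewrite -HdF /loop_sum -wsumZw -subr_ge0 -[X in _ - X]mul1r -mulNr -[- 1 * _]wsumZw -wsumDw.
  apply: wsum_ge0 => // p; rewrite mulN1r subr_ge0.
  by case: (loop_wt_tent k p).
pose gv j := tent Gamma j (wv_len Gamma j).
have gv0 j : 0 <= gv j.
  by apply: tent_ge0; rewrite ltW ?wv_len_gt0 //= /loop_len lerDr ltW ?vw_len_gt0.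
have elr j : (hatT_bridge_deg r (rshift n j))%:~R = - (hatT_bridge_deg r (lshift n j))%:~R :> R.
  by have := congr1 (fun z : int => z%:~R : R) (hatT_bridge_deg_lr r j); rewrite rmorphD /=; lra.
(* The share of the pairs over j in the closing sum: the offsets t0 cancel, and the Green values of
   the two chips of [hatT_div] add up to [gv j]. *)
pose f j : R :=
  ((s (lshift n j) + s (rshift n j))%:~R * bridge_len Gamma j
   + bridge_sum (lshift n j) id F + bridge_sum (rshift n j) id F) +
  ((s (lshift n j) + s (rshift n j) + 1)%:~R * gv j
   - loop_sum (lshift n j) (tent Gamma j) F - loop_sum (rshift n j) (tent Gamma j) F).
have f0 : \sum_j f j = 0.
  have Hd2 := Hd; rewrite !big_lr -big_split /= in Hd2; rewrite -[RHS]Hd2; apply: eq_bigr => j _.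
  rewrite !bs !ls !tent_l !tent_r !tent0 !mul0r !addr0 elr /= idx_proj_l idx_proj_r.
  rewrite -/(gv j) /f.
  have := tent_pair (xi_pair hx j); rewrite -/(gv j).
  have Q (len gg a b c d e e' h h' sl sr : R) : a + b = gg ->
    (sl + sr) * len + h + h' + ((sl + sr + 1) * gg - c - d) =
    sl * len + (h - t0 * e) + (sr * len + (h' - t0 * - e)) +
    (sl * gg - (c - a) + (sr * gg - (d - b))) by move=> <-; ring.
  by rewrite !rmorphD /=; apply: Q.
have lenj j : 0 < bridge_len Gamma j := bridge_len_gt0 Gamma j.
have [low|high] := pselect (exists k, s k <= bin k).
  have [k0 lk0] := low.
  have lo k : s k <= bin k := cyclic_ind low_pred lk0 k.
  apply: (sum_neq0_lt0 n0) f0 => j; rewrite /f.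
  have [l1 l2] := (lo (lshift n j), lo (rshift n j)).
  (* Up to the chips of [hatT_div], s + bF is the slope at the start of a bridge. Since a moment is
     at most bF times the length, the two bridges together contribute at most minus their length. *)
  have sle : (s (lshift n j) + bF (lshift n j)) + (s (rshift n j) + bF (rshift n j)) <= -1.
    have := low_step _ (lo (ord_pred (lshift n j))); have := low_step _ (lo (ord_pred (rshift n j))).
    have := bout_pred (lshift n j); have := bout_pred (rshift n j).
    have := Eb (lshift n j); have := Eb (rshift n j); have := bin_lr j; lia.
  have s1 : s (lshift n j) + s (rshift n j) + 1 <= 0 by have := bin_lr j; lia.
  have [_] := bmF (lshift n j); have [_] := bmF (rshift n j).
  have [+ _] := GF (lshift n j); have [+ _] := GF (rshift n j).
  rewrite tent_l tent_r /= idx_proj_l idx_proj_r.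
  have := lenj j; have := gv0 j.
  move: sle s1; rewrite -(ler_int R) -[_ <= 0](ler_int R) !rmorphD /= -[(-1)%:~R]/(-1 : R).
  set sl := (s (lshift n j))%:~R; set sr := (s (rshift n j))%:~R.
  set bL := (bF _)%:~R; set bR := (bF _)%:~R.
  move: (bridge_sum _ _ F) (bridge_sum _ _ F) (loop_sum _ _ F) (loop_sum _ _ F) (gv j) (bridge_len _ _) => a b c d gg len.
  nra.
have hi k : bin k + 1 <= s k.
  by rewrite leNgt; apply/negP => sk; apply: high; exists k; lia.
have f0' : \sum_j - f j = 0 by rewrite sumrN f0 oppr0.
apply: (sum_neq0_lt0 n0) f0' => j; rewrite /f.
have th k : bout k + 1 <= t k.
  have := hi (ordS k); have := Eb (ordS k); have := bout_pred (ordS k); have := bF0 (ordS k).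
  by rewrite ordSK; lia.
have s1 : 1 <= s (lshift n j) + s (rshift n j).
  by have := bin_lr j; have := hi (lshift n j); have := hi (rshift n j); lia.
(* The slopes leaving the loops are above the barrier as well, which limits the number of chips of F
   on these loops and hence their Green potential. *)
have t1 : (dF (lshift n j) + dF (rshift n j)) <= s (lshift n j) + s (rshift n j) + 1.
  have := Ea (lshift n j); have := Ea (rshift n j); have := th (lshift n j); have := th (rshift n j).
  by have := bout_lr j; lia.
have [+ _] := bmF (lshift n j); have [+ _] := bmF (rshift n j).
have [_] := GF (lshift n j); have [_] := GF (rshift n j).
rewrite tent_l tent_r /= idx_proj_l idx_proj_r -/(gv j).
have := lenj j; have := gv0 j.
move: s1 t1; rewrite -(ler_int R) -[_ <= _ + 1](ler_int R) !rmorphD /=.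
set sl := (s (lshift n j))%:~R; set sr := (s (rshift n j))%:~R.
set dL := (dF _)%:~R; set dR := (dF _)%:~R.
move: (bridge_sum _ _ F) (bridge_sum _ _ F) (loop_sum _ _ F) (loop_sum _ _ F) (gv j) (bridge_len _ _) => a b c d gg len.
nra.
Qed.

Lemma barrier_rank m : (\sum_(j < n) ((g j - g j.+1) + (g j.+1 - g j)) <= m)%N ->
  ~ rank_ge (hatT_div p0 r xi) m.
Proof.
move=> le H; apply: barrier_not_effective.
apply: (rank_ge_le p0 le H); first exact: barrier_eff.
exact: barrier_deg.
Qed.

End Barrier.

(** * Greedy permutations and words *)

Section Greedy.
Variables (r : nat) (W : nat -> nat -> bool).
Hypothesis W_lt : forall j i, W j i -> (i < r)%N.
Hypothesis W_sparse : forall j i, W j i -> ~~ W j i.+1.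
Implicit Types (j i : nat) (u : 'S_r.+1) (x y : 'I_r.+1).

(* A permutation maps the label of a strand to its position. *)
Definition ascent u i : bool :=
  ((u^-1)%g (inord i) < (u^-1)%g (inord i.+1 : 'I_r.+1))%N.

Definition swap_fun j u y : 'I_r.+1 :=
  if W j y && ascent u y then inord y.+1
  else if [&& (0 < y)%N, W j y.-1 & ascent u y.-1] then inord y.-1 else y.

Lemma swap_funE j u y : (swap_fun j u y : nat) =
  if W j y && ascent u y then y.+1
  else if [&& (0 < y)%N, W j y.-1 & ascent u y.-1] then y.-1 else y.
Proof.
have yr := ltn_ord y; rewrite /swap_fun; case: ifP => [/andP[/W_lt yr' _]|_].
  by rewrite inordK.
by case: ifP => // _; rewrite inordK //; lia.
Qed.

(** By [W_sparse] the pairs of positions swapped at one loop are disjoint. *)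
Lemma swap_funK j u : involutive (swap_fun j u).
Proof.
move=> y; apply: val_inj; rewrite /= swap_funE.
have := swap_funE j u y; case: ifP => [/andP[Wy ay] ->|nW].
  by rewrite (negPf (W_sparse Wy)) /= Wy ay.
case: ifP => [/and3P[y0 Wy ay] ->|nW' ->].
  by rewrite Wy ay /= prednK.
by rewrite nW nW'.
Qed.

Definition swap_perm j u : 'S_r.+1 := perm (inv_inj (swap_funK j u)).

(** The Demazure product of the walls: a generator is applied only when it adds an inversion. *)
Fixpoint greedy j : 'S_r.+1 :=
  if j is j'.+1 then (greedy j' * swap_perm j' (greedy j'))%g else 1%g.

Lemma greedyS j x : greedy j.+1 x = swap_fun j (greedy j) (greedy j x).
Proof. by rewrite /= permM permE. Qed.

Lemma greedy_step j x :
  [\/ greedy j.+1 x = greedy j x :> nat,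
      greedy j.+1 x = (greedy j x).+1 :> nat /\ W j (greedy j x)
    | greedy j x = (greedy j.+1 x).+1 :> nat /\ W j (greedy j.+1 x)].
Proof.
rewrite greedyS swap_funE; case: ifP => [/andP[H _]|_]; first by constructor 2.
case: ifP => [/and3P[y0 H _]|_]; last by constructor 1.
by constructor 3; rewrite prednK.
Qed.

(* A gap c separates the positions below c from the other ones. *)
Definition gap_wall j c : bool := (0 < c)%N && W j c.-1.

Lemma greedy_gap j c x : ~~ gap_wall j c -> (c <= greedy j.+1 x)%N = (c <= greedy j x)%N.
Proof.
rewrite /gap_wall greedyS swap_funE => nw.
set y := greedy j x; case: ifP => [/andP[H _]|_].
  have : c <> y.+1 by move=> cE; move: nw; rewrite cE /= H.
  by lia.
case: ifP => [/and3P[y0 H _]|_] //.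
have : c <> y by move=> cE; move: nw; rewrite cE y0 H.
by lia.
Qed.

(** The two strands at a wall either swap there or had been swapped before; sparsity keeps
    neighbouring walls from interfering. *)
Lemma greedy_descent j i : W j i ->
  ((greedy j.+1)^-1%g (inord i.+1 : 'I_r.+1) < (greedy j.+1)^-1%g (inord i : 'I_r.+1))%N.
Proof.
move=> H; have ir := W_lt H.
set u := greedy j.
have uV y : ((greedy j.+1)^-1)%g y = (u^-1)%g (swap_fun j u y).
  apply: (@perm_inj _ (greedy j.+1)); rewrite permKV greedyS -/u permKV.
  by rewrite swap_funK.
rewrite !uV; have i1 : (inord i.+1 : 'I_r.+1) = i.+1 :> nat by rewrite inordK.
have i0 : (inord i : 'I_r.+1) = i :> nat by rewrite inordK //; lia.
have [asc|nasc] := boolP (ascent u i).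
  have -> : swap_fun j u (inord i.+1) = inord i.
    apply: val_inj; rewrite /= swap_funE i1 i0 (negPf (W_sparse H)) /= H asc //.
  have -> : swap_fun j u (inord i) = inord i.+1.
    by apply: val_inj; rewrite /= swap_funE i1 i0 H asc.
  exact: asc.
have -> : swap_fun j u (inord i.+1) = inord i.+1.
  by apply: val_inj; rewrite /= swap_funE i1 (negPf (W_sparse H)) /= H (negPf nasc).
have -> : swap_fun j u (inord i) = inord i.
  apply: val_inj; rewrite /= swap_funE i0 H (negPf nasc) /=.
  case: ifP => // /and3P[i00 Hi _]; have := W_sparse Hi; by rewrite prednK // H.
rewrite /ascent -leqNgt in nasc; rewrite ltn_neqAle nasc andbT.
rewrite (inj_eq val_inj) (inj_eq perm_inj) -val_eqE /= i1 i0; lia.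
Qed.

Definition crossing (u : 'S_r.+1) (a c : nat) : nat :=
  #|[pred x : 'I_r.+1 | (x < a)%N && (c <= u x)%N]|.

Lemma crossingS u a c : (c <= r)%N -> crossing u a c =
  (crossing u a c.+1 + (((u^-1)%g (inord c) : 'I_r.+1) < a)%N)%N.
Proof.
move=> cr; rewrite /crossing -!sum1_card (bigID (fun x => u x == inord c)) /= addnC; congr addn.
  apply: eq_bigl => x; rewrite !inE -andbA; congr (_ && _).
  by rewrite -val_eqE /= inordK // ltn_neqAle eq_sym andbC.
case: ltnP => ha.
  rewrite (big_pred1 ((u^-1)%g (inord c))) // => x; rewrite !inE /=.
  apply/idP/eqP => [/andP[_ /eqP<-]|->]; first by rewrite permK.
  by rewrite permKV eqxx andbT ha /= inordK.
rewrite big_pred0 // => x; rewrite !inE; apply/negP => /andP[/andP[xa _] /eqP E].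
by move: ha; rewrite -E permK leqNgt xa.
Qed.

Lemma crossing0 a c : (a <= r.+1)%N -> crossing 1%g a c = (a - c)%N.
Proof.
move=> ar; rewrite /crossing -sum1_card.
rewrite (eq_bigl (fun x : 'I_r.+1 => (c <= x < a)%N)); last first.
  by move=> x; rewrite inE perm1 andbC.
have -> : (\sum_(x < r.+1 | (c <= x < a)%N) 1 = \sum_(0 <= x < r.+1 | (c <= x < a)%N) 1)%N.
  by rewrite big_mkord.
rewrite (big_cat_nat (n := a)) //= [X in (_ + X)%N]big1_seq; last first.
  by move=> i; rewrite mem_index_iota => /andP[]; lia.
rewrite addn0; case: (leqP c a) => ca; last first.
  rewrite big1_seq; first by lia.
  by move=> i /andP[]; lia.
rewrite (big_cat_nat (n := c)) //= big1_seq ?add0n; last first.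
  by move=> i; rewrite mem_index_iota => /andP[]; lia.
rewrite big_mkcond (eq_big_nat _ _ (F2 := fun=> 1%N)); last by move=> i ->.
by rewrite sum_nat_const_nat muln1.
Qed.

(* The number of strands crossing downwards is the least total descent of a path
   of gaps that avoids the walls. *)
Lemma gap_path k a c : (a <= r.+1)%N -> (c <= r.+1)%N -> exists G : nat -> nat,
  [/\ G 0%N = a, G k.+1 = c, (forall i, G i <= r.+1)%N,
      forall j, (j < k)%N -> ~~ gap_wall j (G j.+1)
    & (\sum_(i < k.+1) (G i - G i.+1) <= crossing (greedy k) a c)%N].
Proof.
elim: k c => [|k IH] c ar cr.
  exists (fun i => if i == 0%N then a else c); split=> // [i|]; first by case: eqP.
  by rewrite big_ord1 /= crossing0.
(* A path to c' passes the loop k in the gap c' and is then prolonged by a leg to c1. *)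
have ext c' c1 : (c' <= r.+1)%N -> (c1 <= r.+1)%N -> ~~ gap_wall k c' ->
    (crossing (greedy k) a c' + (c' - c1) <= crossing (greedy k.+1) a c1)%N ->
    exists G : nat -> nat,
  [/\ G 0%N = a, G k.+2 = c1, (forall i, G i <= r.+1)%N,
      forall j, (j < k.+1)%N -> ~~ gap_wall j (G j.+1)
    & (\sum_(i < k.+2) (G i - G i.+1) <= crossing (greedy k.+1) a c1)%N].
  move=> cr' cr1 nw le; have [G [G0 Gk Gr Gw Gs]] := IH c' ar cr'.
  exists (fun i => if (i <= k.+1)%N then G i else c1); split=> //.
  - by rewrite ltnn.
  - by move=> i; case: ifP.
  - move=> j; rewrite ltnS leq_eqVlt => /orP[/eqP->|jk]; first by rewrite eqxx Gk.
    by rewrite jk orbT Gw.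
  rewrite big_ord_recr /= leqnn ltnn Gk; apply: leq_trans le; rewrite leq_add2r.
  apply: leq_trans Gs; apply: leq_sum => i _.
  by rewrite (ltnW (ltn_ord i)) (ltn_ord i).
have cross c' : ~~ gap_wall k c' -> crossing (greedy k.+1) a c' = crossing (greedy k) a c'.
  by move=> nw; apply: eq_card => x; rewrite !inE greedy_gap.
have [w|nw] := boolP (gap_wall k c); last first.
  by apply: (ext c c) => //; rewrite subnn addn0 cross.
have /andP[c0 Wc] := w; have cr2 := W_lt Wc.
have nwS : ~~ gap_wall k c.+1 by have := W_sparse Wc; rewrite prednK.
have nwP : ~~ gap_wall k c.-1.
  apply/negP => /andP[c1 W']; have := W_sparse W'; by rewrite prednK // Wc.
have desc := greedy_descent Wc; rewrite prednK // in desc.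
have E1 := @crossingS (greedy k.+1) a c; have E2 := @crossingS (greedy k.+1) a c.-1.
rewrite prednK // in E2.
(* The path has to pass next to the walled gap c. If the strand at the position c started below a,
   one strand fewer crosses the gap c + 1, which pays for the descent to c. Otherwise
   [greedy_descent] shows that neither strand at the wall started below a, so the gap c - 1 is
   crossed as often as c. *)
have [ya|ay] := ltnP (((greedy k.+1)^-1)%g (inord c)) a.
  apply: (ext c.+1 c) => //; first by lia.
  by rewrite -cross // E1 ?ya ?subSnn //; lia.
apply: (ext c.-1 c) => //; first by lia.
rewrite -cross // E2; last by lia.
by rewrite ltnNge (leq_trans ay (ltnW desc)) /=; lia.
Qed.

Lemma rev_or_barrier n : (0 < n)%N ->
  (forall x, greedy n x = (r - x)%N :> nat) \/
  exists g : nat -> nat, [/\ (g 0 + g n = r.+1)%N,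
    forall j, (j < n)%N -> ~~ gap_wall j (g j)
    & (\sum_(j < n) ((g j - g j.+1) + (g j.+1 - g j)) < r)%N].
Proof.
case: n => // n _; have [H|nrev] := pselect (forall x, (r - x <= greedy n.+1 x)%N).
  left=> x; apply/eqP; rewrite eq_sym; move: x.
  (* Both sides are the sum of all positions, so inequality everywhere forces equality. *)
  have S : (\sum_(x < r.+1) (r - x) = \sum_(x < r.+1) greedy n.+1 x)%N.
    have -> : (\sum_(x < r.+1) greedy n.+1 x = \sum_(x < r.+1) x)%N.
      by rewrite [RHS](reindex_inj (@perm_inj _ (greedy n.+1))).
    rewrite [LHS](reindex_inj rev_ord_inj); apply: eq_bigr => x _ /=.
    by have := ltn_ord x; lia.
  have /leqif_sum : forall x : 'I_r.+1, true -> (r - x <= greedy n.+1 x ?= iff (r - x == greedy n.+1 x))%N.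
    by move=> x _; split=> //; apply: H.
  by move=> [_]; rewrite S eqxx => /esym/forallP Hx x; have := Hx x.
right; have [x] : exists x, (greedy n.+1 x < r - x)%N.
  apply: contrapT => H; apply: nrev => x; rewrite leqNgt; apply/negP => lt.
  by apply: H; exists x.
(* The strand x starts below a and ends below c, so at most a - 1 = x strands cross. A path from a
   to c of total descent at most x has variation at most 2x + c - a = r - 1. *)
move=> xlt; have xr := ltn_ord x; pose a := x.+1; pose c := (r - x)%N.
have [||G [G0 Gc Gr Gw Gs]] := @gap_path n.+1 a c; try by rewrite /a /c; lia.
have cross : (crossing (greedy n.+1) a c < a)%N.
  rewrite /crossing; apply: (@leq_trans #|[pred y : 'I_r.+1 | (y < a)%N]|).
    apply: proper_card; apply/properP; split.
      by apply/fintype.subsetP => y; rewrite !inE => /andP[].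
    by exists x; rewrite !inE /a ?leqnn // negb_and -ltnNge xlt orbT.
  have ar : (a <= r.+1)%N by rewrite /a; lia.
  have := crossing0 0 ar; rewrite subn0 /crossing => E; rewrite -[leqRHS]E.
  by apply: subset_leq_card; apply/fintype.subsetP => y; rewrite !inE => ->.
(* The shift makes g j the gap at the loop j. As c = r + 1 - a, the first leg from a to G 1 is as
   long as a leg from c to r + 1 - G 1; it is moved to the end, where [g_end] requires it. *)
exists (fun j => if (j <= n)%N then G j.+1 else r.+1 - G 1%N)%N; split.
- by rewrite ltnn /= subnKC.
- by move=> j; rewrite ltnS => jn; rewrite jn Gw.
rewrite big_ord_recr /= leqnn ltnn.
have tel : forall m, (\sum_(i < m) (G i.+1 - G i) + G 0 = \sum_(i < m) (G i - G i.+1) + G m)%N.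
  elim=> [|m]; first by rewrite !big_ord0.
  rewrite !big_ord_recr /=.
  by move: (\sum_(i < m) _)%N (\sum_(i < m) _)%N => u v; lia.
have split3 (f : nat -> nat) :
    (\sum_(i < n.+2) f i = f 0%N + \sum_(i < n) f i.+1 + f n.+1)%N.
  by rewrite big_ord_recl big_ord_recr /= addnA; congr (_ + _ + _)%N; apply: eq_bigr.
have := tel n.+2; move: Gs; rewrite (split3 (fun i => G i - G i.+1)%N).
rewrite (split3 (fun i => G i.+1 - G i)%N) G0 Gc.
have -> : (\sum_(i < n) ((if (i <= n)%N then G i.+1 else r.+1 - G 1) -
    (if (i < n)%N then G i.+2 else r.+1 - G 1) +
    ((if (i < n)%N then G i.+2 else r.+1 - G 1) -
     (if (i <= n)%N then G i.+1 else r.+1 - G 1))) =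
   \sum_(i < n) (G i.+1 - G i.+2) + \sum_(i < n) (G i.+2 - G i.+1))%N.
  by rewrite -big_split /=; apply: eq_bigr => i _; rewrite (ltn_ord i) (ltnW (ltn_ord i)).
have := Gr 1%N; have := Gr n.+1; rewrite /a /c in cross *.
move: (\sum_(i < n) _)%N (\sum_(i < n) _)%N => s1 s2.
lia.
Qed.

End Greedy.

(** * Inversions, reduced words and the greedy subword *)

Section Words.
Variable r : nat.
Implicit Types (w : 'S_r.+1) (i : 'I_r) (x y : 'I_r.+1) (u : seq 'I_r).

Lemma tauE i x : (tau i x : nat) =
  if x == i :> nat then i.+1 else if x == i.+1 :> nat then i : nat else x.
Proof.
rewrite /tau; case: tpermP => [->|->|/eqP h1 /eqP h2] /=.
- by rewrite eqxx.
- by rewrite /bump /= add1n eqxx (gtn_eqF (ltnSn i)).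
- move: h1 h2; rewrite -!val_eqE /= /bump /= add1n => /negPf-> /negPf->.
  by [].
Qed.

Definition inversions w : nat :=
  #|[pred p : 'I_r.+1 * 'I_r.+1 | (p.1 < p.2)%N && (w p.2 < w p.1)%N]|.

Lemma inversions_tau w i x y : w x = i :> nat -> w y = i.+1 :> nat ->
  (inversions (w * tau i)%g <= (inversions w).+1)%N /\
  ((x < y)%N -> inversions (w * tau i)%g = (inversions w).+1).
Proof.
move=> wx wy.
have wE z z' : w z = w z' :> nat -> z = z' by move=> /val_inj /perm_inj.
pose P := [pred p : 'I_r.+1 * 'I_r.+1 | (p.1 < p.2)%N && (w p.2 < w p.1)%N].
pose P' := [pred p : 'I_r.+1 * 'I_r.+1 |
  (p.1 < p.2)%N && ((w * tau i)%g p.2 < (w * tau i)%g p.1)%N].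
have other p : p != (x, y) -> p != (y, x) -> P' p = P p.
  case: p => a b; rewrite !xpair_eqE => /negP n1 /negP n2; rewrite /= !permM !tauE.
  have h1 : ~ (w a = i :> nat /\ w b = i.+1 :> nat).
    move=> [E1 E2]; apply: n1.
    by rewrite (wE a x (etrans E1 (esym wx))) (wE b y (etrans E2 (esym wy))) !eqxx.
  have h2 : ~ (w a = i.+1 :> nat /\ w b = i :> nat).
    move=> [E1 E2]; apply: n2.
    by rewrite (wE a y (etrans E1 (esym wy))) (wE b x (etrans E2 (esym wx))) !eqxx.
  have h3 : w a = w b :> nat -> a = b by apply: wE.
  case: ltnP => //= ab; have {}h3 : w a <> w b :> nat by move=> /h3 E; rewrite E ltnn in ab.
  move: (w a : nat) (w b : nat) (i : nat) h1 h2 h3 => p q m h1 h2 h3.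
  by case: (eqVneq p m) => ?; case: (eqVneq p m.+1) => ?;
     case: (eqVneq q m) => ?; case: (eqVneq q m.+1) => ?; lia.
have xy : x != y by apply/eqP => xy; move: wx; rewrite xy wy; lia.
have P'yx : P' (y, x) = false.
  by rewrite /= !permM !tauE wx wy eqxx (gtn_eqF (ltnSn i)) eqxx; lia.
have Pxy : P (x, y) = false by rewrite /= wx wy; lia.
have P'xy : P' (x, y) = (x < y)%N.
  by rewrite /= !permM !tauE wx wy eqxx (gtn_eqF (ltnSn i)) eqxx ltnSn andbT.
have Pyx : P (y, x) = (y < x)%N by rewrite /= wx wy ltnSn andbT.
have E : (inversions (w * tau i)%g + (y < x)%N = inversions w + (x < y)%N)%N.
  rewrite /inversions -/P -/P'.
  rewrite (cardD1 (x, y) P') (cardD1 (y, x) [predD1 P' & (x, y)]).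
  rewrite (cardD1 (x, y) P) (cardD1 (y, x) [predD1 P & (x, y)]).
  have yx : ((y, x) == (x, y)) = false by rewrite xpair_eqE (negPf xy) andbF.
  have -> : #|[predD1 [predD1 P' & (x, y)] & (y, x)]| = #|[predD1 [predD1 P & (x, y)] & (y, x)]|.
    apply: eq_card => p; rewrite !inE.
    by have [//|n2] := eqVneq p (y, x); have [//|n1] := eqVneq p (x, y); have := other p n1 n2.
  rewrite !inE yx /= -[(x < y)%N && _]/(P' (x, y)) -[(y < x)%N && _]/(P' (y, x)).
  rewrite P'yx P'xy -[(x < y)%N && _]/(P (x, y)) -[(y < x)%N && _]/(P (y, x)) Pxy Pyx.
  by rewrite !add0n addnAC [RHS]addnAC (addnC (x < y)%N).
split; first by lia.
by move=> lt; lia.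
Qed.


Lemma inversions1 : inversions 1%g = 0%N.
Proof. by apply: eq_card0 => p; rewrite !inE !perm1; lia. Qed.

Lemma word_prod_rcons u i : word_prod (rcons u i) = (word_prod u * tau i)%g.
Proof. by rewrite /word_prod big_rcons. Qed.

Lemma permKV_val w (m : nat) : (m < r.+1)%N -> w ((w^-1)%g (inord m)) = m :> nat.
Proof. by move=> mr; rewrite permKV inordK. Qed.

Lemma inversions_word u : (inversions (word_prod u) <= size u)%N.
Proof.
elim/last_ind: u => [|u i IH]; first by rewrite /word_prod big_nil inversions1.
have ir := ltn_ord i; rewrite word_prod_rcons size_rcons.
have [le _] := @inversions_tau (word_prod u) i _ _
  (permKV_val (word_prod u) (ltnW ir : (i < r.+1)%N)) (permKV_val (word_prod u) (ir : (i.+1 < r.+1)%N)).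
exact: leq_trans le _.
Qed.

(** A letter adds at most one inversion, so no word for the same permutation has fewer letters than
    inversions. *)
Lemma reduced_inversions u : size u = inversions (word_prod u) -> reduced_word u.
Proof. by move=> su u' E; rewrite su -E; apply: inversions_word. Qed.

(** Spreads the partial products of u over the letters of Q, pausing at the letters that u skips. *)
Lemma subseq_strands (Q : seq (option 'I_r)) u w : subseq u (pmap id Q) ->
  exists P : nat -> 'S_r.+1, [/\ P 0%N = w, P (size Q) = (w * word_prod u)%g &
    forall j, P j.+1 = P j \/
      exists2 i, nth None Q j = Some i & P j.+1 = (P j * tau i)%g].
Proof.
have cons Q' o w0 w1 v : (w1 = w0 \/ exists2 i, o = Some i & w1 = (w0 * tau i)%g) ->
    (exists P : nat -> 'S_r.+1, [/\ P 0%N = w1, P (size Q') = v &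
      forall j, P j.+1 = P j \/
        exists2 i, nth None Q' j = Some i & P j.+1 = (P j * tau i)%g]) ->
    exists P : nat -> 'S_r.+1, [/\ P 0%N = w0, P (size (o :: Q')) = v &
      forall j, P j.+1 = P j \/
        exists2 i, nth None (o :: Q') j = Some i & P j.+1 = (P j * tau i)%g].
  move=> Ho [P [P0 Ps PS]]; exists (fun j => if j is j'.+1 then P j' else w0).
  by split=> //; case=> [|j] /=; rewrite ?P0 //; apply: PS.
elim: Q u w => [|o Q IH] u w /=.
  move=> /eqP->; exists (fun=> w); split=> //; last by left.
  by rewrite /word_prod big_nil mulg1.
case: o => [i|] /=; last by move=> /(IH u w); apply: cons; left.
case: u => [|i' u].
  by move=> _; apply: (cons _ _ _ w); [left|apply: IH; apply: sub0seq].
case: eqP => [-> su|_ su].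
  have := IH u (w * tau i)%g su; rewrite -mulgA => H.
  apply: (cons _ _ _ (w * tau i)%g); first by right; exists i.
  by rewrite /word_prod big_cons.
by apply: (cons _ _ _ w); [left|apply: IH].
Qed.

Section GreedyWord.
Variables (W : nat -> nat -> bool) (Q : seq (option 'I_r)).
Hypothesis W_lt : forall j m, W j m -> (m < r)%N.
Hypothesis W_sparse : forall j m, W j m -> ~~ W j m.+1.
Hypothesis Q_wall : forall j m, W j m = (omap (@nat_of_ord r) (nth None Q j) == Some m).
Let gr := greedy W_lt W_sparse.

(** When the walls form a word, a loop has at most one wall, and a greedy step is one generator or
    none. *)
Lemma swap_perm_letter j w : swap_perm W_lt W_sparse j w =
  if nth None Q j is Some i then if ascent w i then tau i else 1%g else 1%g.
Proof.
apply/permP => y; apply: val_inj; rewrite /= permE (swap_funE W_lt) !Q_wall.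
case: (nth None Q j) => [i|] /=; last by rewrite andbF perm1.
rewrite -[Some _ == _]/((i : nat) == y) -[Some _ == _]/((i : nat) == y.-1).
have [iy|iy] := eqVneq (i : nat) y.
  rewrite /= -iy; case: ifP => [asc|nasc]; first by rewrite tauE iy eqxx.
  case: ifP => [|_]; last by rewrite perm1.
  by move=> /and3P[i0 /eqP]; lia.
rewrite /=; have [iy'|iy'] := eqVneq (i : nat) y.-1; last first.
  rewrite andbF; case: ifP => _; rewrite ?perm1 // tauE.
  case: eqP => [E|_]; first by rewrite E eqxx in iy.
  by case: eqP => // E; rewrite E eqxx in iy'.
have y0 : (0 < y)%N by case: posnP => // y0; rewrite y0 /= in iy'; rewrite iy' y0 eqxx in iy.
rewrite y0 -iy' /=; case: (ascent w i); last by rewrite perm1.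
rewrite tauE; case: eqP => [E|_]; first by rewrite E eqxx in iy.
by rewrite iy' prednK // eqxx.
Qed.

Lemma greedy_word k : (k <= size Q)%N -> exists u,
  [/\ subseq u (pmap id (take k Q)), word_prod u = gr k &
      size u = inversions (word_prod u)].
Proof.
elim: k => [|k IH] kQ.
  exists [::]; have w1 : word_prod [::] = 1%g :> 'S_r.+1 by rewrite /word_prod big_nil.
  by rewrite w1 inversions1; split=> //; apply: sub0seq.
have [u [su pu iu]] := IH (ltnW kQ).
rewrite (take_nth None kQ) -cats1 pmap_cat /=.
have sub v : subseq u (pmap id (take k Q) ++ v) by apply: subseq_trans su (prefix_subseq _ _).
rewrite swap_perm_letter; case: (nth None Q k) => [i|] /=; last first.
  by exists u; rewrite mulg1.
case: ifP => [asc|_]; last by exists u; rewrite mulg1.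
exists (rcons u i); rewrite word_prod_rcons pu; split=> //.
  by rewrite -cats1; apply: cat_subseq.
have ir := ltn_ord i; rewrite size_rcons iu pu.
have [_ ->//] := @inversions_tau (gr k) i _ _
  (permKV_val (gr k) (ltnW ir : (i < r.+1)%N)) (permKV_val (gr k) (ir : (i.+1 < r.+1)%N)).
Qed.

End GreedyWord.

Lemma greedy_contains_w0 (W : nat -> nat -> bool) n (Q : lingering_word r n)
    (W_lt : forall j m, W j m -> (m < r)%N)
    (W_sparse : forall j m, W j m -> ~~ W j m.+1) :
  (forall j m, W j m = (omap (@nat_of_ord r) (nth None Q j) == Some m)) ->
  (forall x, greedy W_lt W_sparse n x = (r - x)%N :> nat) -> contains_w0 Q.
Proof.
move=> QW gn; have := greedy_word W_lt W_sparse QW (leqnn _).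
rewrite take_size size_tuple => -[u [su pu iu]]; exists u; split=> //.
  exact: reduced_inversions.
rewrite pu; apply/permP => x; apply: val_inj; rewrite permE; apply: etrans (gn x) _ => /=.
by have := ltn_ord x; lia.
Qed.

End Words.

(** * The main theorem *)

Section Dichotomy.
Context {R : realType} {n : nat} (Gamma : loop_of_loops R n).
Local Notation L := (dcover Gamma).
Local Notation G := (lol_graph L).
Variable p0 : gpoint G.
Hypothesis hp0 : in_first_bridge p0.
Variable xi : 'I_(n + n) -> R.
Hypothesis hx : prym_coords Gamma xi.
Implicit Types (j : 'I_n) (r : nat).

Definition on_wall r j (i : nat) : Prop :=
  loop_point L (lshift n j) (xi (lshift n j)) =
  loop_point L (lshift n j) (i%:Z - (uphalf r)%:Z)%:~R.

(** The loop is a natural number, the form that [greedy] takes; there are no walls past the last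
    loop. *)
Definition wall r (m i : nat) : bool :=
  (i < r)%N && [exists j : 'I_n, (j == m :> nat) && `[< on_wall r j i >]].

Lemma wallE r j i : wall r j i = (i < r)%N && `[< on_wall r j i >].
Proof.
congr andb; apply/existsP/idP => [[j' /andP[/eqP/val_inj->]]//|w].
by exists j; rewrite eqxx.
Qed.

Lemma wall_lt r m i : wall r m i -> (i < r)%N.
Proof. by case/andP. Qed.

Lemma wall_ord r m i : wall r m i -> exists j : 'I_n, m = j.
Proof. by move=> /andP[_ /existsP[j /andP[/eqP<- _]]]; exists j. Qed.

Lemma on_wall_diff r j i i' : on_wall r j i -> on_wall r j i' ->
  exists z : int, (i%:Z - i'%:Z)%:~R * vw_len Gamma j = z%:~R * loop_len Gamma j.
Proof.
rewrite /on_wall => -> /loop_point_eq[z]; rewrite -intrB loop_len_l /= idx_proj_l => E.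
by exists z; rewrite -E; congr (_%:~R * _); lia.
Qed.

(** Walls at adjacent positions would make [vw_len] an integer multiple of [loop_len], but 0 <
    vw_len < loop_len. *)
Lemma wall_sparse r m i : wall r m i -> ~~ wall r m i.+1.
Proof.
move=> w; have [j jm] := wall_ord w; move: w; rewrite {m}jm !wallE.
move=> /andP[_ /asboolP w]; apply/negP => /andP[_ /asboolP w'].
have [z] := on_wall_diff w' w.
have -> : i.+1%:Z - i%:Z = 1 by lia.
rewrite mul1r => E; have y0 := vw_len_gt0 Gamma j; have y1 := wv_len_gt0 Gamma j.
have z0 : z = 0.
  apply: (@lt1_int_eq0 R z (loop_len Gamma j)); first exact: loop_len_gt0.
  by rewrite -E /loop_len; apply/andP; split; lra.
by move: E; rewrite z0 mul0r => E; rewrite E ltxx in y0.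
Qed.

Local Notation gr r := (greedy (@wall_lt r) (@wall_sparse r)).

Lemma n_gt0 : (0 < n)%N.
Proof. by have [j0 _] := first_bridge hp0; apply: leq_ltn_trans (ltn_ord j0). Qed.

Lemma greedy_rank_ge r : (forall x : 'I_r.+1, gr r n x = (r - x)%N :> nat) ->
  rank_ge (hatT_div p0 r xi) r.
Proof.
move=> gn; apply: (strands_rank_ge hp0 hx (p := fun k x => gr r k x)) => //.
- by move=> x; rewrite perm1.
- by move=> m _ x y /val_inj /perm_inj.
move=> j x; rewrite !slope_l /loop_step.
have [->|[-> ]|[-> ]] := greedy_step (@wall_lt r) (@wall_sparse r) j x.
- by constructor 1.
- by rewrite wallE => /andP[_ /asboolP w]; constructor 2; split=> //; lia.
by rewrite wallE => /andP[_ /asboolP w]; constructor 3; split=> //; lia.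
Qed.

Lemma path_variation (f : nat -> nat) k :
  (f k - f 0 <= \sum_(i < k) ((f i - f i.+1) + (f i.+1 - f i)))%N /\
  (f 0 - f k <= \sum_(i < k) ((f i - f i.+1) + (f i.+1 - f i)))%N.
Proof.
elim: k => [|k]; first by rewrite big_ord0; lia.
by rewrite big_ord_recr /=; move: (\sum_(i < k) _)%N => s; lia.
Qed.

Lemma strands_or_barrier r : (forall x : 'I_r.+1, gr r n x = (r - x)%N :> nat) \/
  (0 < r)%N /\ ~ rank_ge (hatT_div p0 r xi) r.-1.
Proof.
have [|[g [g_end g_wall g_var]]] := rev_or_barrier (@wall_lt r) (@wall_sparse r) n_gt0.
  by left.
right; have r0 : (0 < r)%N by apply: leq_ltn_trans g_var.
split=> //; apply: (barrier_rank hp0 hx g_end); last by rewrite -ltnS prednK.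
move=> j E; have jn := ltn_ord j; have := g_wall j jn; apply/negP; rewrite negbK.
(* A gap 0 or r + 1 has no wall by definition, but may still meet the coordinate modulo the torsion.
   It does not occur: as g 0 + g n = r + 1, a path through it has variation at least r + 1. *)
have [v1 v2] := path_variation g j; have [v3 v4] := path_variation (fun i => g (j + i)%N) (n - j).
have S : (\sum_(i < n) ((g i - g i.+1) + (g i.+1 - g i)) =
  \sum_(i < j) ((g i - g i.+1) + (g i.+1 - g i)) +
  \sum_(i < n - j) ((g (j + i) - g (j + i.+1)) + (g (j + i.+1) - g (j + i))))%N.
  have -> : (\sum_(i < n) ((g i - g i.+1) + (g i.+1 - g i)) =
    \sum_(i < j + (n - j)) ((g i - g i.+1) + (g i.+1 - g i)))%N by rewrite subnKC // ltnW.
  by rewrite big_split_ord /=; congr addn; apply: eq_bigr => i _; rewrite addnS.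
have gj : (0 < g j <= r)%N.
  move: S v1 v2 v3 v4 g_var g_end; rewrite addn0 subnKC; last exact: ltnW.
  by move: (\sum_(i < n) _)%N (\sum_(i < j) _)%N (\sum_(i < n - j) _)%N; lia.
case/andP: gj => gj0 gjr; rewrite /gap_wall gj0 wallE prednK // gjr /=.
apply/asboolP; rewrite /on_wall E; congr (loop_point _ _ _%:~R); lia.
Qed.

Lemma rk_hatT_parity r : (rk (hatT_div p0 r xi) = r%:Z %[mod 2])%Z.
Proof.
have ge_m1 := rk_ge_m1 (hatT_div p0 r xi).
apply: contrapT => ne.
(* If the parity were wrong, r' = rk + 1 would have the parity of r and define the same divisor. The
   dichotomy for r' gives either rank at least r' or rank less than r' - 1, both false. *)
pose r' := absz (rk (hatT_div p0 r xi) + 1).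
have r'E : r'%:Z = rk (hatT_div p0 r xi) + 1 by rewrite /r'; lia.
have hE : hatT_div p0 r' xi = hatT_div p0 r xi.
  by rewrite -(hatT_odd p0 r') -(hatT_odd p0 r); have -> : odd r' = odd r by lia.
have [/greedy_rank_ge|[r'0]] := strands_or_barrier r'; rewrite hE.
  by move=> /(rk_ge p0); lia.
by case; apply/(rk_ge p0); lia.
Qed.

End Dichotomy.

(** * Generic loops and the union of the tori *)

Section Main.
Context {R : realType} {n : nat} (Gamma : loop_of_loops R n).
Local Notation L := (dcover Gamma).
Local Notation G := (lol_graph L).
Variable p0 : gpoint G.
Hypothesis hp0 : in_first_bridge p0.
Implicit Types (j : 'I_n) (r : nat) (xi : 'I_(n + n) -> R).

Lemma torsion_order_le j (k : nat) (z : int) : (0 < k)%N ->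
  k%:R * vw_len Gamma j = z%:~R * loop_len Gamma j ->
  (0 < torsion_order Gamma j <= k)%N.
Proof.
move=> k0 E; rewrite /torsion_order asboolF.
  pose T (m : nat) := (0 < m)%N /\
    exists z : int, m%:R * vw_len Gamma j = z%:~R * loop_len Gamma j.
  have exT : exists m, `[< T m >] by exists k; apply/asboolP; split=> //; exists z.
  case: xgetP => [m -> [[m0 _] mmin]|none]; first by rewrite m0 mmin //; split=> //; exists z.
  case: (ex_minnP exT) => m /asboolP Tm mmin; case: (none m); split=> // k' Tk'.
  by apply: mmin; apply/asboolP.
move=> H; apply: H; apply/rationalP; exists z, k.
have l0 : loop_len Gamma j != 0 by rewrite gt_eqF // loop_len_gt0.
have k0' : k%:R != 0 :> R by rewrite pnatr_eq0 -lt0n.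
by apply: (mulfI k0'); rewrite mulrA E mulfK // mulrC mulfVK.
Qed.

(** Two walls i < i' on one loop show that its torsion order is positive and at most i' - i < r. *)
Lemma generic_wall r xi j (i i' : nat) : generic Gamma r ->
  wall Gamma xi r j i -> wall Gamma xi r j i' -> i = i'.
Proof.
move=> gen; wlog lt : i i' / (i < i')%N.
  move=> H w w'; have [lt|lt|//] := ltngtP i i'; first exact: H.
  by apply/esym/H.
rewrite !wallE => /andP[_ /asboolP w] /andP[i'r /asboolP w'].
have [z] := on_wall_diff w' w; rewrite subzn; last exact: ltnW.
rewrite -pmulrn => E; have /andP[t0 tle] := torsion_order_le (k := i' - i) (ltac:(lia)) E.
by case: (gen j); lia.
Qed.

(** The partial products of the subword serve as strand positions, each letter being a swap at a
    wall. *)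
Lemma word_rank_ge r (Q : lingering_word r n) xi : prym_coords Gamma xi ->
  contains_w0 Q ->
  (forall j (i : 'I_r), tnth Q j = Some i ->
     loop_point L (lshift n j) (xi (lshift n j)) =
     loop_point L (lshift n j) (slope r (lshift n j) i)%:~R) ->
  rank_ge (hatT_div p0 r xi) r.
Proof.
move=> hx [u [su _ pu]] HQ; have [P [P0 Pn PS]] := subseq_strands 1%g su.
rewrite size_tuple mul1g pu in Pn.
apply: (strands_rank_ge hp0 hx (p := fun k x => P k x)).
- by move=> x; rewrite P0 perm1.
- by move=> x; rewrite Pn permE /= subSS.
- by move=> m _ x y /val_inj /perm_inj.
move=> j x; case: (PS j) => [->|[i Qi ->]]; first by constructor 1.
have {Qi} w : on_wall Gamma xi r j i.
  by rewrite /on_wall -(slope_l _ j); apply: HQ; rewrite (tnth_nth None).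
rewrite permM !slope_l tauE /loop_step; case: (eqVneq (P j x : nat) i) => [->|_].
  by constructor 2; split=> //; lia.
case: (eqVneq (P j x : nat) i.+1) => [->|_]; last by constructor 1.
by constructor 3; split=> //; lia.
Qed.

Definition wall_word r xi : lingering_word r n :=
  [tuple [pick i : 'I_r | wall Gamma xi r j i] | j < n].

Lemma wall_wordE r xi (m i : nat) : generic Gamma r ->
  wall Gamma xi r m i = (omap (@nat_of_ord r) (nth None (wall_word r xi) m) == Some i).
Proof.
move=> gen; have [mn|nm] := ltnP m n; last first.
  rewrite nth_default ?size_tuple //; apply/negP => /wall_ord[j E].
  by have := ltn_ord j; rewrite -E; lia.
rewrite -[m]/(nat_of_ord (Ordinal mn)) -tnth_nth tnth_mktuple.
case: pickP => [i' w'|none] /=.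
  apply/idP/eqP => [w|[<-]//]; congr Some; exact: generic_wall gen w' w.
by apply/negP => w; have := none (Ordinal (wall_lt w)); rewrite w.
Qed.

Lemma prym_BN_word_torus r : generic Gamma r ->
  prym_BN Gamma r =
    \bigcup_(Q in [set Q : lingering_word r n | contains_w0 Q]) word_torus p0 Q.
Proof.
move=> gen; apply/seteqP; split=> c.
  case=> -[D0 hD0 cD0] [D [cD rD pD]].
  have [eps [xi [hx D0T]]] := prym_normal_form hp0 hD0.
  have DT : lin_equiv D (hatT_div p0 eps xi).
    by apply: lin_equiv_trans D0T; apply/pic_eqP; rewrite -cD -cD0.
  have rkT := rk_equiv DT; have par := rk_hatT_parity hp0 hx eps.
  (* The rank has the parity of [eps] by [rk_hatT_parity] and that of r by assumption. *)
  have epsE : eps = odd r by case: (eps) par rkT => par rkT; lia.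
  rewrite epsE hatT_odd in DT rkT.
  have rk_r : rank_ge (hatT_div p0 r xi) r by apply/(rk_ge p0); rewrite -rkT.
  have [gn|[r0 nrk]] := strands_or_barrier hp0 hx r; last first.
    by case: nrk; apply: (rank_ge_le p0 _ rk_r); apply: leq_pred.
  exists (wall_word r xi).
    by apply: greedy_contains_w0 gn => m i; apply: wall_wordE.
  exists xi; last by rewrite cD; apply/pic_eqP/lin_equiv_sym.
  split=> // j i; rewrite tnth_mktuple; case: pickP => // i' w' [<-].
  by move: w'; rewrite wallE slope_l => /andP[_ /asboolP].
case=> Q Qw0 [xi [hx HQ] <-]; split.
  by exists (hatT_div p0 r xi) => //=; apply/pic_eqP; apply: norm_hatT.
exists (hatT_div p0 r xi); split=> //; last exact: rk_hatT_parity.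
by apply/(rk_ge p0); apply: word_rank_ge HQ.
Qed.

End Main.

Theorem theorem4p6 (R : realType) (g r : nat) (hg : (2 <= g)%N)
    (hr : (1 <= r)%N) (Gamma : loop_of_loops R g.-1)
    (hgen : generic Gamma r)
    (p0 : gpoint (lol_graph (dcover Gamma))) (hp0 : in_first_bridge p0) :
  prym_BN Gamma r =
    \bigcup_(Q in [set Q : lingering_word r g.-1 | contains_w0 Q])
      word_torus p0 Q.
Proof. exact: prym_BN_word_torus. Qed.
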